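(* Let $\Lambda$ be a countable group and let $\Delta : \mathrm{L}\Lambda \to \mathrm{L}\Lambda \,\overline{\otimes}\, \mathrm{L}\Lambda$ be the comultiplication. Suppose that $\Omega \in \mathrm{L}\Lambda \,\overline{\otimes}\, \mathrm{L}\Lambda$ is a unitary satisfying $$\Omega_{21} = \mu\,\Omega \quad\text{and}\quad (\Delta \otimes \mathrm{id})(\Omega)\,(\Omega \otimes 1) = \eta\,(\mathrm{id} \otimes \Delta)(\Omega)\,(1 \otimes \Omega)$$ for some $\mu,\eta \in \mathbb{T}$. Then $\mu = \eta = 1$ and there exists a unitary $w \in \mathrm{L}\Lambda$ such that $$\Omega = \Delta(w^* )(w \otimes w) .$$
   Context: $\mathrm{L}\Lambda$ is the group von Neumann algebra of $\Lambda$ with canonical unitaries $(v_s)_{s\in\Lambda}$. The comultiplication $\Delta$ is the normal unital $*$-homomorphism determined by $\Delta(v_s) = v_s \otimes v_s$ for all $s\in\Lambda$. $\Omega_{21} = \sigma(\Omega)$, where $\sigma(x\otimes y) = y \otimes x$ is the flip automorphism of $\mathrm{L}\Lambda\,\overline{\otimes}\,\mathrm{L}\Lambda$. $\mathbb{T}$ is the circle group. *)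

(* Defs.v *)
From HB Require Import structures.
From mathcomp Require Import all_boot all_order all_algebra.
From mathcomp Require Import complex.
From mathcomp Require Import all_classical all_reals all_analysis.
From mathcomp Require Import ring.

Set Implicit Arguments.
Unset Strict Implicit.
Unset Printing Implicit Defensive.

Import Order.TTheory GRing.Theory Num.Theory numFieldNormedType.Exports.
Import Normc.

Local Open Scope classical_set_scope.
Local Open Scope ring_scope.

Section Sums.
Context {R : realType} {I : choiceType}.

(* Unordered sums, meaningful for absolutely summable families. *)
Definition rsum (f : I -> R) : R :=
  fine (\esum_(i in [set: I]) ((EFin \o f)^\+ i)%E) -
  fine (\esum_(i in [set: I]) ((EFin \o f)^\- i)%E).

Definition csum (f : I -> R[i]) : R[i] :=
  Complex (rsum (fun i => complex.Re (f i))) (rsum (fun i => complex.Im (f i))).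

Definition sqsum (f : I -> R[i]) : \bar R :=
  \esum_(i in [set: I]) (normc (f i) ^+ 2)%:E.

End Sums.

Section SqsumTheory.
Context {R : realType}.

Let normc_sqrE (z : R[i]) :
  normc z ^+ 2 = complex.Re z ^+ 2 + complex.Im z ^+ 2.
Proof. by case: z => a b /=; rewrite sqr_sqrtr ?addr_ge0 ?sqr_ge0. Qed.

Let sqr_normcD (a b : R[i]) :
  normc (a + b) ^+ 2 <= 2 * normc a ^+ 2 + 2 * normc b ^+ 2.
Proof.
case: a b => [a1 a2] [b1 b2]; rewrite !normc_sqrE /=.
rewrite -subr_ge0 [X in 0 <= X](_ : _ = (a1 - b1) ^+ 2 + (a2 - b2) ^+ 2).
  by rewrite addr_ge0 ?sqr_ge0.
by rewrite !sqrrD sqrrN sqrrN !mulrN !mulrDr !mulr2n !mulrDl !mul1r; ring.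
Qed.

Lemma sqsum_ge0 (I : choiceType) (f : I -> R[i]) : (0 <= sqsum f)%E.
Proof. by apply: esum_ge0 => i _; rewrite lee_fin sqr_ge0. Qed.

Lemma sqsum0 (I : choiceType) : sqsum (0 : I -> R[i]) = 0%E.
Proof.
apply: esum1 => i _; rewrite [normc _](_ : _ = 0) ?expr0n//.
exact: normc0.
Qed.

Lemma sqsumZ (I : choiceType) (a : R[i]) (f : I -> R[i]) :
  (sqsum (a *: f) <= (normc a ^+ 2)%:E * sqsum f)%E.
Proof.
apply: ge_ereal_sup => _ /= [A [finA _] <-].
apply: (@le_trans _ _
  ((normc a ^+ 2)%:E * \sum_(i \in A) (normc (f i) ^+ 2)%:E)%E).
  rewrite ge0_mule_fsumr => [|i]; last by rewrite lee_fin sqr_ge0.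
  by under eq_fsbigr do rewrite normcM exprMn EFinM.
rewrite lee_wpmul2l ?lee_fin ?sqr_ge0 //.
by apply: ereal_sup_ubound; exists A.
Qed.

Lemma sqsumD (I : choiceType) (f g : I -> R[i]) :
  (sqsum (f + g)%R <= 2%:E * sqsum f + 2%:E * sqsum g)%E.
Proof.
have s2 h : (2%:E * sqsum h = sqsum h + sqsum h :> \bar R)%E.
  by rewrite -[2%R]/(1 + 1)%R EFinD ge0_muleDl ?mul1e.
have nn (h : I -> R[i]) i : [set: I] i -> (0 <= (normc (h i) ^+ 2)%:E :> \bar R)%E.
  by rewrite lee_fin sqr_ge0.
rewrite !s2 /sqsum -!esumD; do ?[exact: nn]; last 2 first.
- by move=> i Ii; rewrite adde_ge0 ?nn.
- by move=> i Ii; rewrite adde_ge0 ?nn.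
apply: le_esum => i _; rewrite -!EFinD lee_fin.
by have := sqr_normcD (f i) (g i); rewrite !mulr_natl !mulr2n.
Qed.

Lemma sqsum_inj (I J : choiceType) (e : J -> I) (f : I -> R[i]) :
  injective e -> (sqsum (f \o e) <= sqsum f)%E.
Proof.
move=> einj; rewrite /sqsum.
rewrite -(@reindex_esum R J I setT (range e) e (fun i => (normc (f i) ^+ 2)%:E)).
  rewrite esum_mkcond; apply: le_esum => i _.
  by case: ifP => // _; rewrite lee_fin sqr_ge0.
split=> [j _|j k _ _ /einj //|_ [j _ <-]]; first by exists j.
by exists j.
Qed.

Lemma sqsum_prod (I J : choiceType) (f : I -> R[i]) (g : J -> R[i]) :
  (sqsum f < +oo -> sqsum g < +oo ->
   sqsum (fun p : I * J => f p.1 * g p.2)%R < +oo)%E.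
Proof.
move=> foo goo; pose c := fine (sqsum g).
have cE : sqsum g = c%:E.
  by rewrite fineK // ge0_fin_numE // sqsum_ge0.
apply: (@le_lt_trans _ _ (c%:E * sqsum f)%E); last first.
  by rewrite lte_mul_pinfty ?lee_fin ?fine_ge0 ?sqsum_ge0.
rewrite /sqsum.
rewrite [X in (X <= _)%E](_ : _ = \esum_(i in [set: I]) \esum_(j in [set: J])
   (normc (f i * g j) ^+ 2)%:E); last first.
  rewrite (@esum_esum R I J setT (fun=> setT)
    (fun i j => (normc (f i * g j) ^+ 2)%:E)).
    by congr esum; apply/seteqP; split.
  by move=> i j _ _; rewrite lee_fin sqr_ge0.
apply: ge_ereal_sup => _ /= [A [finA _] <-].
apply: (@le_trans _ _
  (c%:E * \sum_(i \in A) (normc (f i) ^+ 2)%:E)%E).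
  rewrite ge0_mule_fsumr => [|i]; last by rewrite lee_fin sqr_ge0.
  rewrite lee_fsum// => i _; rewrite muleC -cE.
  apply: le_trans (sqsumZ (f i) g).
  by rewrite /sqsum.
rewrite lee_wpmul2l ?lee_fin ?fine_ge0 ?sqsum_ge0 //.
by apply: ereal_sup_ubound; exists A.
Qed.

End SqsumTheory.

Section Ell2.
Variables (R : realType) (X : choiceType).

Definition is_ell2 : {pred X -> R[i]} := fun f => `[< (sqsum f < +oo)%E >].

Record ell2 := Ell2 { ell2_fun :> X -> R[i]; ell2P : ell2_fun \in is_ell2 }.

HB.instance Definition _ := [isSub for ell2_fun].
HB.instance Definition _ := [Choice of ell2 by <:].

Lemma is_ell2_submod : submod_closed is_ell2.
Proof.
split=> [|a f g]; first by apply/asboolP; rewrite sqsum0 ltry.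
move=> /asboolP foo /asboolP goo; apply/asboolP.
apply: le_lt_trans (sqsumD _ _) _.
apply: lte_add_pinfty; apply: lte_mul_pinfty; rewrite ?lee_fin //.
apply: le_lt_trans (sqsumZ _ _) _.
by apply: lte_mul_pinfty; rewrite ?lee_fin ?sqr_ge0.
Qed.

HB.instance Definition _ := GRing.isSubmodClosed.Build _ _ is_ell2
  is_ell2_submod.
HB.instance Definition _ := [SubChoice_isSubLmodule of ell2 by <:].

End Ell2.

Section Ell2Theory.
Variable R : realType.

Definition l2norm (X : choiceType) (xi : ell2 R X) : R :=
  Num.sqrt (fine (sqsum xi)).

(* The inner product, linear in the first variable. *)
Definition dotp (X : choiceType) (xi eta : ell2 R X) : R[i] :=
  csum (fun x => xi x * conjc (eta x)).

Definition pullback (X Y : choiceType) (e : Y -> X) (einj : injective e)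
  (xi : ell2 R X) : ell2 R Y :=
  Ell2 (asboolT (le_lt_trans (sqsum_inj xi einj) (asboolW (ell2P xi)))).

Definition tensv (X Y : choiceType) (xi : ell2 R X) (eta : ell2 R Y) :
    ell2 R (X * Y)%type :=
  Ell2 (asboolT (sqsum_prod (asboolW (ell2P xi)) (asboolW (ell2P eta)))).

Lemma sqsumE (X : choiceType) (xi : ell2 R X) :
  sqsum xi = (l2norm xi ^+ 2)%:E.
Proof.
rewrite sqr_sqrtr ?fine_ge0 ?sqsum_ge0// fineK// ge0_fin_numE ?sqsum_ge0//.
exact: asboolW (ell2P xi).
Qed.

End Ell2Theory.

Section BoundedOperators.
Variables (R : realType) (X : choiceType).

Definition bounded_op (T : ell2 R X -> ell2 R X) : Prop :=
  exists M : R, forall xi, l2norm (T xi) <= M * l2norm xi.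

Definition is_bop : {pred ell2 R X -> ell2 R X} :=
  fun T => `[< linear T /\ bounded_op T >].

(* The bounded linear operators on l^2(X). *)
Record bop := Bop { bop_fun :> ell2 R X -> ell2 R X; bopP : bop_fun \in is_bop }.

HB.instance Definition _ := [isSub for bop_fun].
HB.instance Definition _ := [Choice of bop by <:].

Lemma bounded_opP T : bounded_op T <->
  exists2 M : R, 0 <= M & forall xi, (sqsum (T xi) <= M%:E * sqsum xi)%E.
Proof.
split=> [[M TM]|[M M0 TM]].
  exists (M ^+ 2); rewrite ?sqr_ge0// => xi.
  rewrite !sqsumE -EFinM lee_fin -exprMn ler_pXn2r ?nnegrE ?sqrtr_ge0//.
  exact: le_trans (sqrtr_ge0 _) (TM xi).
exists (Num.sqrt M) => xi.
have := TM xi; rewrite !sqsumE -EFinM lee_fin => {}TM.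
rewrite -(@ler_pXn2r _ 2) ?nnegrE ?mulr_ge0 ?sqrtr_ge0//.
by rewrite exprMn [Num.sqrt M ^+ 2]sqr_sqrtr.
Qed.

Lemma is_bop_submod : submod_closed is_bop.
Proof.
split=> [|a S T].
  apply/asboolP; split; first by move=> a x y; rewrite -[RHS]/(a *: 0 + 0) scaler0 addr0.
  apply/bounded_opP; exists 0 => // xi.
  by rewrite mul0e (_ : sqsum _ = 0%E)// sqsum0.
move=> /asboolP[linS /bounded_opP[M M0 SM]].
move=> /asboolP[linT /bounded_opP[N N0 TN]].
apply/asboolP; split.
  move=> b x y; rewrite -[LHS]/(a *: S (b *: x + y) + T (b *: x + y)).
  rewrite -[RHS]/(b *: (a *: S x + T x) + (a *: S y + T y)).
  rewrite linS linT !scalerDr addrACA.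
  by congr (_ + _ + _); rewrite !scalerA mulrC.
apply/bounded_opP; exists (2 * (normc a ^+ 2 * M) + 2 * N) => [|xi].
  by rewrite addr_ge0// mulr_ge0// mulr_ge0// sqr_ge0.
apply: le_trans (sqsumD _ _) _.
rewrite (EFinD (2 * (normc a ^+ 2 * M)) (2 * N)) [leRHS]ge0_muleDl; last 2 first.
- by rewrite lee_fin mulr_ge0// mulr_ge0// sqr_ge0.
- by rewrite lee_fin mulr_ge0.
rewrite (EFinM 2 (_ * M)) (EFinM _ M) (EFinM 2 N) -!muleA.
apply: leeD; apply: lee_wpmul2l; rewrite ?lee_fin//; last exact: TN.
apply: le_trans (sqsumZ _ _) _.
by apply: lee_wpmul2l; [rewrite lee_fin sqr_ge0|exact: SM].
Qed.

HB.instance Definition _ := GRing.isSubmodClosed.Build _ _ is_bop is_bop_submod.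
HB.instance Definition _ := [SubChoice_isSubLmodule of bop by <:].

Lemma bop_linear (T : bop) : linear T.
Proof. by have /asboolP[] := bopP T. Qed.

HB.instance Definition _ (T : bop) :=
  GRing.isLinear.Build R[i] (ell2 R X) (ell2 R X) *:%R T (@bop_linear T).

Lemma bop_bounded (T : bop) : bounded_op T.
Proof. by have /asboolP[] := bopP T. Qed.

Lemma bop1_subproof : idfun \in is_bop.
Proof.
by apply/asboolP; split=> //; exists 1 => xi; rewrite mul1r.
Qed.

Lemma bopM_subproof (S T : bop) : S \o T \in is_bop.
Proof.
apply/asboolP; split=> [a x y|]; first by rewrite /= !linearP.
have /bounded_opP[M M0 SM] := bop_bounded S.
have /bounded_opP[N N0 TN] := bop_bounded T.
apply/bounded_opP; exists (M * N) => [|xi]; first exact: mulr_ge0.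
apply: le_trans (SM _) _.
by rewrite EFinM -muleA lee_wpmul2l ?lee_fin.
Qed.

Definition bop1 : bop := Bop bop1_subproof.
Definition bopM (S T : bop) : bop := Bop (bopM_subproof S T).

Lemma bopMA : associative bopM. Proof. by move=> S T U; apply: val_inj. Qed.
Lemma bop1M : left_id bop1 bopM. Proof. by move=> T; apply: val_inj. Qed.
Lemma bopM1 : right_id bop1 bopM. Proof. by move=> T; apply: val_inj. Qed.
Lemma bopMDl : left_distributive bopM +%R.
Proof. by move=> S T U; apply: val_inj. Qed.
Lemma bopMDr : right_distributive bopM +%R.
Proof.
by move=> S T U; apply: val_inj; apply/funext => xi /=; rewrite linearD.
Qed.

HB.instance Definition _ :=
  GRing.Zmodule_isPzRing.Build bop bopMA bop1M bopM1 bopMDl bopMDr.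

(* The choice is unique, and the set is nonempty by the Riesz theorem. *)
Definition adj (T : bop) : bop :=
  xget 0 [set S : bop | forall xi eta, dotp (T xi) eta = dotp xi (S eta)].

Definition unitary (U : bop) : Prop := adj U * U = 1 /\ U * adj U = 1.

Definition commutant (S : set bop) : set bop :=
  [set T | forall A, S A -> T * A = A * T].

(* The von Neumann algebra generated by S when S is closed under adj, as is the
   case for every generating set used below. *)
Definition bicommutant (S : set bop) : set bop := commutant (commutant S).

(* The functionals T |-> sum_n <T xi_n, eta_n> with xi, eta square-summable,
   i.e., the elements of the predual of B(l^2(X)). *)
Definition normal_functional (omega : bop -> R[i]) : Prop :=
  exists xi eta : nat -> ell2 R X,
    [/\ (\esum_(n in [set: nat]) (l2norm (xi n) ^+ 2)%:E < +oo)%E,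
        (\esum_(n in [set: nat]) (l2norm (eta n) ^+ 2)%:E < +oo)%E &
        forall T, omega T = csum (fun n => dotp (T (xi n)) (eta n))].

(* Convergence of the filter F to T in the ultraweak topology. *)
Definition uw_cvg (F : set_system bop) (T : bop) : Prop :=
  forall omega, normal_functional omega ->
    omega S @[S --> F] --> (omega T : R[i]^o).

End BoundedOperators.

Section Reindexing.
Variable R : realType.

Lemma pullback_linear (X Y : choiceType) (e : Y -> X) (einj : injective e) :
  linear (pullback einj : ell2 R X -> ell2 R Y).
Proof. by move=> a x y; apply: val_inj. Qed.

Lemma sqsum_pullback (X Y : choiceType) (e : Y -> X) (einj : injective e)
  (xi : ell2 R X) : (sqsum (pullback einj xi) <= sqsum xi)%E.
Proof. exact: sqsum_inj. Qed.

Lemma pullback_bop (X : choiceType) (e : X -> X) (einj : injective e) :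
  pullback einj \in @is_bop R X.
Proof.
apply/asboolP; split; first exact: pullback_linear.
by apply/bounded_opP; exists 1 => // xi; rewrite mul1e sqsum_pullback.
Qed.

Lemma conj_bop_subproof (X Y : choiceType) (e : Y -> X) (e' : X -> Y)
  (einj : injective e) (e'inj : injective e') (T : bop R X) :
  pullback einj \o T \o pullback e'inj \in @is_bop R Y.
Proof.
apply/asboolP; split=> [a x y|].
  by rewrite /= !(pullback_linear, linearP).
have /bounded_opP[M M0 TM] := bop_bounded T.
apply/bounded_opP; exists M => // xi.
apply: le_trans (sqsum_pullback einj (T (pullback e'inj xi))) _.
apply: le_trans (TM (pullback e'inj xi)) _.
by rewrite lee_wpmul2l ?lee_fin ?sqsum_pullback.
Qed.

(* The conjugation of T by the unitary l^2(X) -> l^2(Y) given by a bijection. *)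
Definition conj_bop (X Y : choiceType) (e : Y -> X) (e' : X -> Y)
  (eK : cancel e e') (e'K : cancel e' e) (T : bop R X) : bop R Y :=
  Bop (conj_bop_subproof (can_inj eK) (can_inj e'K) T).

Definition swap (X Y : Type) (p : X * Y) : Y * X := (p.2, p.1).
Lemma swapK (X Y : Type) : cancel (@swap X Y) (@swap Y X).
Proof. by case. Qed.

Definition reassocl (X Y Z : Type) (p : X * (Y * Z)) : X * Y * Z :=
  (p.1, p.2.1, p.2.2).
Definition reassocr (X Y Z : Type) (p : X * Y * Z) : X * (Y * Z) :=
  (p.1.1, (p.1.2, p.2)).
Lemma reassoclK (X Y Z : Type) : cancel (@reassocl X Y Z) (@reassocr X Y Z).
Proof. by case=> ? []. Qed.
Lemma reassocrK (X Y Z : Type) : cancel (@reassocr X Y Z) (@reassocl X Y Z).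
Proof. by case=> [] []. Qed.

(* Conjugation by xi (x) eta |-> eta (x) xi, so that x (x) y |-> y (x) x. *)
Definition flip (X Y : choiceType) : bop R (X * Y)%type -> bop R (Y * X)%type :=
  conj_bop (@swapK Y X) (@swapK X Y).

(* The identification of A (x) (B (x) C) with (A (x) B) (x) C. *)
Definition assoc (X Y Z : choiceType) :
    bop R (X * (Y * Z))%type -> bop R (X * Y * Z)%type :=
  conj_bop (@reassocrK X Y Z) (@reassoclK X Y Z).

End Reindexing.

Section Tensors.
Variable R : realType.

(* The operator x (x) y on l^2(X) (x) l^2(Y) = l^2(X * Y); it exists and is
   unique because simple tensors span a dense subspace. *)
Definition tens (X Y : choiceType) (x : bop R X) (y : bop R Y) :
    bop R (X * Y)%type :=
  xget 0 [set T : bop R (X * Y)%type |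
    forall xi eta, T (tensv xi eta) = tensv (x xi) (y eta)].

Definition vtens (X Y : choiceType) (M : set (bop R X)) (N : set (bop R Y)) :
    set (bop R (X * Y)%type) :=
  bicommutant [set tens x y | x in M & y in N].

(* Homomorphisms M -> N are total maps that are constrained on M only. *)
Definition star_hom (X Y : choiceType) (M : set (bop R X)) (N : set (bop R Y))
    (phi : bop R X -> bop R Y) : Prop :=
  [/\ forall x, M x -> N (phi x),
      forall a x y, M x -> M y -> phi (a *: x + y) = a *: phi x + phi y,
      forall x y, M x -> M y -> phi (x * y) = phi x * phi y &
      forall x, M x -> phi (adj x) = adj (phi x)].

(* Ultraweak continuity of the restriction of phi to M. *)
Definition normal_on (X Y : choiceType) (M : set (bop R X))
    (phi : bop R X -> bop R Y) : Prop :=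
  forall (F : set_system (bop R X)) (T : bop R X),
    Filter F -> F M -> M T -> uw_cvg F T -> uw_cvg (phi @ F) (phi T).

Definition normal_unital_star_hom (X Y : choiceType) (M : set (bop R X))
    (N : set (bop R Y)) (phi : bop R X -> bop R Y) : Prop :=
  [/\ star_hom M N phi, phi 1 = 1 & normal_on M phi].

(* Phi is the normal homomorphism phi (x) psi : M (x) N -> M' (x) N'. *)
Definition tensor_hom (X Y X' Y' : choiceType)
    (M : set (bop R X)) (N : set (bop R Y))
    (M' : set (bop R X')) (N' : set (bop R Y'))
    (phi : bop R X -> bop R X') (psi : bop R Y -> bop R Y')
    (Phi : bop R (X * Y)%type -> bop R (X' * Y')%type) : Prop :=
  normal_unital_star_hom (vtens M N) (vtens M' N') Phi /\
  forall x y, M x -> N y -> Phi (tens x y) = tens (phi x) (psi y).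

End Tensors.

Section GroupVonNeumannAlgebra.
Variables (R : realType) (G : groupType).

(* The left regular representation, (v_s xi)(t) = xi (s^-1 t). *)
Definition lreg (s : G) : bop R G := Bop (pullback_bop R (mulgI (s^-1)%g)).

Definition group_vN : set (bop R G) := bicommutant (range lreg).

Definition comultiplication (Delta : bop R G -> bop R (G * G)%type) : Prop :=
  normal_unital_star_hom group_vN (vtens group_vN group_vN) Delta /\
  forall s, Delta (lreg s) = tens (lreg s) (lreg s).

End GroupVonNeumannAlgebra.

Arguments group_vN : clear implicits.

Notation "x \ox y" := (tens x y) (at level 40, left associativity) : ring_scope.
Notation "M \vox N" := (vtens M N) (at level 40, left associativity) :
  classical_set_scope.

(* Main.v *)
(* Let W be the fundamental unitary, W (delta_s (x) delta_t) =
   delta_s (x) delta_(st), so that Delta x = W (x (x) 1) W^*, and put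
   X = Y W with Y = Omega^*.  The cocycle identity and the pentagon equation give
     X_12 X_13 = eta^-1 Y_23 W_23 X_12 W_23^*,
   and flipping the last two legs, X_13 X_12 = conj(mu) X_12 X_13.  Hence the
   slices K = (id (x) omega)(X) satisfy K^* K = conj(mu) K K^*, which forces
   mu = 1, and then the slices commute with each other and with their adjoints.
   Since the matrix of such a slice consists of Fourier coefficients of Y, it
   is Hilbert-Schmidt when omega is a matrix coefficient at basis vectors.  A
   commuting family of normal Hilbert-Schmidt operators has a common eigenvector
   v, and X (v (x) z) = v (x) w z for a unitary w in LG.  Applied to v, the
   identity above reads w (x) w = eta^-1 Y Delta w, so Omega is a
   coboundary up to eta, and the cocycle identity then gives eta = 1. *)

Require Import Defs.
From HB Require Import structures.
From mathcomp Require Import all_boot all_order all_algebra.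
From mathcomp Require Import complex.
From mathcomp Require Import all_classical all_reals all_analysis.
From mathcomp Require Import ring lra.

Set Implicit Arguments.
Unset Strict Implicit.
Unset Printing Implicit Defensive.

Import Order.TTheory GRing.Theory Num.Theory numFieldNormedType.Exports.
Local Open Scope classical_set_scope.
Local Open Scope ring_scope.

(** * Unordered sums *)

Section UnorderedSums.
Context {R : realType}.
Implicit Types (I J : choiceType).

(** [Delta], [Delta_id] and [id_Delta] are known only through normality and their values on
    generators. The formulas implementing them by W are therefore checked on generators and carried
    to the bicommutants by von Neumann's density argument; then the cocycle hypothesis is an
    identity between concrete operators on l^2(G x G x G).

    Flipping the last two legs alters only the factor Y_23: conjugated by W_23, the flip becomes a
    right translation of the second leg controlled by the third, and the second legs of Y and of W
    both commute with right translations.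

    The factor W makes the slices Hilbert-Schmidt: the matrix of a slice of X lists coordinates of
    the single vector Y(delta_1 (x) delta_1) along an injective indexing.

    The spectral theory rests on two estimates. The Hilbert-Schmidt norm keeps the iterates of a
    norm-one self-adjoint operator from dying out on every basis vector, which yields a top
    eigenvector. Its square is additive on orthogonal projections and at least 1 on nonzero ones, so
    a projection commuting with the family shrinks only finitely often, and the family acts by
    scalars on a minimal one. *)

Definition rsummable I (f : I -> R) : Prop :=
  (\esum_(i in [set: I]) `|f i|%:E < +oo)%E.

Definition csummable I (f : I -> R[i]) : Prop :=
  (\esum_(i in [set: I]) (Normc.normc (f i))%:E < +oo)%E.

Lemma rsummableD I (f g : I -> R) :
  rsummable f -> rsummable g -> rsummable (fun i => f i + g i).
Proof.
move=> sf sg; apply: le_lt_trans (lte_add_pinfty sf sg).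
rewrite -esumD; [|by move=> *; rewrite lee_fin..].
by apply: le_esum => i _; rewrite -EFinD lee_fin ler_normD.
Qed.

Lemma rsummableZ I (a : R) (f : I -> R) :
  rsummable f -> rsummable (fun i => a * f i).
Proof.
move=> sf; have aoo : (`|a|%:E * (\esum_(i in [set: I]) `|f i|%:E) < +oo)%E.
  by rewrite lte_mul_pinfty// lee_fin.
apply: le_lt_trans aoo; apply: ge_ereal_sup => _ /= [A [finA _] <-].
under eq_fsbigr do rewrite normrM EFinM.
rewrite -ge0_mule_fsumr => [|i]; last by rewrite lee_fin.
by rewrite lee_wpmul2l ?lee_fin//; apply: ereal_sup_ubound; exists A.
Qed.

Lemma rsummableN I (f : I -> R) :
  rsummable f -> rsummable (fun i => - f i).
Proof. by move=> sf; rewrite /rsummable; under eq_esum do rewrite normrN. Qed.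

(** [fine] sends an infinite sum to 0, so this is the true value only for summable [u]. *)
Definition nsum I (u : I -> R) : R := fine (\esum_(i in [set: I]) (u i)%:E).

Lemma nsumE I (u : I -> R) : (forall i, 0 <= u i) -> rsummable u ->
  \esum_(i in [set: I]) (u i)%:E = (nsum u)%:E.
Proof.
move=> u0 su; rewrite /nsum fineK// ge0_fin_numE; last first.
  by apply: esum_ge0 => i _; rewrite lee_fin.
apply: le_lt_trans su; apply: le_esum => i _.
by rewrite lee_fin ler_norm.
Qed.

Lemma nsum_ge0 I (u : I -> R) : (forall i, 0 <= u i) -> 0 <= nsum u.
Proof. by move=> u0; rewrite fine_ge0// esum_ge0// => i _; rewrite lee_fin. Qed.

Lemma nsumD I (u v : I -> R) : (forall i, 0 <= u i) -> (forall i, 0 <= v i) ->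
  rsummable u -> rsummable v -> nsum (fun i => u i + v i) = nsum u + nsum v.
Proof.
move=> u0 v0 su sv; apply: EFin_inj.
rewrite EFinD -!nsumE//; last 2 first.
- by move=> i; rewrite addr_ge0.
- exact: rsummableD.
by rewrite -esumD; [|by move=> *; rewrite lee_fin..].
Qed.

Definition pospart I (f : I -> R) i := Num.max (f i) 0.
Definition negpart I (f : I -> R) i := Num.max (- f i) 0.

Lemma pospart_ge0 I (f : I -> R) i : 0 <= pospart f i.
Proof. by rewrite le_max lexx orbT. Qed.

Lemma negpart_ge0 I (f : I -> R) i : 0 <= negpart f i.
Proof. by rewrite le_max lexx orbT. Qed.

Lemma posnegE I (f : I -> R) i : f i = pospart f i - negpart f i.
Proof.
rewrite /pospart /negpart.
case: (lerP 0 (f i)) => h.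
  by rewrite ?[Num.max (- _) 0]max_r; lra.
by rewrite ?[Num.max (- _) 0]max_l; lra.
Qed.

Lemma rsummable_pospart I (f : I -> R) : rsummable f -> rsummable (pospart f).
Proof.
apply: le_lt_trans; apply: le_esum => i _; rewrite lee_fin.
by rewrite ger0_norm ?pospart_ge0// ge_max ler_norm normr_ge0.
Qed.

Lemma rsummable_negpart I (f : I -> R) : rsummable f -> rsummable (negpart f).
Proof.
apply: le_lt_trans; apply: le_esum => i _; rewrite lee_fin.
by rewrite ger0_norm ?negpart_ge0// ge_max -normrN ler_norm normr_ge0.
Qed.

(** Any splitting into nonnegative summable parts computes [rsum], not only the canonical one: [u]
    plus the negative part of u - v equals [v] plus the positive part, and [nsum] is additive.
    Linearity and Fubini for [rsum] reduce to this. *)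
Lemma rsumB I (u v : I -> R) :
  (forall i, 0 <= u i) -> (forall i, 0 <= v i) -> rsummable u -> rsummable v ->
  rsum (fun i => u i - v i) = nsum u - nsum v.
Proof.
move=> u0 v0 su sv; rewrite /rsum.
have suv : rsummable (fun i => u i - v i).
  by apply: rsummableD => //; apply: rsummableN.
have sp := rsummable_pospart suv; have sm := rsummable_negpart suv.
have pE : (EFin \o (fun i => (u i - v i)%R))^\+%E =
    EFin \o pospart (fun i => u i - v i).
  by apply/funext => i; rewrite funeposE /= EFin_max.
have mE : (EFin \o (fun i => (u i - v i)%R))^\-%E =
    EFin \o negpart (fun i => u i - v i).
  by apply/funext => i; rewrite funenegE /= EFin_max.
rewrite pE mE -/(nsum _) -/(nsum (negpart _)).
apply/eqP; rewrite subr_eq addrAC eq_sym subr_eq; apply/eqP.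
rewrite -!nsumD//; do ?[exact: pospart_ge0|exact: negpart_ge0].
congr nsum; apply/funext => i.
by have := posnegE (fun i => u i - v i) i; lra.
Qed.

Lemma rsumE I (f : I -> R) : rsummable f ->
  rsum f = nsum (pospart f) - nsum (negpart f).
Proof.
move=> sf; rewrite -rsumB; do ?[exact: pospart_ge0|exact: negpart_ge0|
  exact: rsummable_pospart|exact: rsummable_negpart].
by congr rsum; apply/funext => i; exact: posnegE.
Qed.

Lemma rsumD I (f g : I -> R) : rsummable f -> rsummable g ->
  rsum (fun i => f i + g i) = rsum f + rsum g.
Proof.
move=> sf sg; rewrite (rsumE sf) (rsumE sg) addrACA -opprD.
have pp h i := @pospart_ge0 I h i; have nn h i := @negpart_ge0 I h i.
rewrite -!nsumD//; do ?[exact: rsummable_pospart|exact: rsummable_negpart].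
rewrite -rsumB; last 4 first.
- by move=> i; rewrite addr_ge0.
- by move=> i; rewrite addr_ge0.
- by apply: rsummableD; exact: rsummable_pospart.
- by apply: rsummableD; exact: rsummable_negpart.
congr rsum; apply/funext => i.
by rewrite {1}(posnegE f) {1}(posnegE g) addrACA opprD.
Qed.

Lemma rsumN I (f : I -> R) : rsummable f -> rsum (fun i => - f i) = - rsum f.
Proof.
move=> sf; rewrite (rsumE sf) opprB -rsumB; do ?[exact: pospart_ge0|exact: negpart_ge0|
  exact: rsummable_pospart|exact: rsummable_negpart].
by congr rsum; apply/funext => i; rewrite {1}(posnegE f) opprB.
Qed.

Lemma nsumZ I (a : R) (u : I -> R) : 0 <= a -> (forall i, 0 <= u i) ->
  rsummable u -> nsum (fun i => a * u i) = a * nsum u.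
Proof.
move=> a0 u0 su; apply: EFin_inj.
have su' := rsummableZ a su.
rewrite EFinM -!nsumE//; last by move=> i; rewrite mulr_ge0.
rewrite -[RHS]/(_ * ereal_sup _)%E; apply/eqP; rewrite eq_le; apply/andP; split.
  apply: ge_ereal_sup => _ /= [A [finA _] <-].
  under eq_fsbigr do rewrite EFinM.
  rewrite -ge0_mule_fsumr => [|i]; last by rewrite lee_fin.
  by rewrite lee_wpmul2l ?lee_fin//; apply: ereal_sup_ubound; exists A.
have [->|an0] := eqVneq a 0.
  by rewrite mul0e esum_ge0// => i _; rewrite lee_fin mul0r.
have ap : 0 < a by rewrite lt_neqAle eq_sym an0.
rewrite muleC -lee_pdivlMr//.
apply: ge_ereal_sup => _ /= [A [finA _] <-].
rewrite lee_pdivlMr// muleC ge0_mule_fsumr => [|i]; last by rewrite lee_fin.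
under eq_fsbigr do rewrite -EFinM.
by apply: ereal_sup_ubound; exists A.
Qed.

Lemma rsumZ I (a : R) (f : I -> R) : rsummable f ->
  rsum (fun i => a * f i) = a * rsum f.
Proof.
wlog a0 : a / 0 <= a => [hw sf|sf].
  have [a0|a0] := lerP 0 a; first exact: hw.
  have := hw (- a); rewrite oppr_ge0 ltW// => /(_ isT sf).
  under eq_fun do rewrite mulNr.
  rewrite rsumN; last exact: rsummableZ.
  by rewrite mulNr => /oppr_inj.
rewrite (rsumE sf) mulrBr.
have pp h i := @pospart_ge0 I h i; have nn h i := @negpart_ge0 I h i.
rewrite -!nsumZ//; do ?[exact: rsummable_pospart|exact: rsummable_negpart].
rewrite -rsumB; last 4 first.
- by move=> i; rewrite mulr_ge0.
- by move=> i; rewrite mulr_ge0.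
- by apply: rsummableZ; exact: rsummable_pospart.
- by apply: rsummableZ; exact: rsummable_negpart.
by congr rsum; apply/funext => i; rewrite {1}(posnegE f) mulrBr.
Qed.

Lemma rsum_nsum I (u : I -> R) : (forall i, 0 <= u i) -> rsummable u ->
  rsum u = nsum u.
Proof.
move=> u0 su; rewrite (rsumE su).
rewrite (_ : pospart u = u); last by apply/funext => i; apply/max_idPl.
rewrite (_ : negpart u = fun=> 0); last first.
  by apply/funext => i; apply/max_idPr; rewrite oppr_le0.
by rewrite {2}/nsum esum1//= subr0.
Qed.

Lemma nsum1 I (u : I -> R) i : 0 <= u i -> (forall j, j != i -> u j = 0) ->
  nsum u = u i.
Proof.
move=> ui u0; rewrite /nsum (esumID [set i]); last first.
  by move=> j _; have [->|/u0->] := eqVneq j i; rewrite lee_fin.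
rewrite setTI esum_set1 ?lee_fin// esum1 ?adde0//.
by move=> j [_ /= /eqP/u0->].
Qed.

Lemma rsummable1 I (f : I -> R) i : (forall j, j != i -> f j = 0) -> rsummable f.
Proof.
move=> f0; rewrite /rsummable (esumID [set i])//.
rewrite setTI esum_set1// [X in (_ + X)%E]esum1 ?adde0 ?ltry//.
by move=> j [_ /= /eqP/f0->]; rewrite normr0.
Qed.

Lemma rsum1 I (f : I -> R) i : (forall j, j != i -> f j = 0) -> rsum f = f i.
Proof.
move=> f0; rewrite (rsumE (rsummable1 f0)) [in RHS](posnegE f).
rewrite (@nsum1 _ _ i) ?pospart_ge0//; last first.
  by move=> j ji; rewrite /pospart f0// maxxx.
rewrite (@nsum1 _ _ i) ?negpart_ge0//.
by move=> j ji; rewrite /negpart f0// oppr0 maxxx.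
Qed.

(** Tonelli. Summability of the sections and of their sums is recorded because [rsumB] asks for it
    in the signed case. *)
Lemma nsum_prod I J (u : I * J -> R) : (forall p, 0 <= u p) -> rsummable u ->
  [/\ forall i, rsummable (fun j => u (i, j)),
      rsummable (fun i => nsum (fun j => u (i, j))) &
      nsum u = nsum (fun i => nsum (fun j => u (i, j)))].
Proof.
move=> u0 su.
have E : \esum_(i in [set: I]) \esum_(j in [set: J]) (u (i, j))%:E =
    \esum_(p in [set: I * J]) (u p)%:E.
  rewrite (@esum_esum R I J setT (fun=> setT) (fun i j => (u (i, j))%:E)).
    by congr esum; [apply/seteqP; split|apply/funext => -[]].
  by move=> *; rewrite lee_fin.
have si i : rsummable (fun j => u (i, j)).
  rewrite /rsummable; under eq_esum do rewrite ger0_norm//.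
  apply: (@le_lt_trans _ _ (\esum_(p in [set: I * J]) (u p)%:E)%E).
    rewrite -E (esumID [set i]); last first.
      by move=> j _; apply: esum_ge0 => *; rewrite lee_fin.
    rewrite setTI esum_set1 ?leeDl//; first apply: esum_ge0 => j _.
      by apply: esum_ge0 => *; rewrite lee_fin.
    by apply: esum_ge0 => *; rewrite lee_fin.
  by rewrite nsumE// ltry.
have E' : \esum_(i in [set: I]) (nsum (fun j => u (i, j)))%:E = (nsum u)%:E.
  by rewrite -nsumE// -E; apply: eq_esum => i _; rewrite nsumE.
split=> //; last by rewrite {2}/nsum E'.
rewrite /rsummable; under eq_esum do rewrite ger0_norm ?nsum_ge0//.
by rewrite E' ltry.
Qed.

Lemma rsum_prod I J (f : I * J -> R) : rsummable f ->
  rsum f = rsum (fun i => rsum (fun j => f (i, j))).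
Proof.
move=> sf; rewrite (rsumE sf).
have [p1 p2 ->] := nsum_prod (@pospart_ge0 _ _) (rsummable_pospart sf).
have [n1 n2 ->] := nsum_prod (@negpart_ge0 _ _) (rsummable_negpart sf).
rewrite -rsumB//; last 2 first.
- by move=> i; apply: nsum_ge0 => j; exact: pospart_ge0.
- by move=> i; apply: nsum_ge0 => j; exact: negpart_ge0.
congr rsum; apply/funext => i; rewrite -rsumB//; last 2 first.
- by move=> j; exact: pospart_ge0.
- by move=> j; exact: negpart_ge0.
by congr rsum; apply/funext => j; rewrite -posnegE.
Qed.

Lemma rsum_reindex I J (e : J -> I) (e' : I -> J) (f : I -> R) :
  cancel e e' -> cancel e' e -> rsum (f \o e) = rsum f.
Proof.
move=> eK e'K; rewrite /rsum; congr (fine _ - fine _);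
  rewrite [RHS](reindex_esum setT setT e)//;
  do ?[by split=> [//|j k _ _ /(can_inj eK)//|i _]; exists (e' i)];
  by apply: eq_esum => i _; rewrite ?funeposE ?funenegE.
Qed.

End UnorderedSums.

(** * The inner product *)

Section ComplexSums.
Context {R : realType}.
Implicit Types (I J : choiceType).
Local Notation nrm := Normc.normc.

Lemma normc_Re_le (z : R[i]) : `|complex.Re z| <= nrm z.
Proof. by case: z => a b /=; rewrite -sqrtr_sqr ler_wsqrtr// lerDl sqr_ge0. Qed.

Lemma normc_Im_le (z : R[i]) : `|complex.Im z| <= nrm z.
Proof. by case: z => a b /=; rewrite -sqrtr_sqr ler_wsqrtr// lerDr sqr_ge0. Qed.

Lemma normc_ge0 (z : R[i]) : 0 <= nrm z.
Proof. by case: z => a b; rewrite sqrtr_ge0. Qed.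

Lemma normc_conj (z : R[i]) : nrm (conjc z) = nrm z.
Proof. by case: z => a b /=; rewrite sqrrN. Qed.

Lemma conjcD (x y : R[i]) : conjc (x + y) = conjc x + conjc y.
Proof. exact: rmorphD. Qed.

Lemma conjcM (x y : R[i]) : conjc (x * y) = conjc x * conjc y.
Proof. exact: rmorphM. Qed.

Lemma conjcN (x : R[i]) : conjc (- x) = - conjc x.
Proof. exact: rmorphN. Qed.

Lemma realCD (x y : R) : (x + y)%:C%C = x%:C%C + y%:C%C :> R[i].
Proof. exact: (rmorphD (real_complex R)). Qed.

Lemma realCB (x y : R) : (x - y)%:C%C = x%:C%C - y%:C%C :> R[i].
Proof. exact: (rmorphB (real_complex R)). Qed.

Lemma realCM (x y : R) : (x * y)%:C%C = x%:C%C * y%:C%C :> R[i].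
Proof. exact: (rmorphM (real_complex R)). Qed.

Lemma conjc_realC (x : R) : conjc x%:C%C = x%:C%C :> R[i].
Proof. by rewrite /= oppr0. Qed.

Lemma mulc_conj (z : R[i]) : z * conjc z = (nrm z ^+ 2)%:C%C.
Proof.
case: z => a b; rewrite /= sqr_sqrtr ?addr_ge0 ?sqr_ge0//.
apply/eqP; rewrite eq_complex /=; apply/andP; split; apply/eqP; ring.
Qed.

Lemma csummable_Re I (f : I -> R[i]) : csummable f ->
  rsummable (fun i => complex.Re (f i)).
Proof. by apply: le_lt_trans; apply: le_esum => i _; rewrite lee_fin normc_Re_le. Qed.

Lemma csummable_Im I (f : I -> R[i]) : csummable f ->
  rsummable (fun i => complex.Im (f i)).
Proof. by apply: le_lt_trans; apply: le_esum => i _; rewrite lee_fin normc_Im_le. Qed.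

Lemma csummable_le I (f : I -> R[i]) (g : I -> R) :
  (forall i, nrm (f i) <= g i) -> rsummable g -> csummable f.
Proof.
move=> fg; apply: le_lt_trans; apply: le_esum => i _.
by rewrite lee_fin (le_trans (fg i))// ler_norm.
Qed.

Lemma csummable_norm I (f : I -> R[i]) : csummable f ->
  rsummable (fun i => nrm (f i)).
Proof.
by rewrite /rsummable; under eq_esum do rewrite ger0_norm ?normc_ge0//.
Qed.

Lemma csummableZ I (a : R[i]) (f : I -> R[i]) :
  csummable f -> csummable (fun i => a * f i).
Proof.
move=> /csummable_norm sf; apply: csummable_le (rsummableZ (nrm a) sf) => i.
by rewrite Normc.normcM.
Qed.

Lemma csumD I (f g : I -> R[i]) : csummable f -> csummable g ->
  csum (fun i => f i + g i) = csum f + csum g.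
Proof.
move=> sf sg.
have hR := rsumD (csummable_Re sf) (csummable_Re sg).
have hI := rsumD (csummable_Im sf) (csummable_Im sg).
rewrite /csum -[RHS]/(Complex (_ + _) (_ + _)) -hR -hI.
by congr Complex; congr rsum; apply/funext => i; case: (f i) (g i) => a b [].
Qed.

Lemma csumZ I (a : R[i]) (f : I -> R[i]) : csummable f ->
  csum (fun i => a * f i) = a * csum f.
Proof.
move=> sf; case: a => a b.
have sR := csummable_Re sf; have sI := csummable_Im sf.
have hR := rsumD (rsummableZ a sR) (rsummableN (rsummableZ b sI)).
have hI := rsumD (rsummableZ a sI) (rsummableZ b sR).
rewrite rsumN ?rsumZ// in hR; last exact: rsummableZ.
rewrite !rsumZ// in hI.
rewrite /csum -[RHS]/(Complex (a * _ - b * _) (a * _ + b * _)) -hR -hI.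
by congr Complex; congr rsum; apply/funext => i; case: (f i).
Qed.

Lemma csum_conj I (f : I -> R[i]) : csummable f ->
  csum (fun i => conjc (f i)) = conjc (csum f).
Proof.
move=> sf; rewrite /csum /= -rsumN; last exact: csummable_Im.
by congr Complex; congr rsum; apply/funext => i; case: (f i).
Qed.

Lemma csum1 I (f : I -> R[i]) i : (forall j, j != i -> f j = 0) -> csum f = f i.
Proof.
move=> f0; rewrite /csum (@rsum1 _ _ _ i) => [|j /f0->//].
by rewrite (@rsum1 _ _ _ i) => [|j /f0->//]; case: (f i).
Qed.

Lemma csum_prod I J (f : I * J -> R[i]) : csummable f ->
  csum f = csum (fun i => csum (fun j => f (i, j))).
Proof.
move=> sf; rewrite /csum /=.
by rewrite (rsum_prod (csummable_Re sf)) (rsum_prod (csummable_Im sf)).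
Qed.

Lemma csum_reindex I J (e : J -> I) (e' : I -> J) (f : I -> R[i]) :
  cancel e e' -> cancel e' e -> csum (f \o e) = csum f.
Proof.
move=> eK e'K; rewrite /csum.
by congr Complex; apply: (rsum_reindex _ eK e'K).
Qed.

Lemma csummable_reindex I J (e : J -> I) (e' : I -> J) (f : I -> R[i]) :
  cancel e e' -> cancel e' e -> csummable f -> csummable (f \o e).
Proof.
move=> eK e'K; rewrite /csummable (reindex_esum setT setT e)//.
by split=> [//|j k _ _ /(can_inj eK)//|i _]; exists (e' i).
Qed.

End ComplexSums.

Section InnerProduct.
Context {R : realType}.
Implicit Types (X Y : choiceType).
Local Notation nrm := Normc.normc.

Lemma ell2_ext X (xi eta : ell2 R X) : (forall x, xi x = eta x) -> xi = eta.
Proof. by move=> h; apply: val_inj; apply/funext. Qed.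

Lemma ell2_rsummable X (xi : ell2 R X) : rsummable (fun x => nrm (xi x) ^+ 2).
Proof.
rewrite /rsummable; under eq_esum do rewrite ger0_norm ?sqr_ge0//.
exact: asboolW (ell2P xi).
Qed.

Lemma dotp_csummable X (xi eta : ell2 R X) :
  csummable (fun x => xi x * conjc (eta x)).
Proof.
apply: csummable_le (rsummableD (ell2_rsummable xi) (ell2_rsummable eta)) => x.
rewrite Normc.normcM normc_conj.
have := normc_ge0 (xi x); have := normc_ge0 (eta x); nra.
Qed.

Lemma dotpP X (a : R[i]) (x y z : ell2 R X) :
  dotp (a *: x + y) z = a * dotp x z + dotp y z.
Proof.
rewrite /dotp -csumZ; last exact: dotp_csummable.
rewrite -csumD; last 2 first.
- by apply: csummableZ; exact: dotp_csummable.
- exact: dotp_csummable.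
by congr csum; apply/funext => i; rewrite mulrA -mulrDl.
Qed.

Lemma dotpC X (x y : ell2 R X) : dotp y x = conjc (dotp x y).
Proof.
rewrite /dotp -csum_conj; last exact: dotp_csummable.
by congr csum; apply/funext => i; rewrite rmorphM /= conjcK mulrC.
Qed.

Lemma dotp0l X (z : ell2 R X) : dotp 0 z = 0.
Proof. by have := dotpP 1 0 0 z; rewrite scaler0 addr0 mul1r => /eqP; rewrite -subr_eq subrr => /eqP. Qed.

Lemma dotpDl X (x y z : ell2 R X) : dotp (x + y) z = dotp x z + dotp y z.
Proof. by have := dotpP 1 x y z; rewrite scale1r mul1r. Qed.

Lemma dotpZl X (a : R[i]) (x z : ell2 R X) : dotp (a *: x) z = a * dotp x z.
Proof. by have := dotpP a x 0 z; rewrite dotp0l !addr0. Qed.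

Lemma dotpNl X (x z : ell2 R X) : dotp (- x) z = - dotp x z.
Proof. by rewrite -scaleN1r dotpZl mulN1r. Qed.

Lemma dotpBl X (x y z : ell2 R X) : dotp (x - y) z = dotp x z - dotp y z.
Proof. by rewrite dotpDl dotpNl. Qed.

Lemma dotp0r X (z : ell2 R X) : dotp z 0 = 0.
Proof. by rewrite dotpC dotp0l conjc0. Qed.

Lemma dotpDr X (x y z : ell2 R X) : dotp z (x + y) = dotp z x + dotp z y.
Proof. by rewrite dotpC dotpDl conjcD -!dotpC. Qed.

Lemma dotpZr X (a : R[i]) (x z : ell2 R X) : dotp z (a *: x) = conjc a * dotp z x.
Proof. by rewrite dotpC dotpZl conjcM -dotpC. Qed.

Lemma dotpNr X (x z : ell2 R X) : dotp z (- x) = - dotp z x.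
Proof. by rewrite dotpC dotpNl conjcN -dotpC. Qed.

Lemma dotpBr X (x y z : ell2 R X) : dotp z (x - y) = dotp z x - dotp z y.
Proof. by rewrite dotpDr dotpNr. Qed.

Lemma l2norm_ge0 X (x : ell2 R X) : 0 <= l2norm x.
Proof. exact: sqrtr_ge0. Qed.

Lemma dotp_self X (x : ell2 R X) : dotp x x = (l2norm x ^+ 2)%:C%C.
Proof.
rewrite /dotp; under eq_fun do rewrite mulc_conj.
rewrite /csum /= rsum_nsum; [|by move=> i; rewrite sqr_ge0|exact: ell2_rsummable].
congr Complex.
  by rewrite /nsum -/(sqsum x) sqsumE.
(* The imaginary parts all vanish; homogeneity of [rsum] with the scalar 0 shows that their sum
   does. *)
by have := @rsumZ R X 0 (fun=> 0); rewrite !mul0r; apply; rewrite /rsummable esum1 ?ltry// => i _; rewrite normr0.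
Qed.

Lemma l2norm0 X : l2norm (0 : ell2 R X) = 0.
Proof.
have := dotp_self (0 : ell2 R X); rewrite dotp0l => -[/esym/eqP].
by rewrite sqrf_eq0 => /eqP.
Qed.

Lemma normc_le_l2norm X (x : ell2 R X) i : nrm (x i) <= l2norm x.
Proof.
rewrite -(@ler_pXn2r _ 2) ?nnegrE ?l2norm_ge0 ?normc_ge0// -lee_fin -sqsumE.
rewrite /sqsum (esumID [set i]); last by move=> *; rewrite lee_fin sqr_ge0.
rewrite setTI esum_set1 ?lee_fin ?sqr_ge0// leeDl// esum_ge0// => j _.
by rewrite lee_fin sqr_ge0.
Qed.

Lemma l2norm_eq0 X (x : ell2 R X) : l2norm x = 0 -> x = 0.
Proof.
move=> x0; apply: ell2_ext => i; apply: Normc.eq0_normc.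
by apply/eqP; rewrite eq_le normc_ge0 -x0 normc_le_l2norm.
Qed.

Lemma dotp_eq0 X (x : ell2 R X) : dotp x x = 0 -> x = 0.
Proof.
rewrite dotp_self => -[/eqP]; rewrite sqrf_eq0 => /eqP.
exact: l2norm_eq0.
Qed.

(** With N = |y|^2 and a = <x, y>, the squared norm of N x - a y is N (N |x|^2 - |a|^2), and it is
    nonnegative. *)
Lemma cauchy_schwarz X (x y : ell2 R X) : nrm (dotp x y) <= l2norm x * l2norm y.
Proof.
set N := l2norm y ^+ 2; set a := dotp x y.
have [y0|/eqP y0] := eqVneq (l2norm y) 0.
  by rewrite /a (l2norm_eq0 y0) dotp0r Normc.normc0 l2norm0 mulr0.
have N0 : 0 < N by rewrite exprn_gt0// lt_neqAle l2norm_ge0 andbT eq_sym; apply/eqP.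
have E : dotp (N%:C%C *: x - a *: y) (N%:C%C *: x - a *: y) =
    (N * (N * l2norm x ^+ 2 - nrm a ^+ 2))%:C%C.
  rewrite dotpBl !dotpBr !dotpZl !dotpZr !dotp_self (dotpC x y) -/a -/N.
  rewrite realCM realCB realCM -mulc_conj conjc_realC.
  move: (conjc a) (N%:C)%C (l2norm x ^+ 2)%:C%C => b c d; ring.
have : 0 <= N * (N * l2norm x ^+ 2 - nrm a ^+ 2).
  move: E; rewrite dotp_self => /complexI <-; exact: sqr_ge0.
rewrite pmulr_rge0// subr_ge0 => h.
rewrite -(@ler_pXn2r _ 2) ?nnegrE ?normc_ge0 ?mulr_ge0 ?l2norm_ge0//.
by rewrite exprMn mulrC.
Qed.

Lemma l2normZ X (a : R[i]) (x : ell2 R X) : l2norm (a *: x) = nrm a * l2norm x.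
Proof.
apply/eqP; rewrite -(@eqrXn2 _ 2) ?mulr_ge0 ?l2norm_ge0 ?normc_ge0//; apply/eqP.
apply: complexI; rewrite -dotp_self dotpZl dotpZr mulrA mulc_conj dotp_self.
by rewrite exprMn [RHS]realCM.
Qed.

Lemma l2normN X (x : ell2 R X) : l2norm (- x) = l2norm x.
Proof. by rewrite -scaleN1r l2normZ normcN Normc.normc1 mul1r. Qed.

Lemma l2norm_sqrD X (x y : ell2 R X) :
  l2norm (x + y) ^+ 2 = l2norm x ^+ 2 + l2norm y ^+ 2 + 2 * complex.Re (dotp x y).
Proof.
apply: complexI; rewrite -dotp_self dotpDl !dotpDr (dotpC x y) !dotp_self.
rewrite !realCD realCM; case: (dotp x y) => a b.
by apply/eqP; rewrite eq_complex /=; apply/andP; split; apply/eqP; ring.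
Qed.

Lemma l2norm_sqrB X (x y : ell2 R X) :
  l2norm (x - y) ^+ 2 = l2norm x ^+ 2 + l2norm y ^+ 2 - 2 * complex.Re (dotp x y).
Proof. by rewrite l2norm_sqrD l2normN dotpNr raddfN mulrN. Qed.

Lemma le_l2normD X (x y : ell2 R X) : l2norm (x + y) <= l2norm x + l2norm y.
Proof.
rewrite -(@ler_pXn2r _ 2) ?nnegrE ?addr_ge0 ?l2norm_ge0// l2norm_sqrD.
have := le_trans (ler_norm _) (le_trans (normc_Re_le (dotp x y)) (cauchy_schwarz x y)).
by move=> h; rewrite sqrrD; lra.
Qed.

Lemma le_l2normB X (x y z : ell2 R X) : l2norm (x - z) <= l2norm (x - y) + l2norm (y - z).
Proof. by rewrite -(subrKA y) le_l2normD. Qed.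

Definition deltaf X (x : X) : X -> R[i] := fun y => (y == x)%:R.

Lemma deltaf_is_ell2 X (x : X) : deltaf x \in @is_ell2 R X.
Proof.
apply/asboolP; rewrite /sqsum (esumID [set x]); last first.
  by move=> *; rewrite lee_fin sqr_ge0.
rewrite setTI esum_set1 ?lee_fin ?sqr_ge0// esum1 ?adde0 ?ltry//.
by move=> y [_ /= /eqP yx]; rewrite /deltaf (negbTE yx) Normc.normc0 expr0n.
Qed.

Definition delta X (x : X) : ell2 R X := Ell2 (deltaf_is_ell2 x).

Lemma deltaE X (x y : X) : delta x y = (y == x)%:R. Proof. by []. Qed.

Lemma dotp_delta X (xi : ell2 R X) x : dotp xi (delta x) = xi x.
Proof.
rewrite /dotp (@csum1 _ _ _ x) => [|y yx]; rewrite deltaE.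
  by rewrite eqxx conjc1 mulr1.
by rewrite (negbTE yx) conjc0 mulr0.
Qed.

Lemma dotp_ext X (x y : ell2 R X) : (forall z, dotp x z = dotp y z) -> x = y.
Proof. by move=> h; apply: ell2_ext => i; rewrite -!dotp_delta. Qed.

Lemma dotp_extr X (x y : ell2 R X) : (forall z, dotp z x = dotp z y) -> x = y.
Proof. by move=> h; apply: dotp_ext => z; rewrite dotpC h -dotpC. Qed.

Lemma l2norm_delta X (x : X) : l2norm (delta x) = 1.
Proof.
have /eqP : l2norm (delta x) ^+ 2 = 1.
  by apply: complexI; rewrite -dotp_self dotp_delta deltaE eqxx.
by rewrite sqrf_eq1 => /orP[/eqP//|/eqP h]; have := l2norm_ge0 (delta x); rewrite h oppr_ge0 ler10.
Qed.

Lemma dotp_pullback X Y (e : Y -> X) (e' : X -> Y) (einj : injective e)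
    (e'inj : injective e') (xi : ell2 R X) (eta : ell2 R Y) :
  cancel e e' -> cancel e' e ->
  dotp (pullback einj xi) eta = dotp xi (pullback e'inj eta).
Proof.
move=> eK e'K; rewrite /dotp -[RHS](csum_reindex _ eK e'K).
by congr csum; apply/funext => y; rewrite /= eK.
Qed.

Definition pairl_inj X Y (y : Y) : injective (fun x : X => (x, y)).
Proof. by move=> a b []. Qed.

Definition slice X Y (xi : ell2 R (X * Y)%type) (y : Y) : ell2 R X :=
  pullback (@pairl_inj X Y y) xi.

Lemma sliceE X Y (xi : ell2 R (X * Y)%type) (y : Y) x : slice xi y x = xi (x, y).
Proof. by []. Qed.

Lemma dotp_slice X Y (xi eta : ell2 R (X * Y)%type) :
  dotp xi eta = csum (fun y => dotp (slice xi y) (slice eta y)).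
Proof.
rewrite {1}/dotp -(csum_reindex _ (@swapK Y X) (@swapK X Y)) csum_prod//.
exact: (csummable_reindex (@swapK Y X) (@swapK X Y)) (dotp_csummable _ _).
Qed.

Lemma sqsum_slice X Y (f : X * Y -> R[i]) :
  sqsum f = \esum_(y in [set: Y]) sqsum (fun x => f (x, y)).
Proof.
rewrite /sqsum (reindex_esum setT setT (@swap Y X)); last first.
  by split=> [//|[? ?] [? ?] _ _ [-> ->]//|[x y] _]; exists (y, x).
rewrite (@esum_esum R Y X setT (fun=> setT) (fun y x => (nrm (f (x, y)) ^+ 2)%:E)).
  by congr esum; apply/seteqP; split.
by move=> *; rewrite lee_fin sqr_ge0.
Qed.

Lemma dotp_tensv X Y (x x' : ell2 R X) (y y' : ell2 R Y) :
  dotp (tensv x y) (tensv x' y') = dotp x x' * dotp y y'.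
Proof.
rewrite dotp_slice.
have sE (u : ell2 R X) (v : ell2 R Y) j : slice (tensv u v) j = v j *: u.
  by apply: ell2_ext => i; rewrite /= mulrC.
under eq_fun do rewrite !sE dotpZl dotpZr mulrA [_ * dotp _ _]mulrC.
by rewrite csumZ//; exact: dotp_csummable.
Qed.

Lemma l2norm_tensv X Y (x : ell2 R X) (y : ell2 R Y) :
  l2norm (tensv x y) = l2norm x * l2norm y.
Proof.
apply/eqP; rewrite -(@eqrXn2 _ 2) ?mulr_ge0 ?l2norm_ge0//; apply/eqP.
by apply: complexI; rewrite -dotp_self dotp_tensv !dotp_self exprMn [RHS]realCM.
Qed.

End InnerProduct.

(** * Completeness and orthogonal projection *)

Section Completeness.
Context {R : realType}.
Implicit Types (X Y : choiceType).
Local Notation nrm := Normc.normc.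

Lemma esum_le_seq X (f : X -> R) (c : R) :
  (forall s : seq X, uniq s -> \sum_(x <- s) f x <= c) ->
  (\esum_(x in [set: X]) (f x)%:E <= c%:E)%E.
Proof.
move=> fc; apply: ge_ereal_sup => _ /= [A [finA _] <-].
by rewrite fsbig_finite//= sumEFin lee_fin fc.
Qed.

Lemma esum_ge_seq X (f : X -> R) (s : seq X) : (forall x, 0 <= f x) -> uniq s ->
  ((\sum_(x <- s) f x)%:E <= \esum_(x in [set: X]) (f x)%:E)%E.
Proof.
move=> f0 us; apply: esum_ge; exists [set` s] => //.
by rewrite -fsbig_seq// sumEFin.
Qed.

Lemma esum_approx_seq X (f : X -> R) (c : R) : (c%:E < \esum_(x in [set: X]) (f x)%:E)%E ->
  exists s : seq X, uniq s /\ c < \sum_(x <- s) f x.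
Proof.
move=> /ereal_sup_gt[_ [A [finA _] <-]].
rewrite fsbig_finite//= sumEFin lte_fin => h.
by exists (finmap.enum_fset (fset_set A)).
Qed.

Lemma sum_le_l2norm X (xi : ell2 R X) (s : seq X) : uniq s ->
  \sum_(x <- s) nrm (xi x) ^+ 2 <= l2norm xi ^+ 2.
Proof.
move=> us; rewrite -lee_fin -sqsumE.
by apply: (esum_ge_seq (fun x => sqr_ge0 (nrm (xi x)))).
Qed.

Lemma l2norm_le X (xi : ell2 R X) (c : R) : 0 <= c ->
  (forall s : seq X, uniq s -> \sum_(x <- s) nrm (xi x) ^+ 2 <= c ^+ 2) ->
  l2norm xi <= c.
Proof.
move=> c0 h; rewrite -(@ler_pXn2r _ 2) ?nnegrE ?l2norm_ge0// -lee_fin -sqsumE.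
exact: esum_le_seq.
Qed.

Lemma real_complete (u : nat -> R) :
  (forall e : R, 0 < e -> exists N, forall m n, (N <= m)%N -> (N <= n)%N -> `|u m - u n| <= e) ->
  exists l, forall e : R, 0 < e -> exists N, forall n, (N <= n)%N -> `|u n - l| <= e.
Proof.
move=> uC; have : cvg (u @ \oo).
  apply/cauchy_cvgP/cauchy_exP => e e0.
  have [N uN] := uC _ (divr_gt0 e0 (ltr0Sn _ 1)); exists (u N); exists N => //.
  move=> n /= Nn; rewrite /ball /=.
  by rewrite (le_lt_trans (uN _ _ (leqnn N) Nn))// ltr_pdivrMr// ltr_pMr// ltr1n.
move=> /cvg_ex[l ul]; exists l => e e0.
have /cvgrPdist_le/(_ _ e0)[N _ hN] := ul.
by exists N => n Nn; rewrite distrC; apply: hN.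
Qed.

Lemma normc_le_ReIm (z : R[i]) : nrm z <= `|complex.Re z| + `|complex.Im z|.
Proof.
case: z => a b /=; rewrite -(@ler_pXn2r _ 2) ?nnegrE ?sqrtr_ge0 ?addr_ge0//.
rewrite sqr_sqrtr ?addr_ge0 ?sqr_ge0// sqrrD !real_normK ?num_real//.
by rewrite lerD2r lerDl mulrn_wge0// mulr_ge0.
Qed.

Lemma complex_complete (u : nat -> R[i]) :
  (forall e : R, 0 < e -> exists N, forall m n, (N <= m)%N -> (N <= n)%N -> nrm (u m - u n) <= e) ->
  exists l, forall e : R, 0 < e -> exists N, forall n, (N <= n)%N -> nrm (u n - l) <= e.
Proof.
move=> uC.
have [a ha] : exists l, forall e : R, 0 < e -> exists N, forall n, (N <= n)%N -> `|complex.Re (u n) - l| <= e.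
  apply: real_complete => e /uC[N hN]; exists N => m n Nm Nn.
  by rewrite -raddfB (le_trans (normc_Re_le _))// hN.
have [b hb] : exists l, forall e : R, 0 < e -> exists N, forall n, (N <= n)%N -> `|complex.Im (u n) - l| <= e.
  apply: real_complete => e /uC[N hN]; exists N => m n Nm Nn.
  by rewrite -raddfB (le_trans (normc_Im_le _))// hN.
exists (Complex a b) => e e0.
have e2 : 0 < e / 2 by rewrite divr_gt0.
have [N hN] := ha _ e2; have [M hM] := hb _ e2.
exists (maxn N M) => n; rewrite geq_max => /andP[Nn Mn].
apply: le_trans (normc_le_ReIm _) _; rewrite [leRHS](splitr e).
move: (hN _ Nn) (hM _ Mn); case: (u n) => c d /= h1 h2.
exact: lerD.
Qed.

(** The limit is taken coordinatewise. A finite partial sum of |u_n - f|^2 is compared through u_m,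
    with m so large, depending on the finite set, that u_m is close to f there. The 4 in [key] comes
    from |a + b|^2 <= 2 |a|^2 + 2 |b|^2. *)
Lemma ell2_complete X (u : nat -> ell2 R X) :
  (forall e : R, 0 < e -> exists N, forall m n, (N <= m)%N -> (N <= n)%N -> l2norm (u m - u n) <= e) ->
  exists l, forall e : R, 0 < e -> exists N, forall n, (N <= n)%N -> l2norm (u n - l) <= e.
Proof.
move=> uC.
have /choice[f hf] : forall x, exists l, forall e : R, 0 < e ->
    exists N, forall n, (N <= n)%N -> nrm (u n x - l) <= e.
  move=> x; apply: complex_complete => e /uC[N hN]; exists N => m n Nm Nn.
  by apply: le_trans (hN _ _ Nm Nn); exact: (normc_le_l2norm (u m - u n) x).
have unif (s : seq X) (e : R) : 0 < e -> exists N, forall n, (N <= n)%N ->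
    forall x, x \in s -> nrm (u n x - f x) <= e.
  move=> e0; elim: s => [|x s [N hN]]; first by exists 0%N.
  have [M hM] := hf x _ e0; exists (maxn N M) => n; rewrite geq_max => /andP[Nn Mn] y.
  by rewrite inE => /orP[/eqP->|]; [exact: hM|exact: hN].
have key (e : R) N n : 0 < e -> (forall m, (N <= m)%N -> l2norm (u m - u n) <= e) ->
    forall s : seq X, uniq s -> \sum_(x <- s) nrm (u n x - f x) ^+ 2 <= 4 * e ^+ 2.
  move=> e0 hN s us.
  (* Chosen so that the sum of d^2 over [s] is at most e^2; the successor also covers the empty
     [s]. *)
  pose d := e / (size s).+1%:R.
  have d0 : 0 < d by rewrite divr_gt0.
  have [M hM] := unif s d d0.
  have [Nm Mm] : (N <= maxn N M)%N /\ (M <= maxn N M)%N by rewrite leq_maxl leq_maxr.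
  move: (maxn N M) Nm Mm => m Nm Mm.
  have h1 := sum_le_l2norm (u m - u n) us.
  have h2 : \sum_(x <- s) nrm (u m x - f x) ^+ 2 <= e ^+ 2.
    apply: (@le_trans _ _ (\sum_(x <- s) d ^+ 2)).
      rewrite big_seq [leRHS]big_seq; apply: ler_sum => x xs.
      by rewrite ler_pXn2r ?nnegrE ?normc_ge0 ?(ltW d0)//; exact: hM.
      rewrite big_const_seq count_predT iter_addr_0 -[leLHS]mulr_natr /d expr_div_n -mulrA.
    rewrite ler_piMr ?sqr_ge0// mulrC ler_pdivrMr ?exprn_gt0// mul1r -natrX ler_nat.
    by rewrite expnS expn1 (leq_trans (leqnSn _))// leq_pmulr.
  have h3 : l2norm (u m - u n) ^+ 2 <= e ^+ 2.
    by rewrite ler_pXn2r ?nnegrE ?l2norm_ge0 ?(ltW e0)//; exact: hN.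
  apply: (@le_trans _ _ (\sum_(x <- s) (2 * nrm ((u m - u n) x) ^+ 2 + 2 * nrm (u m x - f x) ^+ 2))).
    apply: ler_sum => x _.
    have -> : u n x - f x = - (u m - u n) x + (u m x - f x).
      by rewrite -[(u m - u n) x]/(u m x - u n x) opprB subrKA.
    apply: (@le_trans _ _ ((nrm ((u m - u n) x) + nrm (u m x - f x)) ^+ 2)).
      rewrite ler_pXn2r ?nnegrE ?addr_ge0 ?normc_ge0// -[nrm ((u m - u n) x)]normcN.
      exact: le_normcD.
    have := sqr_ge0 (nrm ((u m - u n) x) - nrm (u m x - f x)).
    by rewrite sqrrB sqrrD; lra.
  by rewrite big_split /= -!mulr_sumr; lra.
(* One instance of [key] puts u_N0 - f in l^2, and f is recovered as u_N0 minus that vector. *)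
have [N0 hN0] := uC 1 ltr01.
have gP : (fun x => u N0 x - f x) \in @is_ell2 R X.
  apply/asboolP; apply: le_lt_trans (ltry (4 * 1 ^+ 2)); apply: esum_le_seq.
  by apply: (key _ N0) => // m Nm; exact: hN0.
have fE : f = (u N0 - Ell2 gP : ell2 R X).
  by apply/funext => x; rewrite -[RHS]/(u N0 x - (u N0 x - f x)) opprB addrC subrK.
exists (u N0 - Ell2 gP) => e e0.
have [N hN] := uC _ (divr_gt0 e0 (ltr0Sn _ 1)); exists N => n Nn.
apply: l2norm_le; first exact: ltW.
move=> s us; have := key _ N n (divr_gt0 e0 (ltr0Sn _ 1)) _ s us.
rewrite (_ : 4 * (e / 2) ^+ 2 = e ^+ 2); last by field.
by rewrite {1}fE; apply => m Nm; exact: hN.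
Qed.

End Completeness.

Section Projection.
Context {R : realType}.
Implicit Types (X Y : choiceType).
Local Notation nrm := Normc.normc.

Definition is_subspace X (V : set (ell2 R X)) : Prop :=
  V 0 /\ forall a x y, V x -> V y -> V (a *: x + y).

Definition l2closure X (V : set (ell2 R X)) : set (ell2 R X) :=
  [set y | forall e : R, 0 < e -> exists2 v, V v & l2norm (y - v) <= e].

Definition orthog X (V : set (ell2 R X)) : set (ell2 R X) :=
  [set z | forall v, V v -> dotp z v = 0].

Lemma sub_l2closure X (V : set (ell2 R X)) : V `<=` l2closure V.
Proof. by move=> v Vv e e0; exists v => //; rewrite subrr l2norm0 ltW. Qed.

Lemma l2closure_subspace X (V : set (ell2 R X)) :
  is_subspace V -> is_subspace (l2closure V).
Proof.
move=> [V0 VP]; split; first exact: sub_l2closure.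
move=> a x y Vx Vy e e0.
have d0 : 0 < e / (2 * (nrm a + 1)).
  by rewrite divr_gt0// mulr_gt0// ltr_wpDl ?normc_ge0.
have [v Vv xv] := Vx _ d0; have [w Vw yw] := Vy _ (divr_gt0 e0 (ltr0Sn _ 1)).
exists (a *: v + w); first exact: VP.
rewrite opprD addrACA -scalerBr; apply: le_trans (le_l2normD _ _) _.
rewrite [leRHS](splitr e) lerD// l2normZ.
apply: (@le_trans _ _ ((nrm a + 1) * (e / (2 * (nrm a + 1))))).
  by apply: ler_pM => //; rewrite ?normc_ge0 ?l2norm_ge0// lerDl.
have a1 : nrm a + 1 != 0 by rewrite gt_eqF// ltr_wpDl ?normc_ge0.
by rewrite le_eqVlt; apply/orP; left; apply/eqP; field.
Qed.

Lemma normc_small (z : R[i]) : (forall e : R, 0 < e -> nrm z <= e) -> z = 0.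
Proof.
move=> h; apply: Normc.eq0_normc; apply/eqP; rewrite eq_le normc_ge0 andbT.
by apply/ler_addgt0Pr => e e0; rewrite add0r h.
Qed.

Lemma l2norm_small X (z : ell2 R X) : (forall e : R, 0 < e -> l2norm z <= e) -> z = 0.
Proof.
move=> h; apply: l2norm_eq0; apply/eqP; rewrite eq_le l2norm_ge0 andbT.
by apply/ler_addgt0Pr => e e0; rewrite add0r h.
Qed.

Lemma orthog_closure X (V : set (ell2 R X)) z y :
  orthog V z -> l2closure V y -> dotp z y = 0.
Proof.
move=> oz Vy; apply: normc_small => e e0.
have d0 : 0 < e / (l2norm z + 1) by rewrite divr_gt0// ltr_wpDl ?l2norm_ge0.
have [v Vv yv] := Vy _ d0.
rewrite -[dotp z y]subr0 -(oz _ Vv) -dotpBr (le_trans (cauchy_schwarz _ _))//.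
apply: (@le_trans _ _ ((l2norm z + 1) * (e / (l2norm z + 1)))).
  by apply: ler_pM => //; rewrite ?l2norm_ge0// lerDl.
by rewrite mulrC divfK// gt_eqF// ltr_wpDl ?l2norm_ge0.
Qed.

(** A minimizing sequence in [V] converges to [y], in general only in the closure of [V];
    orthogonality is the first-order condition at the minimum. *)
Lemma projection_exists X (V : set (ell2 R X)) (x : ell2 R X) : is_subspace V ->
  exists y, l2closure V y /\ orthog V (x - y).
Proof.
move=> sV; have V0 := sV.1; have VP := sV.2.
pose D := [set l2norm (x - v) | v in V].
have D0 : has_inf D.
  split; first by exists (l2norm (x - 0)); exists 0.
  by exists 0 => _ [v _ <-]; exact: l2norm_ge0.
pose d := inf D.
have d0 : 0 <= d.
  by apply: lb_le_inf => [|_ [v _ <-]]; [exact: (proj1 D0)|exact: l2norm_ge0].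
have dle v : V v -> d <= l2norm (x - v).
  by move=> Vv; apply: ge_inf; [exact: (proj2 D0)|exists v].
have /choice[u hu] : forall n : nat, exists v, V v /\ l2norm (x - v) ^+ 2 <= d ^+ 2 + n.+1%:R^-1.
  move=> n; have n1 : (0 : R) < n.+1%:R^-1 by rewrite invr_gt0.
  have n2 : n.+1%:R^-1 <= 1 :> R by rewrite invf_le1// ler1n.
  move: (n.+1%:R^-1 : R) n1 n2 => k n1 n2.
  have dp : 0 < 2 * d + 1 by lra.
  (* Since e <= 1, (d + e)^2 <= d^2 + e (2 d + 1) = d^2 + k. *)
  pose e := k / (2 * d + 1).
  have e0 : 0 < e by rewrite divr_gt0.
  have e1 : e <= 1 by rewrite ler_pdivrMr//; lra.
  have [_ [v Vv <-] h] := inf_adherent e0 D0; exists v; split=> //.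
  have h2 : l2norm (x - v) ^+ 2 <= (d + e) ^+ 2.
    by rewrite ler_pXn2r ?nnegrE ?l2norm_ge0 ?addr_ge0 ?(ltW e0)// ltW.
  apply: le_trans h2 _; rewrite sqrrD -addrA lerD2l.
  have E : e * (2 * d + 1) = k by rewrite divfK// gt_eqF.
  by rewrite -E mulr2n; nra.
(* Parallelogram law: the midpoint [m] stays in [V], hence at distance at least [d] from [x]. This
   makes the minimizing sequence Cauchy. *)
have par (v w : ell2 R X) : V v -> V w ->
    l2norm (v - w) ^+ 2 <= 2 * l2norm (x - v) ^+ 2 + 2 * l2norm (x - w) ^+ 2 - 4 * d ^+ 2.
  move=> Vv Vw; pose m : ell2 R X := 2^-1 *: (v + w).
  have Vm : V m.
    rewrite /m -[_ *: _]addr0; apply: (VP) => //.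
    by rewrite -[v]scale1r; exact: VP.
  have h : d ^+ 2 <= l2norm (x - m) ^+ 2.
    by rewrite ler_pXn2r ?nnegrE ?l2norm_ge0//; exact: dle.
  have E1 : (x - v) + (x - w) = 2 *: (x - m).
    rewrite scalerBr scalerA mulfV ?pnatr_eq0// scale1r addrACA -opprD.
    by rewrite scaler_nat mulr2n.
  have E2 : l2norm ((x - v) + (x - w)) ^+ 2 = 4 * l2norm (x - m) ^+ 2.
    rewrite E1 l2normZ exprMn; congr (_ * _).
    by rewrite normcMn Normc.normc1 -natrX.
  have E3 : v - w = (x - w) - (x - v) by rewrite opprB [RHS]addrC subrKA.
  have := l2norm_sqrB (x - w) (x - v); rewrite -E3 => ->.
  have := l2norm_sqrD (x - w) (x - v); rewrite [_ + (x - v)]addrC E2.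
  move: h; lra.
have uC (e : R) : 0 < e -> exists N, forall m n, (N <= m)%N -> (N <= n)%N ->
    l2norm (u m - u n) <= e.
  move=> e0; have e2 : 0 < 4^-1 * e ^+ 2 by rewrite mulr_gt0// exprn_gt0.
  have [N hN] := ltr_add_invr (y := 0) (x := 4^-1 * e ^+ 2) e2.
  exists N => m n Nm Nn; rewrite -(@ler_pXn2r _ 2) ?nnegrE ?l2norm_ge0 ?(ltW e0)//.
  have hle k : (N <= k)%N -> k.+1%:R^-1 <= 4^-1 * e ^+ 2.
    move=> Nk; apply: le_trans (ltW hN); rewrite add0r lef_pV2 ?posrE//.
    by rewrite ler_nat.
  have := par _ _ (proj1 (hu m)) (proj1 (hu n)).
  move: (proj2 (hu m)) (proj2 (hu n)) (hle _ Nm) (hle _ Nn).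
  move: (m.+1%:R^-1 : R) (n.+1%:R^-1 : R) (e ^+ 2) => p q r; lra.
have [y hy] := ell2_complete uC.
have Vy : l2closure V y.
  move=> e /hy[N hN]; exists (u N); first exact: (proj1 (hu N)).
  by rewrite -l2normN opprB; exact: hN.
have yd : l2norm (x - y) <= d.
  apply/ler_addgt0Pr => e e0.
  have [N hN] := hy _ (divr_gt0 e0 (ltr0Sn _ 1)).
  have e2 : 0 < (e / 2) ^+ 2 by rewrite exprn_gt0// divr_gt0.
  have [M hM] := ltr_add_invr (y := 0) (x := (e / 2) ^+ 2) e2.
  pose n := maxn N M.
  apply: le_trans (le_l2normB _ (u n) _) _.
  have h1 := hN n (leq_maxl _ _).
  have h2 : l2norm (x - u n) <= d + e / 2.
    rewrite -(@ler_pXn2r _ 2) ?nnegrE ?l2norm_ge0 ?addr_ge0 ?divr_ge0 ?(ltW e0)//.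
    apply: le_trans (proj2 (hu n)) _; rewrite sqrrD.
    have : n.+1%:R^-1 <= (e / 2) ^+ 2.
      apply: le_trans (ltW hM); rewrite add0r lef_pV2 ?posrE//.
      by rewrite ler_nat ltnS leq_maxr.
    have : 0 <= d * (e / 2) by rewrite mulr_ge0// divr_ge0// ltW.
    by move: (n.+1%:R^-1 : R) ((e / 2) ^+ 2) (d * (e / 2)) => p q r; lra.
  by move: h1 h2; lra.
have dy w : V w -> d <= l2norm (x - y - w).
  move=> Vw; apply/ler_addgt0Pr => e /hy[N hN].
  have Vuw : V (u N + w) by rewrite -[u N]scale1r; apply: (VP) => //; exact: (proj1 (hu N)).
  apply: le_trans (dle _ Vuw) _.
  have -> : x - (u N + w) = (x - y - w) - (u N - y).
    by rewrite opprB opprD [RHS]addrACA subrK [- w - _]addrC.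
  by apply: le_trans (le_l2normD _ _) _; rewrite l2normN lerD2l hN.
exists y; split=> // v Vv; set g := x - y in yd dy *; set a := dotp g v.
apply/eqP; apply/negPn/negP => a0.
have na : 0 < nrm a by rewrite lt_neqAle normc_ge0 andbT eq_sym; apply: contra a0 => /eqP/Normc.eq0_normc->.
(* If a = <g, v> were nonzero, replacing [y] by y + t a v would change the squared distance by -2 t
   |a|^2 + t^2 |a|^2 |v|^2, which is at most -t |a|^2 because t |v|^2 <= 1. *)
pose t := (l2norm v ^+ 2 + 1)^-1.
have t0 : 0 < t by rewrite invr_gt0 ltr_wpDl// sqr_ge0.
have tv : t * l2norm v ^+ 2 <= 1.
  by rewrite mulrC ler_pdivrMr ?mul1r ?lerDl// ltr_wpDl// sqr_ge0.
have Vw : V ((t%:C%C * a) *: v) by rewrite -[_ *: _]addr0; exact: VP.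
have := dy _ Vw; rewrite -(@ler_pXn2r _ 2) ?nnegrE ?l2norm_ge0//.
rewrite l2norm_sqrB l2normZ dotpZr conjcM conjc_realC -mulrA [conjc a * _]mulrC.
rewrite -/a mulc_conj -realCM exprMn Normc.normcM.
have -> : nrm t%:C%C = t by rewrite /= expr0n addr0 sqrtr_sqr ger0_norm// ltW.
have : l2norm g ^+ 2 <= d ^+ 2 by rewrite ler_pXn2r ?nnegrE ?l2norm_ge0.
have na2 : 0 < nrm a ^+ 2 by rewrite exprn_gt0.
rewrite -[complex.Re _]/(t * nrm a ^+ 2) exprMn; move: na2 tv.
move: (nrm a ^+ 2) (l2norm v ^+ 2) (l2norm g ^+ 2) (d ^+ 2) => A W G D2 A0 tW GD.
have tA : 0 < t * A by rewrite mulr_gt0.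
have : t * A * (t * W) <= t * A by rewrite ler_piMr// ltW.
have -> : t * A * (t * W) = t ^+ 2 * A * W by ring.
lra.
Qed.

End Projection.

(** * Adjoints *)

Section Operators.
Context {R : realType}.
Implicit Types (X Y : choiceType).
Local Notation nrm := Normc.normc.

Lemma bop_ext X (S T : bop R X) : (forall xi, S xi = T xi) -> S = T.
Proof. by move=> h; apply: val_inj; apply/funext. Qed.

Lemma bop_ext_dotp X (S T : bop R X) :
  (forall xi eta, dotp (S xi) eta = dotp (T xi) eta) -> S = T.
Proof. by move=> h; apply: bop_ext => xi; apply: dotp_ext. Qed.

Lemma bopE X (S T : bop R X) xi : (S * T) xi = S (T xi). Proof. by []. Qed.
Lemma bop1E X (xi : ell2 R X) : (1 : bop R X) xi = xi. Proof. by []. Qed.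
Lemma bopDE X (S T : bop R X) xi : (S + T) xi = S xi + T xi. Proof. by []. Qed.
Lemma bopZE X a (T : bop R X) xi : (a *: T) xi = a *: T xi. Proof. by []. Qed.
Lemma bop0E X (xi : ell2 R X) : (0 : bop R X) xi = 0. Proof. by []. Qed.

Lemma bop_scale X (T : bop R X) a xi : T (a *: xi) = a *: T xi.
Proof. exact: linearZ. Qed.

Lemma bopZl X a (S T : bop R X) : (a *: S) * T = a *: (S * T).
Proof. exact: bop_ext. Qed.

Lemma bopZr X a (S T : bop R X) : S * (a *: T) = a *: (S * T).
Proof. by apply: bop_ext => xi; rewrite !bopE !bopZE linearZ. Qed.

Lemma bop_bound X (T : bop R X) :
  exists2 M : R, 0 <= M & forall xi, l2norm (T xi) <= M * l2norm xi.
Proof.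
have [M hM] := bop_bounded T; exists `|M| => // xi.
by apply: le_trans (hM xi) _; rewrite ler_wpM2r ?l2norm_ge0// ler_norm.
Qed.

Lemma is_bopP X (f : ell2 R X -> ell2 R X) (M : R) : linear f ->
  (forall xi, l2norm (f xi) <= M * l2norm xi) -> f \in @is_bop R X.
Proof. by move=> lf hM; apply/asboolP; split=> //; exists M. Qed.

Definition bounded_functional X (f : ell2 R X -> R[i]) : Prop :=
  (forall a x y, f (a *: x + y) = a * f x + f y) /\
  exists M : R, forall x, nrm (f x) <= M * l2norm x.

(** The representing vector is a multiple of [p], the component orthogonal to the kernel of some x0
    outside it: x - (f x / f p) p lies in the kernel for every [x]. *)
Lemma riesz X (f : ell2 R X -> R[i]) : bounded_functional f ->
  exists r, forall x, f x = dotp x r.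
Proof.
move=> [lf [M hM]].
have f0 : f 0 = 0.
  by have := lf 1 0 0; rewrite scaler0 addr0 mul1r => /eqP; rewrite -subr_eq subrr => /eqP.
have fZ a x : f (a *: x) = a * f x by have := lf a x 0; rewrite !addr0 f0 addr0.
have fB x y : f (x - y) = f x - f y.
  by have := lf (-1) y x; rewrite scaleN1r mulN1r addrC => ->; rewrite addrC.
pose V : set (ell2 R X) := [set x | f x = 0].
have sV : is_subspace V.
  split; first exact: f0.
  by move=> a x y fx fy; rewrite /V /mkset lf fx fy mulr0 addr0.
have [[x0 fx0]|nf] := pselect (exists x, f x <> 0); last first.
  exists 0 => x; rewrite dotp0r; apply: contrapT => fx.
  by apply: nf; exists x.
have [y [Vy oy]] := projection_exists x0 sV.
have M0 : 0 < `|M| + 1 by rewrite ltr_wpDl.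
(* [y] is only known to be in the closure of the kernel; boundedness of [f] closes the gap. *)
have fy : f y = 0.
  apply: normc_small => e e0.
  have [v Vv yv] := Vy _ (divr_gt0 e0 M0).
  have fv : f v = 0 := Vv; rewrite -[f y]subr0 -fv -fB (le_trans (hM _))//.
  apply: (@le_trans _ _ ((`|M| + 1) * (e / (`|M| + 1)))).
    apply: (@le_trans _ _ ((`|M| + 1) * l2norm (y - v))).
      by rewrite ler_wpM2r ?l2norm_ge0// (le_trans (ler_norm _))// lerDl.
    by rewrite ler_wpM2l// ltW.
  by rewrite mulrC divfK// gt_eqF.
pose p := x0 - y.
have fp : f p <> 0 by rewrite fB fy subr0.
have p0 : dotp p p <> 0.
  by move=> /dotp_eq0 p0; apply: fp; rewrite p0.
have /eqP fp0 := fp; have /eqP pp0 := p0.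
exists (conjc (f p / dotp p p) *: p) => x.
rewrite dotpZr conjcK.
have Vx : V (x - (f x / f p) *: p) by rewrite /V /= fB fZ divfK// subrr.
have : dotp (x - (f x / f p) *: p) p = 0.
  by rewrite dotpC (oy _ Vx) conjc0.
rewrite dotpBl dotpZl => /eqP; rewrite subr_eq0 => /eqP ->.
by field; rewrite fp0 pp0.
Qed.

Lemma bounded_functional_dotp X (T : bop R X) y :
  bounded_functional (fun x => dotp (T x) y).
Proof.
split=> [a x x'|]; first by rewrite linearP dotpP.
have [M M0 hM] := bop_bound T; exists (M * l2norm y) => x.
apply: le_trans (cauchy_schwarz _ _) _.
by rewrite mulrAC ler_wpM2r ?l2norm_ge0.
Qed.

(** Riesz vectors stand in for density of the finitely supported vectors: the value at [delta x]
    determines the coordinate of the representing vector at [x]. *)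
Lemma functional_eq X (f g : ell2 R X -> R[i]) :
  bounded_functional f -> bounded_functional g ->
  (forall x, f (delta x) = g (delta x)) -> f = g.
Proof.
move=> /riesz[r fr] /riesz[s gs] fg.
suff -> : f = g by [].
apply/funext => x; rewrite fr gs; congr dotp.
apply: ell2_ext => i; apply: (can_inj (@conjcK R)).
by rewrite -!dotp_delta -!dotpC -fr -gs.
Qed.

Lemma adj_exists X (T : bop R X) :
  exists S : bop R X, forall x y, dotp (T x) y = dotp x (S y).
Proof.
have /choice[S hS] := fun y => riesz (bounded_functional_dotp T y).
have [M M0 hM] := bop_bound T.
have Sb : S \in @is_bop R X.
  apply: (@is_bopP _ _ M) => [a x y|y].
    by apply: dotp_extr => z; rewrite -hS !dotpDr !dotpZr -!hS.
  have [->|n0] := eqVneq (l2norm (S y)) 0; first by rewrite mulr_ge0 ?l2norm_ge0.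
  have np : 0 < l2norm (S y) by rewrite lt_neqAle eq_sym n0 l2norm_ge0.
  (* |S y|^2 = <T (S y), y> <= M |S y| |y|, to be divided by |S y|. *)
  rewrite -(ler_pM2l np) -expr2.
  have -> : l2norm (S y) ^+ 2 = nrm (dotp (S y) (S y)).
    by rewrite dotp_self /= expr0n addr0 sqrtr_sqr ger0_norm// sqr_ge0.
  rewrite -hS (le_trans (cauchy_schwarz _ _))// mulrA ler_wpM2r ?l2norm_ge0//.
  by rewrite mulrC hM.
by exists (Bop Sb).
Qed.

Lemma adjP X (T : bop R X) x y : dotp (T x) y = dotp x (adj T y).
Proof.
have [S hS] := adj_exists T.
by move: x y; rewrite /adj; case: xgetP => [U _ hU|/(_ S)[]].
Qed.

Lemma adjPr X (T : bop R X) x y : dotp (adj T x) y = dotp x (T y).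
Proof. by rewrite dotpC -adjP -dotpC. Qed.

Lemma adj_unique X (S T : bop R X) :
  (forall x y, dotp (T x) y = dotp x (S y)) -> adj T = S.
Proof. by move=> h; apply: bop_ext => y; apply: dotp_extr => z; rewrite -adjP h. Qed.

Lemma adj_bopK X (T : bop R X) : adj (adj T) = T.
Proof. by apply: adj_unique => x y; rewrite adjPr. Qed.

Lemma adj_bopM X (S T : bop R X) : adj (S * T) = adj T * adj S.
Proof. by apply: adj_unique => x y; rewrite !bopE !adjP. Qed.

Lemma adj_bop1 X : adj (1 : bop R X) = 1.
Proof. exact: adj_unique. Qed.

Lemma adj_bopD X (S T : bop R X) : adj (S + T) = adj S + adj T.
Proof. by apply: adj_unique => x y; rewrite !bopDE dotpDl dotpDr !adjP. Qed.

Lemma adj_bopZ X a (T : bop R X) : adj (a *: T) = conjc a *: adj T.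
Proof. by apply: adj_unique => x y; rewrite !bopZE dotpZl dotpZr conjcK adjP. Qed.

Lemma adj_bopN X (T : bop R X) : adj (- T) = - adj T.
Proof. by rewrite -scaleN1r adj_bopZ conjcN conjc1 scaleN1r. Qed.

Lemma adj_bopB X (S T : bop R X) : adj (S - T) = adj S - adj T.
Proof. by rewrite adj_bopD adj_bopN. Qed.

Lemma bop_eq_delta X (S T : bop R X) :
  (forall x, S (delta x) = T (delta x)) -> S = T.
Proof.
move=> h; apply: bop_ext_dotp => xi eta.
have := functional_eq (bounded_functional_dotp S eta) (bounded_functional_dotp T eta).
by move=> /(_ _)/(congr1 (@^~ xi)); apply => x; rewrite h.
Qed.

Lemma l2closure_bop X (V : set (ell2 R X)) (T : bop R X) :
  (forall v, V v -> V (T v)) -> forall y, l2closure V y -> l2closure V (T y).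
Proof.
move=> TV y Vy e e0; have [M M0 hM] := bop_bound T.
have M1 : 0 < M + 1 by rewrite ltr_wpDl.
have [v Vv yv] := Vy _ (divr_gt0 e0 M1); exists (T v); first exact: TV.
rewrite -linearB (le_trans (hM _))//.
apply: (@le_trans _ _ ((M + 1) * (e / (M + 1)))).
  by apply: ler_pM; rewrite ?l2norm_ge0// lerDl.
by rewrite mulrC divfK// gt_eqF.
Qed.

Definition proj X (V : set (ell2 R X)) (x : ell2 R X) : ell2 R X :=
  xget 0 [set y | l2closure V y /\ orthog V (x - y)].

Section Proj.
Variables (X : choiceType) (V : set (ell2 R X)) (sV : is_subspace V).

Lemma projP x : l2closure V (proj V x) /\ orthog V (x - proj V x).
Proof.
have [y hy] := projection_exists x sV.
by rewrite /proj; case: xgetP => [z _ hz|/(_ y)[]].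
Qed.

Lemma proj_unique x y : l2closure V y -> orthog V (x - y) -> proj V x = y.
Proof.
move=> Vy oy; have [Vp op] := projP x.
have [_ cP] := l2closure_subspace sV.
have Vd : l2closure V (proj V x - y).
  by have := cP (-1) _ _ Vy Vp; rewrite scaleN1r addrC.
apply/eqP; rewrite -subr_eq0; apply/eqP; apply: dotp_eq0.
apply: orthog_closure Vd => v Vv.
have -> : proj V x - y = (x - y) - (x - proj V x) by rewrite opprB [RHS]addrC subrKA.
by rewrite dotpBl (oy _ Vv) (op _ Vv) subrr.
Qed.

Lemma proj_bop_subproof : proj V \in @is_bop R X.
Proof.
apply: (@is_bopP _ _ 1) => [a x y|x].
  have [Vx ox] := projP x; have [Vy oy] := projP y.
  apply: proj_unique; first exact: (l2closure_subspace sV).2.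
  move=> v Vv.
  have -> : a *: x + y - (a *: proj V x + proj V y) =
      a *: (x - proj V x) + (y - proj V y) by rewrite opprD addrACA scalerBr.
  move: (ox v Vv) (oy v Vv); move: (x - proj V x) (y - proj V y) => p q hp hq.
  by rewrite dotpP hp hq mulr0 addr0.
have [Vx ox] := projP x; rewrite mul1r.
rewrite -(@ler_pXn2r _ 2) ?nnegrE ?l2norm_ge0//.
have := l2norm_sqrD (x - proj V x) (proj V x); rewrite subrK => ->.
by rewrite (orthog_closure ox Vx) mulr0 addr0 lerDr sqr_ge0.
Qed.

Definition projb : bop R X := Bop proj_bop_subproof.

Lemma projb_closure x : l2closure V (projb x). Proof. exact: (projP x).1. Qed.

Lemma projb_id x : l2closure V x -> projb x = x.
Proof.
by move=> Vx; apply: proj_unique => // v _; rewrite subrr dotp0l.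
Qed.

Lemma projb_idem : projb * projb = projb.
Proof. by apply: bop_ext => x; rewrite bopE projb_id//; exact: projb_closure. Qed.

Lemma adj_projb : adj projb = projb.
Proof.
apply: adj_unique => x y; have [Vx ox] := projP x; have [Vy oy] := projP y.
rewrite -[in LHS](subrK (proj V y) y) -[in RHS](subrK (proj V x) x).
rewrite dotpDr dotpDl (orthog_closure ox Vy) add0r.
by rewrite (dotpC (y - _)) (orthog_closure oy Vx) conjc0 add0r.
Qed.

(** [T] preserves the closure of [V], and since [adj T] preserves [V], it preserves the orthogonal
    complement as well. *)
Lemma projb_comm (T : bop R X) : (forall v, V v -> V (T v)) ->
  (forall v, V v -> V (adj T v)) -> projb * T = T * projb.
Proof.
move=> TV T'V; apply: bop_ext => x; have [Vx ox] := projP x.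
apply: (@proj_unique (T x) (T (proj V x))); first exact: l2closure_bop.
by move=> v Vv; rewrite -linearB adjP ox//; exact: T'V.
Qed.

End Proj.

End Operators.

(** * Tensor products and density in the bicommutant *)

Section Amplification.
Context {R : realType}.
Implicit Types (X Y I J : choiceType).
Local Notation nrm := Normc.normc.

Lemma slice_ext X I (xi eta : ell2 R (X * I)%type) :
  (forall i, slice xi i = slice eta i) -> xi = eta.
Proof. by move=> h; apply: ell2_ext => -[x i]; rewrite -!sliceE h. Qed.

Lemma l2norm_pullback X Y (e : Y -> X) (einj : injective e) (xi : ell2 R X) :
  l2norm (pullback einj xi) <= l2norm xi.
Proof.
rewrite -(@ler_pXn2r _ 2) ?nnegrE ?l2norm_ge0// -lee_fin -!sqsumE.
exact: sqsum_pullback.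
Qed.

Lemma pullbackB X Y (e : Y -> X) (einj : injective e) (xi eta : ell2 R X) :
  pullback einj (xi - eta) = pullback einj xi - pullback einj eta.
Proof. exact: ell2_ext. Qed.

Lemma sqsum_slices X I (xi : ell2 R (X * I)%type) :
  sqsum xi = \esum_(i in [set: I]) (l2norm (slice xi i) ^+ 2)%:E.
Proof. by rewrite sqsum_slice; apply: eq_esum => i _; rewrite -sqsumE. Qed.

Definition ampf X I (T : bop R X) (xi : ell2 R (X * I)%type) (p : X * I) : R[i] :=
  T (slice xi p.2) p.1.

Lemma sqsum_ampf X I (T : bop R X) (M : R) (xi : ell2 R (X * I)%type) : 0 <= M ->
  (forall zeta, l2norm (T zeta) <= M * l2norm zeta) ->
  (sqsum (ampf T xi) <= ((M * l2norm xi) ^+ 2)%:E)%E.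
Proof.
move=> M0 hM; rewrite sqsum_slice.
have E i : sqsum (fun x => ampf T xi (x, i)) = (l2norm (T (slice xi i)) ^+ 2)%:E.
  by rewrite -sqsumE.
under eq_esum do rewrite E.
apply: esum_le_seq => s us.
apply: (@le_trans _ _ (M ^+ 2 * \sum_(i <- s) l2norm (slice xi i) ^+ 2)).
  rewrite mulr_sumr; apply: ler_sum => i _.
  by rewrite -exprMn ler_pXn2r ?nnegrE ?mulr_ge0 ?l2norm_ge0.
rewrite exprMn ler_wpM2l ?sqr_ge0// -lee_fin -sqsumE sqsum_slices.
by apply: (esum_ge_seq (fun i => sqr_ge0 (l2norm (slice xi i)))).
Qed.

Lemma ampf_is_ell2 X I (T : bop R X) (xi : ell2 R (X * I)%type) :
  ampf T xi \in @is_ell2 R (X * I)%type.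
Proof.
have [M M0 hM] := bop_bound T.
by apply/asboolP; apply: le_lt_trans (sqsum_ampf xi M0 hM) (ltry _).
Qed.

Definition amp_fun X I (T : bop R X) (xi : ell2 R (X * I)%type) : ell2 R (X * I)%type :=
  Ell2 (ampf_is_ell2 T xi).

Lemma slice_amp_fun X I (T : bop R X) (xi : ell2 R (X * I)%type) i :
  slice (amp_fun T xi) i = T (slice xi i).
Proof. exact: ell2_ext. Qed.

Lemma slicePE X I a (xi eta : ell2 R (X * I)%type) i :
  slice (a *: xi + eta) i = a *: slice xi i + slice eta i.
Proof. exact: ell2_ext. Qed.

Lemma amp_bop_subproof X I (T : bop R X) : @amp_fun X I T \in @is_bop R (X * I)%type.
Proof.
have [M M0 hM] := bop_bound T; apply: (@is_bopP _ _ _ M) => [a xi eta|xi].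
  by apply: slice_ext => i; rewrite slicePE !slice_amp_fun slicePE linearP.
rewrite -(@ler_pXn2r _ 2) ?nnegrE ?mulr_ge0 ?l2norm_ge0// -lee_fin -sqsumE.
exact: sqsum_ampf.
Qed.

(* [amp I T] is T (x) 1 on l^2(X) (x) l^2(I), and [ampr X T] is 1 (x) T. *)
Definition amp X I (T : bop R X) : bop R (X * I)%type := Bop (amp_bop_subproof I T).

Lemma slice_amp X I (T : bop R X) (xi : ell2 R (X * I)%type) i :
  slice (amp I T xi) i = T (slice xi i).
Proof. exact: ell2_ext. Qed.

Lemma ampM X I (S T : bop R X) : amp I (S * T) = amp I S * amp I T.
Proof. by apply: bop_ext => xi; apply: slice_ext => i; rewrite bopE !slice_amp. Qed.

Lemma amp1 X I : amp I (1 : bop R X) = 1.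
Proof. by apply: bop_ext => xi; apply: slice_ext => i; rewrite slice_amp. Qed.

Lemma ampP X I a (S T : bop R X) : amp I (a *: S + T) = a *: amp I S + amp I T.
Proof.
apply: bop_ext => xi; apply: slice_ext => i.
by rewrite slice_amp !bopDE !bopZE slicePE !slice_amp.
Qed.

Lemma amp0 X I : amp I (0 : bop R X) = 0.
Proof.
by apply: bop_ext => xi; apply: slice_ext => i; rewrite slice_amp; apply: ell2_ext.
Qed.

Lemma ampZ X I a (T : bop R X) : amp I (a *: T) = a *: amp I T.
Proof. by rewrite -[_ *: T]addr0 ampP amp0 addr0. Qed.

Lemma adj_amp X I (T : bop R X) : adj (amp I T) = amp I (adj T).
Proof.
apply: adj_unique => xi eta; rewrite !dotp_slice; congr csum; apply/funext => i.
by rewrite !slice_amp adjP.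
Qed.

Lemma slice_tensv X I (xi : ell2 R X) (eta : ell2 R I) i :
  slice (tensv xi eta) i = eta i *: xi.
Proof. by apply: ell2_ext => x; rewrite /= mulrC. Qed.

Lemma amp_tensv X I (T : bop R X) (xi : ell2 R X) (eta : ell2 R I) :
  amp I T (tensv xi eta) = tensv (T xi) eta.
Proof. by apply: slice_ext => i; rewrite slice_amp !slice_tensv linearZ. Qed.

Lemma delta_tensv X I (x : X) (i : I) :
  delta (x, i) = tensv (delta x) (delta i) :> ell2 R (X * I)%type.
Proof.
apply: ell2_ext => -[y j]; rewrite -[RHS]/((y == x)%:R * (j == i)%:R) deltaE xpair_eqE.
by case: (y == x); case: (j == i); rewrite ?mulr1 ?mulr0.
Qed.

Lemma bop_eq_tensv X I (S T : bop R (X * I)%type) :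
  (forall xi eta, S (tensv xi eta) = T (tensv xi eta)) -> S = T.
Proof. by move=> h; apply: bop_eq_delta => -[x i]; rewrite delta_tensv. Qed.

Section Conjugation.
Variables (X Y : choiceType) (e : Y -> X) (e' : X -> Y).
Variables (eK : cancel e e') (e'K : cancel e' e).
Notation conj := (conj_bop eK e'K).

Lemma conj_bopE (T : bop R X) xi : conj T xi =
  pullback (can_inj eK) (T (pullback (can_inj e'K) xi)).
Proof. by []. Qed.

Lemma pullbackK (xi : ell2 R X) :
  pullback (can_inj e'K) (pullback (can_inj eK) xi) = xi.
Proof. by apply: ell2_ext => x; rewrite /= e'K. Qed.

Lemma pullbackK' (xi : ell2 R Y) :
  pullback (can_inj eK) (pullback (can_inj e'K) xi) = xi.
Proof. by apply: ell2_ext => x; rewrite /= eK. Qed.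

Lemma conj_bopM (S T : bop R X) : conj (S * T) = conj S * conj T.
Proof. by apply: bop_ext => xi; rewrite bopE !conj_bopE pullbackK. Qed.

Lemma conj_bop1 : conj (1 : bop R X) = 1.
Proof. by apply: bop_ext => xi; rewrite conj_bopE !bop1E pullbackK'. Qed.

Lemma conj_bopZ a (T : bop R X) : conj (a *: T) = a *: conj T.
Proof. by apply: bop_ext => xi; apply: ell2_ext. Qed.

Lemma adj_conj_bop (T : bop R X) : adj (conj T) = conj (adj T).
Proof.
apply: adj_unique => xi eta; rewrite !conj_bopE.
rewrite (dotp_pullback _ (can_inj e'K)) // adjP.
by rewrite -(dotp_pullback (can_inj e'K) (can_inj eK)).
Qed.

End Conjugation.

Definition ampr X I (T : bop R I) : bop R (X * I)%type :=
  conj_bop (@swapK X I) (@swapK I X) (amp X T).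

Lemma amprE X I (T : bop R I) (xi : ell2 R (X * I)%type) p :
  ampr X T xi p = T (slice (pullback (can_inj (@swapK I X)) xi) p.1) p.2.
Proof. by []. Qed.

Lemma swap_tensv X I (xi : ell2 R X) (eta : ell2 R I) :
  pullback (can_inj (@swapK X I)) (tensv eta xi) = tensv xi eta.
Proof. by apply: ell2_ext => -[x i]; rewrite /= mulrC. Qed.

Lemma ampr_tensv X I (T : bop R I) (xi : ell2 R X) (eta : ell2 R I) :
  ampr X T (tensv xi eta) = tensv xi (T eta).
Proof. by rewrite conj_bopE swap_tensv amp_tensv swap_tensv. Qed.

(** The product of amplifications witnesses that the [xget] in [tens] is not taken over an empty
    set; agreement on simple tensors gives uniqueness. *)
Lemma tensE X I (x : bop R X) (y : bop R I) : tens x y = amp I x * ampr X y.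
Proof.
have h xi eta : (amp I x * ampr X y) (tensv xi eta) = tensv (x xi) (y eta).
  by rewrite bopE ampr_tensv amp_tensv.
rewrite /tens; case: xgetP => [T _ hT|/(_ _ h)[]].
by apply: bop_eq_tensv => xi eta; rewrite hT h.
Qed.

Lemma tens_tensv X I (x : bop R X) (y : bop R I) xi eta :
  tens x y (tensv xi eta) = tensv (x xi) (y eta).
Proof. by rewrite tensE bopE ampr_tensv amp_tensv. Qed.

Lemma tensM X I (x x' : bop R X) (y y' : bop R I) :
  tens x y * tens x' y' = tens (x * x') (y * y').
Proof. by apply: bop_eq_tensv => xi eta; rewrite bopE !tens_tensv. Qed.

Lemma tens1r X I (x : bop R X) : tens x (1 : bop R I) = amp I x.
Proof. by apply: bop_eq_tensv => xi eta; rewrite tens_tensv amp_tensv. Qed.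

Lemma tens1l X I (y : bop R I) : tens (1 : bop R X) y = ampr X y.
Proof. by apply: bop_eq_tensv => xi eta; rewrite tens_tensv ampr_tensv. Qed.

Lemma tens11 X I : tens (1 : bop R X) (1 : bop R I) = 1.
Proof. by rewrite tens1r amp1. Qed.

Lemma amp_ampr X I (x : bop R X) (y : bop R I) :
  amp I x * ampr X y = ampr X y * amp I x.
Proof.
by apply: bop_eq_tensv => xi eta; rewrite !bopE !(ampr_tensv, amp_tensv).
Qed.

Lemma adj_tens X I (x : bop R X) (y : bop R I) :
  adj (tens x y) = tens (adj x) (adj y).
Proof. by rewrite !tensE adj_bopM adj_amp adj_conj_bop adj_amp amp_ampr. Qed.

(* The slice (id (x) omega)(P), with omega T = <T delta_j, delta_i>. *)
Definition corner_fun X I (P : bop R (X * I)%type) (i j : I) (xi : ell2 R X) : ell2 R X :=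
  slice (P (tensv xi (delta j))) i.

Lemma tensvPl X I a (xi xi' : ell2 R X) (eta : ell2 R I) :
  tensv (a *: xi + xi') eta = a *: tensv xi eta + tensv xi' eta.
Proof.
apply: ell2_ext => -[x i]; rewrite -[LHS]/((a * xi x + xi' x) * eta i).
by rewrite -[RHS]/(a * (xi x * eta i) + xi' x * eta i) mulrDl mulrA.
Qed.

Lemma corner_subproof X I (P : bop R (X * I)%type) i j :
  corner_fun P i j \in @is_bop R X.
Proof.
have [M M0 hM] := bop_bound P; apply: (@is_bopP _ _ _ M) => [a xi eta|xi].
  by rewrite /corner_fun tensvPl linearP slicePE.
apply: le_trans (l2norm_pullback _ _) _; apply: le_trans (hM _) _.
by rewrite l2norm_tensv l2norm_delta mulr1.
Qed.

Definition corner X I (P : bop R (X * I)%type) i j : bop R X :=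
  Bop (corner_subproof P i j).

Lemma cornerE X I (P : bop R (X * I)%type) i j xi :
  corner P i j xi = slice (P (tensv xi (delta j))) i.
Proof. by []. Qed.

Lemma dotp_corner X I (P : bop R (X * I)%type) i j xi eta :
  dotp (corner P i j xi) eta = dotp (P (tensv xi (delta j))) (tensv eta (delta i)).
Proof.
rewrite cornerE [RHS]dotp_slice (@csum1 _ _ _ i) => [|k ki].
  by rewrite slice_tensv deltaE eqxx scale1r.
by rewrite slice_tensv deltaE (negbTE ki) scale0r dotp0r.
Qed.

Lemma adj_corner X I (P : bop R (X * I)%type) i j :
  adj (corner P i j) = corner (adj P) j i.
Proof.
apply: adj_unique => xi eta; rewrite dotp_corner adjP dotpC -dotp_corner.
by rewrite -dotpC.
Qed.

(** [amp I T] is the block-diagonal operator with [T] in every block, so commutation is tested on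
    each block of [P]. This carries commutation with S (x) 1 over to the bicommutant. *)
Lemma corner_commP X I (P : bop R (X * I)%type) (T : bop R X) :
  P * amp I T = amp I T * P <->
  forall i j, corner P i j * T = T * corner P i j.
Proof.
split=> [h i j|h].
  apply: bop_ext => xi.
  by rewrite !bopE !cornerE -slice_amp -bopE -h bopE amp_tensv.
apply: bop_eq_delta => -[x j]; rewrite delta_tensv; apply: slice_ext => i.
by rewrite !bopE slice_amp amp_tensv -!cornerE -!bopE h.
Qed.

End Amplification.

Section Bicommutant.
Context {R : realType}.
Implicit Types (X Y I J : choiceType).
Local Notation nrm := Normc.normc.

Lemma sub_bicommutant X (S : set (bop R X)) : S `<=` bicommutant S.
Proof. by move=> s Ss T hT; rewrite hT. Qed.

Lemma commutant1 X (S : set (bop R X)) : commutant S 1.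
Proof. by move=> T _; rewrite mul1r mulr1. Qed.

Lemma commutantM X (S : set (bop R X)) x y :
  commutant S x -> commutant S y -> commutant S (x * y).
Proof. by move=> hx hy T ST; rewrite -mulrA hy// mulrA hx// mulrA. Qed.

Lemma commutantP X (S : set (bop R X)) a x y :
  commutant S x -> commutant S y -> commutant S (a *: x + y).
Proof.
by move=> hx hy T ST; rewrite mulrDl mulrDr bopZl bopZr hx// hy.
Qed.

Lemma commutant0 X (S : set (bop R X)) : commutant S 0.
Proof. by move=> T _; rewrite mul0r mulr0. Qed.

Lemma commutant_adj X (S : set (bop R X)) :
  (forall s, S s -> S (adj s)) ->
  forall x, commutant S x -> commutant S (adj x).
Proof.
move=> Sadj x hx T ST; rewrite -[T in LHS]adj_bopK -[T in RHS]adj_bopK -!adj_bopM.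
by rewrite hx//; exact: Sadj.
Qed.

Lemma bicommutant_adj X (S : set (bop R X)) :
  (forall s, S s -> S (adj s)) ->
  forall x, bicommutant S x -> bicommutant S (adj x).
Proof. by move=> Sadj; apply: commutant_adj; exact: commutant_adj. Qed.

Inductive lspan X (S : set (bop R X)) : bop R X -> Prop :=
| lspan0 : lspan S 0
| lspan_cons a s T : S s -> lspan S T -> lspan S (a *: s + T).

Lemma lspan_sub X (S : set (bop R X)) : S `<=` lspan S.
Proof. by move=> s Ss; rewrite -[s]scale1r -[_ *: _]addr0; apply: lspan_cons => //; exact: lspan0. Qed.

Lemma lspanP X (S : set (bop R X)) a x y :
  lspan S x -> lspan S y -> lspan S (a *: x + y).
Proof.
move=> hx hy; elim: hx => [|b s T Ss _ IH]; first by rewrite scaler0 add0r.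
by rewrite scalerDr scalerA -addrA; apply: lspan_cons.
Qed.

Lemma lspanMl X (S : set (bop R X)) s x :
  (forall s t, S s -> S t -> S (s * t)) -> S s -> lspan S x -> lspan S (s * x).
Proof.
move=> SM Ss; elim=> [|b t T St _ IH]; first by rewrite mulr0; exact: lspan0.
by rewrite mulrDr bopZr; apply: lspan_cons => //; exact: SM.
Qed.

Lemma lspan_bicommutant X (S : set (bop R X)) : lspan S `<=` bicommutant S.
Proof.
move=> x; elim=> [|b t T St _ IH]; first exact: commutant0.
by apply: commutantP => //; exact: sub_bicommutant.
Qed.

Definition star_submonoid X (S : set (bop R X)) : Prop :=
  [/\ S 1, forall s t, S s -> S t -> S (s * t) & forall s, S s -> S (adj s)].

(* The projection onto the closure of (lspan S (x) 1) xi commutes with S (x) 1,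
   so its corners lie in the commutant of S and it commutes with x (x) 1. *)
Lemma bicommutant_density X I (S : set (bop R X)) (x : bop R X)
    (xi : ell2 R (X * I)%type) (e : R) :
  star_submonoid S -> bicommutant S x -> 0 < e ->
  exists2 T, lspan S T & l2norm (amp I T xi - amp I x xi) <= e.
Proof.
move=> [S1 SM Sadj] Sx e0.
pose V : set (ell2 R (X * I)%type) := [set amp I T xi | T in lspan S].
have sV : is_subspace V.
  split; first by exists 0; [exact: lspan0|rewrite amp0].
  move=> a _ _ [T hT <-] [U hU <-]; exists (a *: T + U); first exact: lspanP.
  by rewrite ampP.
have sVs s v : S s -> V v -> V (amp I s v).
  by move=> Ss [T hT <-]; exists (s * T); [exact: lspanMl|rewrite ampM].
have Ps s : S s -> projb sV * amp I s = amp I s * projb sV.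
  move=> Ss; apply: projb_comm => v Vv; first exact: sVs.
  by rewrite adj_amp; apply: sVs => //; exact: Sadj.
have Px : projb sV * amp I x = amp I x * projb sV.
  apply/corner_commP => i j; rewrite Sx// => s Ss.
  by move: i j; apply/corner_commP; exact: Ps.
(* Because 1 is in the span, [xi] is in [V] and is fixed by the projection. *)
have Vxi : V xi by exists 1; [exact: lspan_sub|rewrite amp1].
have : l2closure V (amp I x xi).
  rewrite -[xi in amp I x xi](projb_id sV (sub_l2closure Vxi)) -bopE -Px bopE.
  exact: projb_closure.
move=> /(_ _ e0)[_ [T hT <-] h]; exists T => //.
by rewrite -l2normN opprB.
Qed.

(** Extension by zero along an injection, obtained as the Riesz vector of zeta |-> <zeta o f, xi>,
    with no partial inverse of [f]. *)
Lemma push_exists X Y (f : Y -> X) (finj : injective f) (xi : ell2 R Y) :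
  exists eta : ell2 R X, (forall y, eta (f y) = xi y) /\
    (forall x, (forall y, f y <> x) -> eta x = 0).
Proof.
have bf : bounded_functional (fun zeta => dotp (pullback finj zeta) xi).
  split=> [a x y|]; first by rewrite pullback_linear dotpP.
  exists (l2norm xi) => x; rewrite mulrC; apply: le_trans (cauchy_schwarz _ _) _.
  by rewrite ler_wpM2r ?l2norm_ge0// l2norm_pullback.
have [eta heta] := riesz bf.
have E x : eta x = conjc (dotp (pullback finj (delta x)) xi).
  by rewrite heta -dotpC dotp_delta.
exists eta; split=> [y|x xf]; rewrite E.
  rewrite -dotpC (_ : pullback _ _ = delta y) ?dotp_delta//.
  by apply: ell2_ext => z; rewrite /= /deltaf (inj_eq finj).
rewrite (_ : pullback _ _ = 0) ?dotp0l ?conjc0//.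
by apply: ell2_ext => z; rewrite /= /deltaf; case: eqP => // /xf.
Qed.

Definition idx_inj X (I J : choiceType) (f : J -> I) (finj : injective f) :
  injective (fun p : X * J => (p.1, f p.2)).
Proof. by move=> [x j] [y k] [-> /finj->]. Qed.

Lemma pullback_amp X (I J : choiceType) (f : J -> I) (finj : injective f) (T : bop R X) xi :
  pullback (idx_inj (X := X) finj) (amp I T xi) = amp J T (pullback (idx_inj finj) xi).
Proof.
apply: ell2_ext => -[x j]; rewrite [LHS]/=.
by congr (T _ _); apply: ell2_ext.
Qed.

(* Approximating in the amplifications by all index types I at once avoids
   re-indexing functionals by nat. *)
Definition strong_filter X (S : set (bop R X)) (x : bop R X) : set_system (bop R X) :=
  [set A | exists (I : choiceType) (xi : ell2 R (X * I)%type) (e : R), 0 < e /\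
    forall T, lspan S T -> l2norm (amp I T xi - amp I x xi) <= e -> A T].

(** Two basic neighbourhoods are intersected over the disjoint union of their index types: the two
    vectors are placed side by side in l^2(X * (I + J)). *)
Lemma strong_filter_filter X (S : set (bop R X)) x : Filter (strong_filter S x).
Proof.
split.
- by exists nat, 0, 1; split.
- move=> A B [I [xi [d [d0 hA]]]] [J [eta [e [e0 hB]]]].
  have inlI : injective (@inl I J) by move=> ? ? [].
  have inrI : injective (@inr I J) by move=> ? ? [].
  have [xi' [h1 h2]] := push_exists (idx_inj (X := X) inlI) xi.
  have [eta' [h3 h4]] := push_exists (idx_inj (X := X) inrI) eta.
  have E1 : pullback (idx_inj inlI) (xi' + eta') = xi.
    apply: ell2_ext => p; rewrite -[LHS]/(xi' _ + eta' _) h1 h4 ?addr0//.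
  have E2 : pullback (idx_inj inrI) (xi' + eta') = eta.
    apply: ell2_ext => p; rewrite -[LHS]/(xi' _ + eta' _) h3 h2 ?add0r//.
  exists (I + J)%type, (xi' + eta'), (Num.min d e); split.
    by rewrite lt_min d0 e0.
  move=> T hT; rewrite le_min => /andP[hd he]; split.
    apply: hA => //; rewrite -E1 -!pullback_amp; apply: le_trans hd.
    by rewrite -pullbackB l2norm_pullback.
  apply: hB => //; rewrite -E2 -!pullback_amp; apply: le_trans he.
  by rewrite -pullbackB l2norm_pullback.
- by move=> A B AB [I [xi [d [d0 hA]]]]; exists I, xi, d; split=> // T hT h; apply/AB/hA.
Qed.

Lemma strong_filter_lspan X (S : set (bop R X)) x : strong_filter S x (lspan S).
Proof. by exists nat, 0, 1; split. Qed.

Lemma strong_filter_nonempty X (S : set (bop R X)) x A :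
  star_submonoid S -> bicommutant S x -> strong_filter S x A -> exists T, A T.
Proof.
move=> sS Sx [I [xi [e [e0 hA]]]].
by have [T hT h] := bicommutant_density xi sS Sx e0; exists T; exact: hA.
Qed.

Lemma strong_filter_dotp X (S : set (bop R X)) x I (xi eta : ell2 R (X * I)%type) (e : R) :
  0 < e -> strong_filter S x
    [set T | nrm (dotp (amp I T xi) eta - dotp (amp I x xi) eta) <= e].
Proof.
move=> e0; have n0 : 0 < l2norm eta + 1 by rewrite ltr_wpDl ?l2norm_ge0.
exists I, xi, (e / (l2norm eta + 1)); split; first by rewrite divr_gt0.
move=> T _ h; rewrite /mkset -dotpBl (le_trans (cauchy_schwarz _ _))//.
apply: (@le_trans _ _ ((e / (l2norm eta + 1)) * (l2norm eta + 1))).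
  by apply: ler_pM; rewrite ?l2norm_ge0// lerDl.
by rewrite divfK// gt_eqF.
Qed.

(** A square-summable sequence of vectors of l^2(X) is one vector of l^2(X * nat), so a normal
    functional is a vector functional of an amplification. *)
Lemma normal_functional_amp X (omega : bop R X -> R[i]) : normal_functional omega ->
  exists xi eta : ell2 R (X * nat)%type, forall T, omega T = dotp (amp nat T xi) eta.
Proof.
move=> [xi [eta [sxi seta hw]]].
have mk (u : nat -> ell2 R X) :
    (\esum_(n in [set: nat]) (l2norm (u n) ^+ 2)%:E < +oo)%E ->
    exists v : ell2 R (X * nat)%type, forall n, slice v n = u n.
  move=> su; have vP : (fun p : X * nat => u p.2 p.1) \in @is_ell2 R (X * nat)%type.
    apply/asboolP; rewrite sqsum_slice; apply: le_lt_trans su.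
    by apply: le_esum => n _; rewrite -sqsumE.
  by exists (Ell2 vP) => n; apply: ell2_ext.
have [v hv] := mk _ sxi; have [w hw'] := mk _ seta.
exists v, w => T; rewrite hw dotp_slice; congr csum; apply/funext => n.
by rewrite slice_amp hv hw'.
Qed.

Lemma normal_functional_dotp X (xi eta : ell2 R X) :
  normal_functional (fun T => dotp (T xi) eta).
Proof.
have fin (u : ell2 R X) : (\esum_(n in [set: nat])
    (l2norm (if n == 0%N then u else 0) ^+ 2)%:E < +oo)%E.
  rewrite (esumID [set 0%N]); last by move=> n _; rewrite lee_fin sqr_ge0.
  rewrite setTI esum_set1 ?lee_fin ?sqr_ge0//= esum1 ?adde0 ?ltry//.
  by move=> n [_ /= /eqP/negbTE->]; rewrite l2norm0 expr0n.
exists (fun n => if n == 0%N then xi else 0), (fun n => if n == 0%N then eta else 0).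
split=> // T; rewrite (@csum1 _ _ _ 0%N)//.
by move=> n /negbTE->; rewrite dotp0r.
Qed.

Lemma normr_complexE (z : R[i]) : `|z| = (nrm z)%:C%C. Proof. by []. Qed.

Lemma strong_filter_uw_cvg X (S : set (bop R X)) x : uw_cvg (strong_filter S x) x.
Proof.
move=> omega /normal_functional_amp[xi [eta hw]].
have FF := strong_filter_filter S x.
apply/(@cvgrPdist_le R[i] R[i]^o _ _ FF) => e e0.
(* In the order of [R[i]] a positive element is real. *)
have eE : e = (complex.Re e)%:C%C.
  by case: e e0 => a b; rewrite ltcE /= => /andP[/eqP -> _].
have r0 : 0 < complex.Re e by rewrite -ltcR -eE.
apply: filterS (strong_filter_dotp S x xi eta r0) => T h.
by rewrite normr_complexE eE lecR -[_ - _]opprB normcN !hw; exact: h.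
Qed.

(** Both sides are linear and agree on [S], hence on its span. Along the strong filter, elements of
    the span approach [x]: the left side follows by normality, the right side because it is a vector
    functional of an amplification. *)
Lemma normal_agree X Y I (S : set (bop R X)) (phi : bop R X -> bop R Y)
    (zeta zeta' : ell2 R Y) (xi eta : ell2 R (X * I)%type) :
  star_submonoid S -> normal_on (bicommutant S) phi ->
  (forall a x y, bicommutant S x -> bicommutant S y ->
     phi (a *: x + y) = a *: phi x + phi y) ->
  (forall s, S s -> dotp (phi s zeta) zeta' = dotp (amp I s xi) eta) ->
  forall x, bicommutant S x -> dotp (phi x zeta) zeta' = dotp (amp I x xi) eta.
Proof.
move=> sS nphi lphi agr x Sx; apply/eqP; rewrite -subr_eq0; apply/eqP.
have FF := strong_filter_filter S x.
have agrT T : lspan S T -> dotp (phi T zeta) zeta' = dotp (amp I T xi) eta.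
  elim=> [|a s T' Ss hT' IH].
    (* [phi] is linear on the bicommutant only, so [phi 0 = 0] is extracted from the instance a =
       -1, x = y = 0. *)
    have z := @commutant0 X (commutant S); have := lphi (-1) _ _ z z.
    by rewrite scaler0 addr0 scaleN1r addNr => ->; rewrite amp0 !dotp0l.
  rewrite lphi; [|exact: sub_bicommutant|exact: lspan_bicommutant].
  by rewrite ampP !dotpP IH agr.
have FM : strong_filter S x (bicommutant S).
  by apply: filterS (strong_filter_lspan S x); exact: lspan_bicommutant.
have c := nphi _ _ FF FM Sx (@strong_filter_uw_cvg _ S x) _ (normal_functional_dotp zeta zeta').
apply: normc_small => e e0.
have e2 : 0 < e / 2 by rewrite divr_gt0.
have e2C : 0 < (e / 2)%:C%C :> R[i] by rewrite ltcR.
have h1 := (@cvgrPdist_le R[i] R[i]^o _ _ (fmap_filter phi FF) _ _).1 c _ e2C.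
have h2 := strong_filter_dotp S x xi eta e2.
have [T [[hT hT'] hTT]] := strong_filter_nonempty sS Sx
  (filterI (filterI (@strong_filter_lspan _ S x) h1) h2).
have {}hT' : nrm (dotp (phi x zeta) zeta' - dotp (phi T zeta) zeta') <= e / 2.
  by rewrite -lecR -normr_complexE; exact: hT'.
rewrite -(subrKA (dotp (phi T zeta) zeta')) (le_trans (le_normcD _ _))//.
by rewrite [leRHS](splitr e) lerD// agrT.
Qed.

End Bicommutant.

(** * Hilbert-Schmidt operators *)

Section HilbertSchmidt.
Context {R : realType} {X : choiceType}.
Implicit Types (S T A P Q K : bop R X).
Local Notation nrm := Normc.normc.

(** The squared Hilbert-Schmidt norm, possibly infinite. On an orthogonal projection it is the
    rank. *)
Definition hs T : \bar R := \esum_(x in [set: X]) (l2norm (T (delta x)) ^+ 2)%:E.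

Definition hilbert_schmidt T : Prop := (hs T < +oo)%E.

Lemma hs_ge0 T : (0 <= hs T)%E.
Proof. by apply: esum_ge0 => x _; rewrite lee_fin sqr_ge0. Qed.

Lemma hs_fine T : hilbert_schmidt T -> hs T = (fine (hs T))%:E.
Proof. by move=> hT; rewrite fineK// ge0_fin_numE// hs_ge0. Qed.

Lemma hs_le S T (c : R) : (forall x, l2norm (S (delta x)) <= c * l2norm (T (delta x))) ->
  hilbert_schmidt T -> hilbert_schmidt S.
Proof.
move=> h hT; apply: le_lt_trans (ltry (c ^+ 2 * fine (hs T))).
apply: esum_le_seq => s us.
apply: (@le_trans _ _ (c ^+ 2 * \sum_(x <- s) l2norm (T (delta x)) ^+ 2)).
  rewrite mulr_sumr; apply: ler_sum => x _; rewrite -exprMn.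
  by rewrite ler_pXn2r ?nnegrE ?l2norm_ge0// (le_trans _ (h x))// l2norm_ge0.
rewrite ler_wpM2l ?sqr_ge0// -lee_fin -hs_fine//.
by apply: (esum_ge_seq (fun x => sqr_ge0 (l2norm (T (delta x))))).
Qed.

Lemma hilbert_schmidtMl S T : hilbert_schmidt T -> hilbert_schmidt (S * T).
Proof.
by have [M M0 hM] := bop_bound S; apply: (@hs_le _ _ M) => x; exact: hM.
Qed.

Lemma hilbert_schmidtZ a T : hilbert_schmidt T -> hilbert_schmidt (a *: T).
Proof. by apply: (@hs_le _ _ (nrm a)) => x; rewrite bopZE l2normZ. Qed.

Lemma hilbert_schmidtD S T : hilbert_schmidt S -> hilbert_schmidt T ->
  hilbert_schmidt (S + T).
Proof.
move=> hS hT; apply: le_lt_trans (ltry (2 * fine (hs S) + 2 * fine (hs T))).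
apply: esum_le_seq => s us.
apply: (@le_trans _ _ (\sum_(x <- s) (2 * l2norm (S (delta x)) ^+ 2 + 2 * l2norm (T (delta x)) ^+ 2))).
  apply: ler_sum => x _.
  have h := le_l2normD (S (delta x)) (T (delta x)).
  have h2 : l2norm ((S + T) (delta x)) ^+ 2 <= (l2norm (S (delta x)) + l2norm (T (delta x))) ^+ 2.
    by rewrite ler_pXn2r ?nnegrE ?addr_ge0 ?l2norm_ge0.
  apply: le_trans h2 _.
  have := sqr_ge0 (l2norm (S (delta x)) - l2norm (T (delta x))).
  by rewrite sqrrB sqrrD; lra.
rewrite big_split /= -!mulr_sumr lerD// ler_wpM2l// -lee_fin -hs_fine//.
  by apply: (esum_ge_seq (fun x => sqr_ge0 (l2norm (S (delta x))))).
by apply: (esum_ge_seq (fun x => sqr_ge0 (l2norm (T (delta x))))).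
Qed.

(** By self-adjointness the coordinate of [T xi] at x is <xi, T delta_x>; Cauchy-Schwarz is then
    summed over x. *)
Lemma l2norm_le_hs T xi : adj T = T ->
  ((l2norm (T xi) ^+ 2)%:E <= (l2norm xi ^+ 2)%:E * hs T)%E.
Proof.
move=> aT; have [hT|] := boolP (hs T < +oo)%E; last first.
  rewrite -leNgt leye_eq => /eqP hT.
  have [x0|xn] := eqVneq (l2norm xi) 0.
    by rewrite (l2norm_eq0 x0) linear0 !l2norm0 expr0n /= mul0e.
  by rewrite hT gt0_muley ?leey// lte_fin exprn_gt0// lt_neqAle eq_sym xn l2norm_ge0.
rewrite hs_fine// -EFinM -sqsumE; apply: esum_le_seq => s us.
apply: (@le_trans _ _ (l2norm xi ^+ 2 * \sum_(x <- s) l2norm (T (delta x)) ^+ 2)).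
  rewrite mulr_sumr; apply: ler_sum => x _; rewrite -exprMn.
  rewrite ler_pXn2r ?nnegrE ?mulr_ge0 ?normc_ge0 ?l2norm_ge0//.
  by rewrite -dotp_delta adjP aT cauchy_schwarz.
rewrite ler_wpM2l ?sqr_ge0// -lee_fin -hs_fine//.
by apply: (esum_ge_seq (fun x => sqr_ge0 (l2norm (T (delta x))))).
Qed.

Lemma hs_orthogonalD S T : (forall x, dotp (S (delta x)) (T (delta x)) = 0) ->
  hs (S + T) = (hs S + hs T)%E.
Proof.
move=> h; rewrite -esumD; [|by move=> *; rewrite lee_fin sqr_ge0..].
by apply: eq_esum => x _; rewrite bopDE l2norm_sqrD h mulr0 addr0 EFinD.
Qed.

Lemma bop_neq0 T : T <> 0 -> exists xi, T xi <> 0.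
Proof.
move=> T0; apply: contrapT => h; apply: T0; apply: bop_ext => xi.
by apply: contrapT => h'; apply: h; exists xi.
Qed.

Lemma opnorm_exists T : T <> 0 -> exists m : R,
  [/\ 0 < m, forall xi, l2norm (T xi) <= m * l2norm xi &
   forall e, 0 < e -> exists xi, l2norm xi = 1 /\ m - e < l2norm (T xi)].
Proof.
move=> /bop_neq0[xi0 Txi0].
have [M M0 hM] := bop_bound T.
have unit (xi : ell2 R X) : xi <> 0 -> exists2 c : R, 0 < c & l2norm (c%:C%C *: xi) = 1 /\ l2norm xi = c^-1.
  move=> x0; have np : 0 < l2norm xi.
    by rewrite lt_neqAle l2norm_ge0 andbT eq_sym; apply/eqP => /l2norm_eq0.
  exists (l2norm xi)^-1; first by rewrite invr_gt0.
  rewrite invrK l2normZ /= expr0n addr0 sqrtr_sqr ger0_norm ?invr_ge0 ?ltW//.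
  by rewrite mulVf ?gt_eqF.
pose D := [set l2norm (T xi) | xi in [set xi | l2norm xi = 1]].
have Dub : has_ubound D.
  by exists M => _ [xi /= x1 <-]; rewrite (le_trans (hM _))// x1 mulr1.
have x0 : xi0 <> 0 by move=> x0; apply: Txi0; rewrite x0 linear0.
have normT (c : R) xi : 0 < c -> l2norm (T (c%:C%C *: xi)) = c * l2norm (T xi).
  by move=> c0; rewrite linearZ l2normZ /= expr0n addr0 sqrtr_sqr ger0_norm// ltW.
have D0 : has_sup D.
  split=> //; have [c c0 [h _]] := unit _ x0.
  by exists (l2norm (T (c%:C%C *: xi0))); exists (c%:C%C *: xi0).
have hsup xi : l2norm (T xi) <= sup D * l2norm xi.
  have [->|/eqP xn] := eqVneq xi 0; first by rewrite linear0 l2norm0 mulr0.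
  have [c c0 [h ->]] := unit _ xn.
  rewrite ler_pdivlMr// mulrC -normT//.
  by apply: ub_le_sup => //; exists (c%:C%C *: xi).
exists (sup D); split=> //.
- have h := hsup xi0.
  have Tp : 0 < l2norm (T xi0).
    by rewrite lt_neqAle l2norm_ge0 andbT eq_sym; apply/eqP => /l2norm_eq0.
  have np : 0 < l2norm xi0.
    by rewrite lt_neqAle l2norm_ge0 andbT eq_sym; apply/eqP => /l2norm_eq0.
  by rewrite -(pmulr_lgt0 _ np) (lt_le_trans Tp).
- move=> e e0; have [_ [xi x1 <-] h] := sup_adherent e0 D0.
  by exists xi.
Qed.

Lemma bernoulli_le (e : R) k : 0 <= e <= 1 -> 1 - k%:R * e <= (1 - e) ^+ k.
Proof.
move=> /andP[e0 e1]; elim: k => [|k IH]; first by rewrite mul0r subr0 expr0.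
rewrite exprS; apply: (@le_trans _ _ ((1 - e) * (1 - k%:R * e))); last first.
  by rewrite ler_wpM2l// subr_ge0.
rewrite -natr1; have : 0 <= k%:R * e * e by rewrite !mulr_ge0.
lra.
Qed.

(** * Top eigenvector of a norm-one self-adjoint operator by power iteration *)

Section TopEigenvector.
Variables (B : bop R X).
Hypothesis (Bsa : adj B = B) (B1 : forall xi, l2norm (B xi) <= l2norm xi).
Hypothesis Btop : forall e : R, 0 < e -> exists xi, l2norm xi = 1 /\ 1 - e < l2norm (B xi).
Hypothesis Bhs : hilbert_schmidt B.

Let b k xi := iter k B xi.

Lemma iter_dotp k l xi eta : dotp (b k xi) (b l eta) = dotp (b (k + l) xi) eta.
Proof.
elim: l k xi eta => [|l IH] k xi eta; first by rewrite addn0.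
by rewrite addnS -[b l.+1 eta]/(B (b l eta)) -adjPr Bsa -[B _]/(b k.+1 xi) IH addSn.
Qed.

Lemma iter_norm_le k l xi : (k <= l)%N -> l2norm (b l xi) <= l2norm (b k xi).
Proof.
move=> /subnKC <-; elim: (l - k)%N => [|m IH]; first by rewrite addn0.
by rewrite addnS; apply: le_trans IH; exact: B1.
Qed.

(** Self-adjointness moves one power across: |B^(k+1) xi|^2 = <B^(k+2) xi, B^k xi>. *)
Lemma iter_norm_logconvex k xi :
  l2norm (b k.+1 xi) ^+ 2 <= l2norm (b k xi) * l2norm (b k.+2 xi).
Proof.
have -> : l2norm (b k.+1 xi) ^+ 2 = nrm (dotp (b k.+1 xi) (b k.+1 xi)).
  by rewrite dotp_self /= expr0n addr0 sqrtr_sqr ger0_norm// sqr_ge0.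
rewrite iter_dotp addSnnS addnC -iter_dotp mulrC.
exact: cauchy_schwarz.
Qed.

(** By log-convexity the ratios of consecutive norms do not decrease, so each is at least the first
    one, |B xi|. Positivity is carried along to allow the division. *)
Lemma iter_norm_ge k xi : l2norm xi = 1 -> 0 < l2norm (B xi) ->
  l2norm (B xi) ^+ k <= l2norm (b k xi).
Proof.
move=> x1 Bp; set c := l2norm (B xi).
suff [//] : [/\ c ^+ k <= l2norm (b k xi), 0 < l2norm (b k xi) &
    c * l2norm (b k xi) <= l2norm (b k.+1 xi)].
elim: k => [|k [h1 h2 h3]].
  by rewrite expr0 /b /= x1; split=> //; rewrite mulr1.
have p : 0 < l2norm (b k.+1 xi) by apply: lt_le_trans h3; rewrite mulr_gt0.
split=> //.
  by rewrite exprS (le_trans _ h3)// ler_wpM2l// ltW.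
have := iter_norm_logconvex k xi => h.
rewrite -(ler_pM2l h2); apply: le_trans h; rewrite mulrA expr2 [_ * c]mulrC.
by rewrite ler_wpM2r// ltW.
Qed.

Lemma adj_exp k : adj (B ^+ k) = B ^+ k.
Proof.
elim: k => [|k IH]; first by rewrite expr0 adj_bop1.
by rewrite exprS adj_bopM IH Bsa -exprS -exprSr.
Qed.

Lemma iter_exp k xi : b k xi = (B ^+ k) xi.
Proof. by elim: k => [//|k IH]; rewrite /b iterS -/(b k xi) IH exprS. Qed.

(** [B] has norm one, so a unit vector with |B xi| > 1 - e gives |B^k xi|^2 >= (1 - e)^(2k) >= 1 - 2
    k e, and this is a lower bound for [hs (B ^+ k)]. *)
Lemma hs_exp_ge k : ((3 / 4)%:E <= hs (B ^+ k)%R)%E.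
Proof.
(* Makes 2 k e at most 1/4. *)
pose e : R := (8 * k.+1%:R)^-1.
have k1 : 1 <= k.+1%:R :> R by rewrite ler1n.
have e0 : 0 < e by rewrite invr_gt0 mulr_gt0.
have ke : k.+1%:R * e = 8^-1 by rewrite /e invfM mulrCA mulfV ?mulr1// gt_eqF.
have e1 : e <= 8^-1 by rewrite -ke ler_peMl// ltW.
have [xi [x1 hx]] := Btop e0.
have Bp : 0 < l2norm (B xi) by apply: lt_trans hx; lra.
have h := iter_norm_ge k x1 Bp.
have h2 : 1 - (2 * k)%:R * e <= l2norm (b k xi) ^+ 2.
  apply: (@le_trans _ _ ((1 - e) ^+ (k * 2))).
    by rewrite mulnC; apply: bernoulli_le; apply/andP; split; lra.
  rewrite exprM ler_pXn2r ?nnegrE ?l2norm_ge0 ?exprn_ge0//; last by lra.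
  apply: le_trans h; rewrite lerXn2r ?nnegrE ?l2norm_ge0 ?(ltW hx)//; lra.
have := l2norm_le_hs xi (adj_exp k); rewrite x1 expr1n mul1e -iter_exp.
apply: le_trans; rewrite lee_fin (le_trans _ h2)//.
have : k%:R * e <= 8^-1 by rewrite -ke ler_wpM2r ?(ltW e0)// ler_nat.
by rewrite natrM -mulrA; move: (k%:R * e) => q; lra.
Qed.

(** Norms decrease along the iteration, so adding the exponents found for each point serves all of
    [s]. The condition 0 < k lets [not_vanish] bound the remaining terms by those of [B] itself. *)
Lemma seq_vanish (s : seq X) :
  (forall x, x \in s -> forall c : R, 0 < c -> exists k, l2norm (b k (delta x)) < c) ->
  forall e : R, 0 < e -> exists k, (0 < k)%N /\ \sum_(x <- s) l2norm (b k (delta x)) ^+ 2 < e.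
Proof.
elim: s => [|x s IH] h e e0; first by exists 1%N; rewrite big_nil.
have [|k [k0 hk]] := IH _ _ (divr_gt0 e0 (ltr0Sn _ 1)).
  by move=> y ys; apply: h; rewrite inE ys orbT.
(* The bound 1 makes the square of the norm no larger than the norm, which is below e / 2. *)
pose c := Num.min 1 (e / 2).
have c0 : 0 < c by rewrite lt_min ltr01 divr_gt0.
have [l hl] := h x (mem_head _ _) c c0.
exists (k + l)%N; split; first by rewrite addn_gt0 k0.
rewrite big_cons [ltRHS](splitr e); apply: ltr_leD; last first.
  apply: le_trans (ltW hk); apply: ler_sum => y _.
  by rewrite ler_pXn2r ?nnegrE ?l2norm_ge0// iter_norm_le// leq_addr.
have h1 : l2norm (b (k + l) (delta x)) < c.
  by apply: le_lt_trans hl; apply: iter_norm_le; rewrite leq_addl.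
move: h1; rewrite lt_min => /andP[h1 h2]; apply: le_lt_trans h2.
by rewrite expr2 ler_piMr ?l2norm_ge0// ltW.
Qed.

(** Otherwise take a finite [s] carrying all of [hs B] but 1/4. For a suitable k the part of
    [hs (B ^+ k)] over [s] is below 1/4, and the part off [s] is dominated by the tail of [hs B].
    The total is at most 1/2, against the lower bound 3/4. *)
Lemma not_vanish : exists x, exists2 c : R, 0 < c & forall k, c <= l2norm (b k (delta x)).
Proof.
apply: contrapT => hc.
have h x (c : R) : 0 < c -> exists k, l2norm (b k (delta x)) < c.
  move=> c0; apply: contrapT => hk; apply: hc; exists x; exists c => // k.
  by rewrite leNgt; apply/negP => hlt; apply: hk; exists k.
have [s [us hs1]] : exists s : seq X, uniq s /\
    fine (hs B) - 4^-1 < \sum_(x <- s) l2norm (B (delta x)) ^+ 2.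
  apply: esum_approx_seq; rewrite -/(hs B) [ltRHS]hs_fine// lte_fin.
  by rewrite ltrBlDr ltrDl.
have e4 : (0 : R) < 4^-1 by [].
have [k [k0 hk]] := seq_vanish (fun x (_ : x \in s) => h x) e4.
have : (hs (B ^+ k)%R <= (4^-1 + 4^-1)%:E)%E.
  apply: esum_le_seq => t ut.
  under eq_bigr do rewrite -iter_exp.
  rewrite (bigID (mem s)) /=; apply: lerD.
    apply: le_trans (ltW hk); rewrite -big_filter.
    have sub : {subset [seq x <- t | x \in s] <= s}.
      by move=> x; rewrite mem_filter => /andP[].
    rewrite [leRHS](bigID (mem [seq x <- t | x \in s])) /= -[leRHS]addr0.
    rewrite -[X in X <= _]addr0 -addrA; apply: lerD; last first.
      by rewrite addr0 sumr_ge0// => x _; exact: sqr_ge0.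
    rewrite -[leRHS]big_filter le_eqVlt; apply/orP; left; apply/eqP.
    apply: perm_big; apply: uniq_perm; rewrite ?filter_uniq// => x.
    by rewrite !mem_filter; case: (x \in s); rewrite ?andbF ?andbT.
  rewrite -big_filter; set t' := [seq x <- t | x \notin s].
  have ust : uniq (s ++ t').
    rewrite cat_uniq us filter_uniq// andbT /=; apply/hasPn => x.
    by rewrite mem_filter => /andP[].
  have := esum_ge_seq (fun x => sqr_ge0 (l2norm (B (delta x)))) ust.
  rewrite -/(hs B) [leRHS]hs_fine// lee_fin big_cat /= => h2.
  have : \sum_(i <- t') l2norm (b k (delta i)) ^+ 2 <= \sum_(i <- t') l2norm (B (delta i)) ^+ 2.
    apply: ler_sum => x _; rewrite ler_pXn2r ?nnegrE ?l2norm_ge0//.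
    by rewrite -[B _]/(b 1 _) iter_norm_le.
  by move: h2 hs1; lra.
move=> /(le_trans (hs_exp_ge k)); rewrite lee_fin; lra.
Qed.

(** For a basis vector whose iterates stay away from 0, |u_k - u_l|^2 = g(2k) + g(2l) - 2 g(k + l)
    with [g] decreasing and bounded below, so [u] converges, and its limit is nonzero and fixed by
    B^2. *)
Lemma top_eigenvector : exists2 v : ell2 R X, v <> 0 & B (B v) = v.
Proof.
have [x [c c0 hc]] := not_vanish.
pose g k := l2norm (b k (delta x)) ^+ 2.
have gd k l : (k <= l)%N -> g l <= g k.
  by move=> kl; rewrite ler_pXn2r ?nnegrE ?l2norm_ge0//; exact: iter_norm_le.
(* Even powers only: -1 may be an eigenvalue of [B], and then the B^k need not converge. *)
pose u k := b (k + k) (delta x).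
have uE k l : l2norm (u k - u l) ^+ 2 = g (k + k)%N + g (l + l)%N - 2 * g (k + l)%N.
  rewrite l2norm_sqrB; congr (_ - 2 * _).
  have -> : dotp (u k) (u l) = dotp (b (k + l) (delta x)) (b (k + l) (delta x)).
    by rewrite /u (iter_dotp (k + k)) (iter_dotp (k + l)) addnACA.
  by rewrite dotp_self.
pose D := range g.
have D0 : has_inf D.
  by split; [exists (g 0%N); exists 0%N|exists 0 => _ [k _ <-]; exact: sqr_ge0].
have gi k : inf D <= g k by apply: ge_inf; [exact: (proj2 D0)|exists k].
have uC e : 0 < e -> exists N, forall m n, (N <= m)%N -> (N <= n)%N ->
    l2norm (u m - u n) <= e.
  move=> e0; have e2 : 0 < e ^+ 2 / 2 by rewrite divr_gt0// exprn_gt0.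
  have [_ [N _ <-] hN] := inf_adherent e2 D0; exists N => m n Nm Nn.
  rewrite -(@ler_pXn2r _ 2) ?nnegrE ?l2norm_ge0 ?(ltW e0)// uE.
  have h1 := gd N (m + m)%N (leq_trans Nm (leq_addr _ _)).
  have h2 := gd N (n + n)%N (leq_trans Nn (leq_addr _ _)).
  by have h3 := gi (m + n)%N; lra.
have [v hv] := ell2_complete uC; exists v.
  move=> v0; have [N hN] := hv _ (divr_gt0 c0 (ltr0Sn _ 1)).
  have := hN N (leqnn N); rewrite v0 subr0 => h.
  have : c <= c / 2 by apply: le_trans h; exact: hc.
  by move: c0; lra.
apply/eqP; rewrite -subr_eq0; apply/eqP; apply: l2norm_small => e e0.
have [N hN] := hv _ (divr_gt0 e0 (ltr0Sn _ 1)).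
apply: le_trans (le_l2normB _ (u N.+1) _) _; rewrite [leRHS](splitr e).
apply: lerD; last exact: hN (leqnSn N).
have -> : u N.+1 = B (B (u N)) by rewrite /u addSn addnS.
rewrite -!linearB; apply: le_trans (B1 _) _; apply: le_trans (B1 _) _.
by rewrite -l2normN opprB; exact: hN.
Qed.

End TopEigenvector.

(** Dividing by the operator norm m gives the normalized case, with a = m^2. The eigenvalue is that
    of A^2, which leaves the sign for A open. *)
Lemma selfadjoint_eigenvector A : adj A = A -> hilbert_schmidt A -> A <> 0 ->
  exists2 a : R, 0 < a & exists2 v, v <> 0 & A (A v) = a%:C%C *: v.
Proof.
move=> aA hA /opnorm_exists[m [m0 hm htop]].
pose B := (m^-1)%:C%C *: A.
have mE xi : l2norm (B xi) = m^-1 * l2norm (A xi).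
  by rewrite bopZE l2normZ /= expr0n addr0 sqrtr_sqr ger0_norm// invr_ge0 ltW.
have [] := @top_eigenvector B.
- by rewrite adj_bopZ aA conjc_realC.
- by move=> xi; rewrite mE mulrC ler_pdivrMr// mulrC.
- move=> e e0; have [xi [x1 hx]] := htop _ (mulr_gt0 m0 e0).
  exists xi; split=> //; rewrite mE -(ltr_pM2l m0) mulrA mulfV ?gt_eqF// mul1r.
  by rewrite mulrBr mulr1.
- exact: hilbert_schmidtZ.
move=> v v0 Bv; exists (m ^+ 2); first exact: exprn_gt0.
exists v => //; rewrite -[in RHS]Bv /B !bopZE bop_scale !scalerA -!realCM.
by rewrite (_ : _ * _ = 1) ?scale1r//; field; rewrite gt_eqF.
Qed.

End HilbertSchmidt.

(** * Common eigenvectors *)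

Section CommonEigenvector.
Context {R : realType} {X : choiceType}.
Implicit Types (S T A P Q K : bop R X).
Local Notation nrm := Normc.normc.

Lemma half_realC : (2 : R[i])^-1 = (2^-1)%:C%C.
Proof. by rewrite fmorphV rmorph_nat. Qed.

(** [Q] projects onto the kernel of A^2 - a, which is closed and is preserved by every operator
    commuting with [A]. *)
Lemma spectral_projection A : adj A = A -> hilbert_schmidt A -> A <> 0 ->
  exists a : R, exists Q, [/\ 0 < a, adj Q = Q, Q * Q = Q, Q <> 0 & hilbert_schmidt Q] /\
    A * A * Q = a%:C%C *: Q /\
    forall T, T * A = A * T -> adj T * A = A * adj T -> Q * T = T * Q.
Proof.
move=> aA hA A0.
have [a a0 [v v0 Av]] := selfadjoint_eigenvector aA hA A0.
pose S : bop R X := A * A - (a%:C%C *: (1 : bop R X)).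
have SE xi : S xi = A (A xi) - a%:C%C *: xi by [].
pose V : set (ell2 R X) := [set xi | S xi = 0].
have sV : is_subspace V.
  split; first by rewrite /V /mkset linear0.
  move=> c x y Vx Vy; have Sx : S x = 0 := Vx; have Sy : S y = 0 := Vy.
  by rewrite /V /mkset (bop_linear S) Sx Sy scaler0 addr0.
have clV y : l2closure V y -> V y.
  move=> Vy; rewrite /V /mkset.
  have [M M0 hM] := bop_bound S; apply: l2norm_small => e e0.
  have M1 : 0 < M + 1 by rewrite ltr_wpDl.
  have [w Vw yw] := Vy _ (divr_gt0 e0 M1).
  have Sw : S w = 0 := Vw.
  rewrite -[S y]subr0 -Sw -linearB (le_trans (hM _))//.
  apply: (@le_trans _ _ ((M + 1) * (e / (M + 1)))).
    by apply: ler_pM; rewrite ?l2norm_ge0// lerDl.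
  by rewrite mulrC divfK// gt_eqF.
pose Q := projb sV.
have AAQ : A * A * Q = a%:C%C *: Q.
  apply: bop_ext => xi; apply/eqP; rewrite -subr_eq0; apply/eqP.
  by have := clV _ (projb_closure sV xi).
have Qcomm T : T * A = A * T -> adj T * A = A * adj T -> Q * T = T * Q.
  have main U : U * A = A * U -> forall w, V w -> V (U w).
    move=> UA w Vw; have Sw : S w = 0 := Vw.
    have AU x : A (U x) = U (A x) by rewrite -!bopE UA.
    by rewrite /V /mkset SE !AU -bop_scale -linearB -SE Sw linear0.
  by move=> h1 h2; apply: projb_comm => w; apply: main.
exists a, Q; split; split=> //.
- exact: adj_projb.
- exact: projb_idem.
- move=> Q0; apply: v0; have Vv : V v by rewrite /V /mkset SE Av subrr.
  by rewrite -(projb_id sV (sub_l2closure Vv)) -/Q Q0.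
- have QA : Q * A = A * Q by apply: Qcomm; rewrite ?aA.
  (* On the range of [Q] the operator A^2 is the invertible scalar a, so [Q] factors through the
     Hilbert-Schmidt operator [A]. *)
  have -> : Q = (a^-1)%:C%C *: (Q * A * A).
    rewrite QA -mulrA QA mulrA AAQ scalerA -realCM mulVf ?gt_eqF//.
    by rewrite scale1r.
  by apply: hilbert_schmidtZ; apply: hilbert_schmidtMl.
Qed.

Variable KK : set (bop R X).
Hypothesis KK_adj : forall K, KK K -> KK (adj K).
Hypothesis KK_comm : forall K L, KK K -> KK L -> K * L = L * K.
Hypothesis KK_hs : forall K, KK K -> hilbert_schmidt K.

Definition good_projection P : Prop :=
  [/\ adj P = P, P * P = P, P <> 0, hilbert_schmidt P &
      forall K, KK K -> P * K = K * P].

(** [l2norm_le_hs] at a nonzero vector fixed by [P]. *)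
Lemma hs_projection_ge1 P : good_projection P -> (1 <= hs P)%E.
Proof.
move=> [aP PP P0 hP _].
have [xi Pxi] := bop_neq0 P0.
have := l2norm_le_hs (P xi) aP; rewrite -bopE PP.
have n0 : 0 < l2norm (P xi) ^+ 2.
  by rewrite exprn_gt0// lt_neqAle l2norm_ge0 andbT eq_sym; apply/eqP => /l2norm_eq0.
by rewrite hs_fine// -EFinM !lee_fin ler_pMr.
Qed.

Definition minimal_projection P : Prop :=
  good_projection P /\ forall Q, good_projection Q -> P * Q = Q -> Q = P.

(** If [Q] is a proper good subprojection, then P - Q is good too, and hs P = hs (P - Q) + hs Q with
    hs (P - Q) >= 1. So [hs] drops by at least 1, and the induction is on an integer bound for
    it. *)
Lemma minimal_projection_exists P : good_projection P ->
  exists P', minimal_projection P'.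
Proof.
move=> gP; have [_ _ _ hP _] := gP.
have [n hn] : exists n : nat, (hs P <= n%:R%:E)%E.
  exists (Num.truncn (fine (hs P))).+1; rewrite hs_fine// lee_fin ltW//.
  exact: truncnS_gt.
elim: n => [|n IH] in P gP hP hn *.
  by have := le_trans (hs_projection_ge1 gP) hn; rewrite lee_fin ler10.
have [mP|nmP] := pselect (minimal_projection P); first by exists P.
have [Q [gQ PQ QP]] : exists Q, [/\ good_projection Q, P * Q = Q & Q <> P].
  apply: contrapT => h; apply: nmP; split=> // Q gQ PQ.
  by apply: contrapT => QP; apply: h; exists Q.
have [aQ QQ Q0 hQ cQ] := gQ; have [aP PP P0 _ cP] := gP.
have QP' : Q * P = Q by rewrite -aP -{1}aQ -adj_bopM PQ.
have gD : good_projection (P - Q).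
  split.
  - by rewrite adj_bopB aP aQ.
  - by rewrite mulrBl !mulrBr PP PQ QP' QQ subrr subr0.
  - by move=> /eqP; rewrite subr_eq0 => /eqP PQe; apply: QP.
  - by rewrite -scaleN1r; apply: hilbert_schmidtD => //; apply: hilbert_schmidtZ.
  - by move=> K hK; rewrite mulrBl mulrBr cP// cQ.
apply: (IH Q) => //.
have : hs P = (hs (P - Q)%R + hs Q)%E.
  rewrite -hs_orthogonalD ?subrK// => x.
  by rewrite -adjPr aQ -bopE mulrBr QQ QP' subrr bop0E dotp0l.
have h1 := hs_projection_ge1 gD; have [_ _ _ hD _] := gD.
move: hn h1; rewrite (hs_fine hP) (hs_fine hQ) (hs_fine hD) -EFinD !lee_fin -natr1.
by move=> h1 h2 [] h3; move: h1 h2; rewrite h3; lra.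
Qed.

(** Minimality is used twice. The spectral projection of [A] must be [P], so A^2 = a P and U = A /
    sqrt a is a symmetry of the range of [P]; then the projection (P + U) / 2 must be 0 or [P], so U
    is -P or P. *)
Lemma minimal_projection_scalar P A : minimal_projection P -> adj A = A ->
  hilbert_schmidt A -> P * A = A -> (forall K, KK K -> A * K = K * A) ->
  exists c : R, A = c%:C%C *: P.
Proof.
move=> [gP mP] aA hA PA cA; have [aP PP P0 hP cP] := gP.
have AP : A * P = A by rewrite -aP -{1}aA -adj_bopM PA.
have [A0|/eqP A0] := eqVneq A 0; first by exists 0; rewrite scale0r.
have [a [Q [[a0 aQ QQ Q0 hQ] [AAQ cQ]]]] := spectral_projection aA hA A0.
(* [Q] lies under [P] because Q = a^-1 A A Q and P A = A. *)
have QP : Q = P.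
  apply: mP.
    split=> // K hK; apply: cQ; first by rewrite cA.
    by rewrite cA//; exact: KK_adj.
  have an0 : a%:C%C != 0 :> R[i] by rewrite -[0]/(0%:C%C) (inj_eq (@complexI R)) gt_eqF.
  by rewrite -[Q]scale1r -[1](mulVf an0) -scalerA -AAQ bopZr !mulrA PA.
have AA : A * A = a%:C%C *: P by rewrite -QP -AAQ QP -mulrA AP.
pose r := Num.sqrt a.
have r0 : 0 < r by rewrite sqrtr_gt0.
have rr : r * r = a by rewrite -expr2 sqr_sqrtr// ltW.
pose U := (r^-1)%:C%C *: A.
have AU : A = r%:C%C *: U.
  by rewrite scalerA -realCM mulfV ?gt_eqF// scale1r.
have UU : U * U = P.
  rewrite bopZl bopZr AA !scalerA -!realCM -rr.
  by rewrite (_ : r^-1 * r^-1 * (r * r) = 1) ?scale1r//; field; rewrite gt_eqF.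
have PU : P * U = U by rewrite bopZr PA.
have UP : U * P = U by rewrite bopZl AP.
pose E := 2^-1 *: (P + U).
have E2 : P + U = 2 *: E by rewrite scalerA mulfV ?pnatr_eq0// scale1r.
have aE : adj E = E.
  by rewrite /E /U adj_bopZ adj_bopD adj_bopZ aP aA half_realC !conjc_realC.
have EE : E * E = E.
  rewrite {1 2}/E bopZl bopZr mulrDl !mulrDr PP PU UP UU [U + P]addrC E2.
  by rewrite -scalerDl !scalerA; congr (_ *: _); field.
have [E0|/eqP E0] := eqVneq E 0.
  exists (- r); move: E2; rewrite E0 scaler0 => /eqP; rewrite addr_eq0 => /eqP ->.
  rewrite (_ : (- r)%:C%C = - r%:C%C :> R[i]); last exact: (rmorphN (real_complex R)).
  by rewrite scalerN scaleNr opprK.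
have gE : good_projection E.
  split=> //.
  - by apply: hilbert_schmidtZ; apply: hilbert_schmidtD => //; apply: hilbert_schmidtZ.
  - move=> K hK; rewrite /E bopZl bopZr; congr (_ *: _).
    by rewrite mulrDl mulrDr bopZl bopZr cP// cA.
have EP : E = P.
  by apply: mP => //; rewrite /E bopZr mulrDr PP PU.
exists r; rewrite AU; congr (_ *: _); move: E2; rewrite EP scaler_nat mulr2n.
by move=> /addrI.
Qed.

Lemma minimal_projection_eigen P K : minimal_projection P -> KK K ->
  exists k : R[i], K * P = k *: P.
Proof.
move=> mP hK; have [[aP PP _ _ cP] _] := mP.
have hK' := KK_adj hK.
have cKK' := KK_comm hK hK'.
have aux a : exists c : R, (a *: K + conjc a *: adj K) * P = c%:C%C *: P.
  set A := (a *: K + conjc a *: adj K).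
  have cA L : KK L -> A * L = L * A.
    by move=> hL; rewrite mulrDl mulrDr !bopZl !bopZr (KK_comm hK hL) (KK_comm hK' hL).
  have PA : P * A = A * P by rewrite mulrDl mulrDr !bopZl !bopZr (cP K)// (cP (adj K)).
  apply: (minimal_projection_scalar mP).
  - by rewrite adj_bopM aP adj_bopD !adj_bopZ adj_bopK conjcK addrC PA.
  - rewrite -PA; apply: hilbert_schmidtMl.
    by apply: hilbert_schmidtD; apply: hilbert_schmidtZ; exact: KK_hs.
  - by rewrite mulrA PA -mulrA PP.
  - by move=> L hL; rewrite -mulrA cP// !mulrA cA.
(* The scalars 1/2 and -i/2 produce the real and imaginary parts of [K], which are recombined as Re
   K + i Im K. *)
have [c hc] := aux 2^-1; have [d hd] := aux (Complex 0 (- 2^-1)).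
exists (c%:C%C + Complex 0 1 * d%:C%C).
rewrite scalerDl -scalerA -hc -hd -bopZl -mulrDl; congr (_ * _).
rewrite scalerDr !scalerA addrACA -!scalerDl.
rewrite half_realC conjc_realC.
rewrite (_ : _ + _ * _ = 1); last first.
  by apply/eqP; rewrite eq_complex /=; apply/andP; split; apply/eqP; field.
rewrite (_ : _ + _ * _ = 0) ?scale0r ?addr0 ?scale1r//.
by apply/eqP; rewrite eq_complex /=; apply/andP; split; apply/eqP; field.
Qed.

(** A nonzero self-adjoint operator built from [K] supplies a first good projection. Below it there
    is a minimal one, and any nonzero vector in the range of that one is a common eigenvector. *)
Lemma hs_common_eigenvector : (exists2 K, KK K & K <> 0) ->
  exists2 v : ell2 R X, v <> 0 & forall K, KK K -> exists k : R[i], K v = k *: v.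
Proof.
move=> [K hK K0]; have hK' := KK_adj hK.
have [A [A0 aA hA cA]] : exists A, [/\ A <> 0, adj A = A, hilbert_schmidt A &
    forall L, KK L -> L * A = A * L].
  have mk a : [/\ adj (a *: K + conjc a *: adj K) = a *: K + conjc a *: adj K,
      hilbert_schmidt (a *: K + conjc a *: adj K) &
      forall L, KK L -> L * (a *: K + conjc a *: adj K) = (a *: K + conjc a *: adj K) * L].
    split.
    - by rewrite adj_bopD !adj_bopZ adj_bopK conjcK addrC.
    - by apply: hilbert_schmidtD; apply: hilbert_schmidtZ; exact: KK_hs.
    - move=> L hL; rewrite mulrDl mulrDr !bopZl !bopZr.
      by rewrite (KK_comm hL hK) (KK_comm hL hK').
  (* If K + K^* vanishes, then i K - i K^* = 2 i K does not. *)
  have [h0|/eqP h0] := eqVneq (1 *: K + conjc 1 *: adj K) 0; last first.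
    by have [] := mk 1; exists (1 *: K + conjc 1 *: adj K).
  exists (Complex 0 1 *: K + conjc (Complex 0 1) *: adj K).
  have [] := mk (Complex 0 1); split=> //.
  move: h0; rewrite conjc1 !scale1r => /eqP; rewrite addr_eq0 => /eqP h0.
  have -> : adj K = - K by rewrite [in RHS]h0 opprK.
  rewrite scalerN -scaleNr -scalerDl; apply/eqP; rewrite scaler_eq0 negb_or.
  rewrite eq_complex negb_and /=; apply/andP; split; last exact/eqP.
  by apply/orP; right; rewrite opprK -[1 + 1]/(2%:R) pnatr_eq0.
have [a [Q [[a0 aQ QQ Q0 hQ] [_ cQ]]]] := spectral_projection aA hA A0.
have gQ : good_projection Q.
  by split=> // L hL; apply: cQ; rewrite cA//; exact: KK_adj.
have [P mP] := minimal_projection_exists gQ.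
have [[_ PP P0 _ _] _] := mP; have [xi Pxi] := bop_neq0 P0.
exists (P xi) => // L hL; have [k hk] := minimal_projection_eigen mP hL.
by exists k; rewrite -bopE hk.
Qed.

End CommonEigenvector.

(** * Leg notation *)

Section Legs.
Context {R : realType}.
Implicit Types (X Y Z I : choiceType).

Definition perm_op X (e : X -> X) (einj : injective e) : bop R X :=
  Bop (pullback_bop R einj).

Lemma perm_opE X (e : X -> X) (einj : injective e) xi x :
  perm_op einj xi x = xi (e x).
Proof. by []. Qed.

Lemma perm_op_inv X (e e' : X -> X) (einj : injective e) (e'inj : injective e') :
  cancel e' e -> perm_op e'inj * perm_op einj = 1.
Proof. by move=> eK; apply: bop_ext => xi; apply: ell2_ext => x; rewrite -[LHS]/(xi (e (e' x))) eK. Qed.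

Lemma adj_perm_op X (e e' : X -> X) (einj : injective e) (e'inj : injective e') :
  cancel e e' -> cancel e' e -> adj (perm_op einj) = perm_op e'inj.
Proof.
by move=> eK e'K; apply: adj_unique => x y; exact: dotp_pullback.
Qed.

(** Matrix coefficients of both sides fall under [normal_agree]. The bijection [e] absorbs the
    regrouping of legs in the target of id (x) Delta; elsewhere it is the identity. *)
Lemma normal_conj X Y I (S : set (bop R X)) (phi : bop R X -> bop R Y)
    (e : X * I -> Y) (e' : Y -> X * I) (eK : cancel e e') (e'K : cancel e' e)
    (U : bop R (X * I)%type) :
  star_submonoid S -> normal_on (bicommutant S) phi ->
  (forall a x y, bicommutant S x -> bicommutant S y ->
     phi (a *: x + y) = a *: phi x + phi y) ->
  (forall s, S s -> conj_bop eK e'K (phi s) = U * amp I s * adj U) ->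
  forall x, bicommutant S x -> conj_bop eK e'K (phi x) = U * amp I x * adj U.
Proof.
move=> sS nphi lphi agr x Sx; apply: bop_ext_dotp => xi eta.
have E T : dotp (conj_bop eK e'K T xi) eta =
    dotp (T (pullback (can_inj e'K) xi)) (pullback (can_inj e'K) eta).
  by rewrite conj_bopE (dotp_pullback _ (can_inj e'K)).
have E' T : dotp ((U * amp I T * adj U) xi) eta =
    dotp (amp I T (adj U xi)) (adj U eta).
  by rewrite !bopE -adjP.
rewrite E E'; apply: (normal_agree sS nphi lphi) => // s Ss.
by rewrite -E -E' agr.
Qed.

Lemma bop_eq_tensv3 X Y Z (S T : bop R (X * Y * Z)%type) :
  (forall a b c, S (tensv (tensv a b) c) = T (tensv (tensv a b) c)) -> S = T.
Proof. by move=> h; apply: bop_eq_delta => -[[x y] z]; rewrite !delta_tensv. Qed.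

Section ThreeLegs.
Variable X : choiceType.
Implicit Types (S T : bop R (X * X)%type) (x : bop R X).

Definition swap23 (p : X * X * X) : X * X * X := (p.1.1, p.2, p.1.2).
Lemma swap23K : involutive swap23. Proof. by case=> -[]. Qed.

Definition Sigma : bop R (X * X * X)%type := perm_op (can_inj swap23K).
Definition L12 T : bop R (X * X * X)%type := amp X T.
Definition L13 T : bop R (X * X * X)%type := Sigma * L12 T * Sigma.
Definition L23 T : bop R (X * X * X)%type := assoc (ampr X T).
Definition leg1 x : bop R (X * X * X)%type := L12 (amp X x).
Definition leg2 x : bop R (X * X * X)%type := L12 (ampr X x).
Definition leg3 x : bop R (X * X * X)%type := ampr (X * X)%type x.

Lemma SigmaK : Sigma * Sigma = 1.
Proof. by apply: perm_op_inv; exact: swap23K. Qed.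

Lemma Sigma_tensv a b c : Sigma (tensv (tensv a b) c) = tensv (tensv a c) b.
Proof. by apply: ell2_ext => -[[x y] z]; rewrite /= mulrAC. Qed.

Lemma L12M S T : L12 (S * T) = L12 S * L12 T. Proof. exact: ampM. Qed.
Lemma L12_1 : L12 1 = 1. Proof. exact: amp1. Qed.
Lemma L13M S T : L13 (S * T) = L13 S * L13 T.
Proof. by rewrite /L13 L12M !mulrA -[Sigma * _ * Sigma * Sigma]mulrA SigmaK mulr1. Qed.
Lemma L13_1 : L13 1 = 1. Proof. by rewrite /L13 L12_1 mulr1 SigmaK. Qed.
Lemma amprM (Y : choiceType) S T : ampr Y (S * T) = ampr Y S * ampr Y T.
Proof. by rewrite /ampr ampM conj_bopM. Qed.
Lemma L23M S T : L23 (S * T) = L23 S * L23 T.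
Proof. by rewrite /L23 amprM /assoc conj_bopM. Qed.
Lemma L23_1 : L23 1 = 1.
Proof. by rewrite /L23 /ampr amp1 conj_bop1 /assoc conj_bop1. Qed.
Lemma L12Z a T : L12 (a *: T) = a *: L12 T.
Proof. exact: ampZ. Qed.
Lemma L13Z a T : L13 (a *: T) = a *: L13 T.
Proof. by rewrite /L13 L12Z bopZr bopZl. Qed.
Lemma L23Z a T : L23 (a *: T) = a *: L23 T.
Proof. by rewrite /L23 /ampr ampZ conj_bopZ /assoc conj_bopZ. Qed.

Lemma L12_tensv T a b c : L12 T (tensv (tensv a b) c) = tensv (T (tensv a b)) c.
Proof. exact: amp_tensv. Qed.

Lemma tensv_assoc (a b c : ell2 R X) :
  pullback (can_inj (@reassocrK X X X)) (tensv a (tensv b c)) = tensv (tensv a b) c.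
Proof. by apply: ell2_ext => -[[x y] z]; rewrite /= mulrA. Qed.

Lemma tensv_assocV (a b c : ell2 R X) :
  pullback (can_inj (@reassoclK X X X)) (tensv (tensv a b) c) = tensv a (tensv b c).
Proof. by apply: ell2_ext => -[x [y z]]; rewrite /= mulrA. Qed.

Lemma L23_tensv T a b c : L23 T (tensv (tensv a b) c) =
  pullback (can_inj (@reassocrK X X X)) (tensv a (T (tensv b c))).
Proof. by rewrite /L23 /assoc conj_bopE tensv_assocV ampr_tensv. Qed.

Lemma leg1_tensv x a b c : leg1 x (tensv (tensv a b) c) = tensv (tensv (x a) b) c.
Proof. by rewrite L12_tensv amp_tensv. Qed.
Lemma leg2_tensv x a b c : leg2 x (tensv (tensv a b) c) = tensv (tensv a (x b)) c.
Proof. by rewrite L12_tensv ampr_tensv. Qed.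
Lemma leg3_tensv x a b c : leg3 x (tensv (tensv a b) c) = tensv (tensv a b) (x c).
Proof. by rewrite /leg3 ampr_tensv. Qed.

Lemma L13_amp x : L13 (amp X x) = leg1 x.
Proof.
apply: bop_eq_tensv3 => a b c.
by rewrite /L13 !bopE !(Sigma_tensv, leg1_tensv).
Qed.

Lemma L13_ampr x : L13 (ampr X x) = leg3 x.
Proof.
apply: bop_eq_tensv3 => a b c.
by rewrite /L13 !bopE !(Sigma_tensv, leg2_tensv, leg3_tensv).
Qed.

Lemma L23_amp x : L23 (amp X x) = leg2 x.
Proof.
by apply: bop_eq_tensv3 => a b c; rewrite L23_tensv amp_tensv tensv_assoc leg2_tensv.
Qed.

Lemma L23_ampr x : L23 (ampr X x) = leg3 x.
Proof.
by apply: bop_eq_tensv3 => a b c; rewrite L23_tensv ampr_tensv tensv_assoc leg3_tensv.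
Qed.

Lemma L12_leg3 T x : L12 T * leg3 x = leg3 x * L12 T.
Proof. exact: amp_ampr. Qed.

Lemma assoc_amp x : assoc (amp (X * X)%type x) = leg1 x.
Proof.
apply: bop_eq_tensv3 => a b c.
by rewrite /assoc conj_bopE tensv_assocV amp_tensv tensv_assoc leg1_tensv.
Qed.

Lemma L23_leg1 T x : L23 T * leg1 x = leg1 x * L23 T.
Proof. by rewrite -assoc_amp /L23 /assoc -!conj_bopM amp_ampr. Qed.

Lemma Sigma_L23 T : Sigma * L23 T * Sigma = L23 (flip T).
Proof.
apply: bop_eq_tensv3 => a b c; rewrite !bopE Sigma_tensv !L23_tensv.
by rewrite /flip conj_bopE swap_tensv; apply: ell2_ext => -[[x y] z].
Qed.

Lemma slice_L12 T xi k : slice (L12 T xi) k = T (slice xi k).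
Proof. exact: slice_amp. Qed.

Lemma slice2_L12_L13 S T a j j' i i' :
  slice (slice (L12 S (L13 T (tensv (tensv a (delta j)) (delta j')))) i') i =
  corner S i j (corner T i' j' a).
Proof.
rewrite slice_L12 cornerE; congr (slice (S _) _).
by rewrite /L13 !bopE Sigma_tensv L12_tensv; apply: ell2_ext => -[x y].
Qed.

Lemma slice2_Sigma xi i i' : slice (slice (Sigma xi) i') i = slice (slice xi i) i'.
Proof. exact: ell2_ext. Qed.

Lemma L13_L12 S T : L13 T * L12 S = Sigma * (L12 T * L13 S) * Sigma.
Proof. by rewrite /L13 !mulrA -[RHS]mulrA SigmaK mulr1. Qed.

Lemma slice2_L13_L12 S T a j j' i i' :
  slice (slice (L13 T (L12 S (tensv (tensv a (delta j)) (delta j')))) i') i =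
  corner T i' j' (corner S i j a).
Proof.
by rewrite -(bopE (L13 T)) L13_L12 !bopE slice2_Sigma Sigma_tensv slice2_L12_L13.
Qed.

(** Matrix coefficients in legs two and three turn S_12 T_13 and T_13 S_12 into the products, in the
    two orders, of a corner of [S] and a corner of [T]. *)
Lemma corner_comm S T (c : R[i]) : L13 T * L12 S = c *: (L12 S * L13 T) ->
  forall i j i' j', corner T i' j' * corner S i j = c *: (corner S i j * corner T i' j').
Proof.
move=> h i j i' j'; apply: bop_ext => a.
rewrite !(bopE, bopZE) -slice2_L13_L12 -slice2_L12_L13 -bopE h.
exact: ell2_ext.
Qed.

End ThreeLegs.
End Legs.

(** * The group von Neumann algebra *)

Section Group.
Context {R : realType} {G : groupType}.
Implicit Types (x y w : bop R G) (T : bop R (G * G)%type).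
Local Notation LG := (group_vN R G).

Definition mmap (p : G * G) : G * G := (p.1, (p.1^-1 * p.2)%g).
Definition mmapV (p : G * G) : G * G := (p.1, (p.1 * p.2)%g).
Lemma mmapK : cancel mmap mmapV. Proof. by case=> a b; rewrite /mmapV /= mulVKg. Qed.
Lemma mmapVK : cancel mmapV mmap. Proof. by case=> a b; rewrite /mmap /= mulKg. Qed.

(* delta_s (x) delta_t |-> delta_s (x) delta_(st) *)
Definition W : bop R (G * G)%type := perm_op (can_inj mmapK).
Definition Wi : bop R (G * G)%type := perm_op (can_inj mmapVK).

Lemma WK : W * Wi = 1. Proof. by apply: perm_op_inv; exact: mmapK. Qed.
Lemma WiK : Wi * W = 1. Proof. by apply: perm_op_inv; exact: mmapVK. Qed.
Lemma adjW : adj W = Wi. Proof. by apply: adj_perm_op; [exact: mmapK|exact: mmapVK]. Qed.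

Lemma lregE s (xi : ell2 R G) t : lreg R s xi t = xi (s^-1 * t)%g. Proof. by []. Qed.

Lemma lreg1 : lreg R (1%g : G) = 1.
Proof. by apply: bop_ext => xi; apply: ell2_ext => t; rewrite lregE invg1 mul1g. Qed.

Lemma lregM (s t : G) : lreg R s * lreg R t = lreg R (s * t)%g.
Proof. by apply: bop_ext => xi; apply: ell2_ext => a; rewrite bopE !lregE invgM mulgA. Qed.

Lemma adj_lreg (s : G) : adj (lreg R s) = lreg R s^-1%g.
Proof.
apply: adj_unique => xi eta; apply: dotp_pullback => t; first by rewrite invgK mulVKg.
by rewrite invgK mulKg.
Qed.

Lemma star_submonoid_lreg : star_submonoid (range (@lreg R G)).
Proof.
split; first by exists 1%g => //; exact: lreg1.
- by move=> _ _ [s _ <-] [t _ <-]; exists (s * t)%g => //; rewrite lregM.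
- by move=> _ [s _ <-]; exists (s^-1)%g => //; rewrite adj_lreg.
Qed.

Lemma group_vN_adj x : LG x -> LG (adj x).
Proof. by apply: bicommutant_adj; have [] := star_submonoid_lreg. Qed.

Lemma star_submonoid_tens (M : set (bop R G)) : star_submonoid M ->
  star_submonoid [set tens x y | x in M & y in M].
Proof.
move=> [M1 MM Madj]; split.
- by exists 1 => //; exists 1 => //; exact: tens11.
- move=> _ _ [x Mx [y My <-]] [x' Mx' [y' My' <-]].
  by exists (x * x'); [exact: MM|exists (y * y'); [exact: MM|rewrite tensM]].
- move=> _ [x Mx [y My <-]]; exists (adj x); first exact: Madj.
  by exists (adj y); [exact: Madj|rewrite adj_tens].
Qed.

Lemma star_submonoid_vN : star_submonoid LG.
Proof.
split; first exact: commutant1.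
- by move=> x y; exact: commutantM.
- exact: group_vN_adj.
Qed.

Definition id_eK : cancel (@id (G * G)) id := fun=> erefl.

Lemma conj_bop_id (T : bop R (G * G)%type) : conj_bop id_eK id_eK T = T.
Proof.
apply: bop_ext => xi; rewrite conj_bopE (_ : pullback _ xi = xi); last exact: ell2_ext.
exact: ell2_ext.
Qed.

Lemma tens_lreg (s : G) : tens (lreg R s) (lreg R s) = W * amp G (lreg R s) * Wi.
Proof.
rewrite tensE; apply: bop_ext => xi; apply: ell2_ext => -[a b].
rewrite -[LHS]/(xi ((s^-1 * a)%g, (s^-1 * b)%g)).
rewrite -[RHS]/(xi ((s^-1 * a)%g, ((s^-1 * a) * (a^-1 * b))%g)).
by congr (xi (_, _)); rewrite mulgA mulgK.
Qed.

Lemma comultiplicationE (Delta : bop R G -> bop R (G * G)%type) :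
  comultiplication Delta -> forall x, LG x -> Delta x = W * amp G x * Wi.
Proof.
move=> [[[_ lD _ _] _ nD] De] x Lx.
have := @normal_conj R G _ G (range (@lreg R G)) Delta _ _ id_eK id_eK W
  star_submonoid_lreg nD lD.
rewrite adjW => /(_ _ x Lx); rewrite conj_bop_id; apply.
by move=> _ [s _ <-]; rewrite conj_bop_id De tens_lreg.
Qed.

Local Notation W12 := (L12 W).
Local Notation Wi12 := (L12 Wi).
Local Notation W23 := (L23 W).
Local Notation Wi23 := (L23 Wi).

Lemma adj_L12 T : adj (L12 T) = L12 (adj T). Proof. exact: adj_amp. Qed.

Lemma adj_L23 T : adj (L23 T) = L23 (adj T).
Proof. by rewrite /L23 /assoc adj_conj_bop /ampr adj_conj_bop adj_amp. Qed.

Lemma adj_Sigma : adj (Sigma G) = Sigma G :> bop R (G * G * G)%type.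
Proof. by apply: adj_perm_op; exact: swap23K. Qed.

(** Since T_13 is [amp G T] conjugated by [Sigma], the operator W_12 Sigma implements Delta (x) id.
    On an elementary tensor the third leg slides past W_12. *)
Lemma Delta_idE (Delta : bop R G -> bop R (G * G)%type)
    (Delta_id : bop R (G * G)%type -> bop R (G * G * G)%type) :
  (forall x, LG x -> Delta x = W * amp G x * Wi) ->
  tensor_hom LG LG (LG \vox LG) LG Delta idfun Delta_id ->
  forall T, (LG \vox LG) T -> Delta_id T = W12 * L13 T * Wi12.
Proof.
move=> DE [[[_ lD _ _] _ nD] De] T LT.
have eK : cancel (@id (G * G * G)) id by [].
have cid (U : bop R (G * G * G)%type) : conj_bop eK eK U = U.
  apply: bop_ext => xi; rewrite conj_bopE (_ : pullback _ xi = xi); last exact: ell2_ext.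
  exact: ell2_ext.
have := @normal_conj R (G * G)%type _ G [set tens x y | x in LG & y in LG] Delta_id _ _ eK eK
  (W12 * Sigma G) (star_submonoid_tens star_submonoid_vN) nD lD.
rewrite adj_bopM adj_L12 adjW adj_Sigma => /(_ _ T LT); rewrite cid /L13 !mulrA.
apply.
move=> _ [x Lx [y Ly <-]]; rewrite cid De// DE//.
have -> : W12 * Sigma G * amp G (tens x y) * (Sigma G * Wi12) =
    W12 * L13 (tens x y) * Wi12 by rewrite /L13 !mulrA.
rewrite !tensE L13M L13_amp L13_ampr -/(L12 _) -/(leg3 y) !L12M -!mulrA.
by rewrite L12_leg3.
Qed.

(** Here the bijection in [normal_conj] is the regrouping of legs. On an elementary tensor W_23
    commutes with the first leg. *)
Lemma id_DeltaE (Delta : bop R G -> bop R (G * G)%type)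
    (id_Delta : bop R (G * G)%type -> bop R (G * (G * G))%type) :
  (forall x, LG x -> Delta x = W * amp G x * Wi) ->
  tensor_hom LG LG LG (LG \vox LG) idfun Delta id_Delta ->
  forall T, (LG \vox LG) T -> assoc (id_Delta T) = W23 * L12 T * Wi23.
Proof.
move=> DE [[[_ lD _ _] _ nD] De] T LT.
have := @normal_conj R (G * G)%type _ G [set tens x y | x in LG & y in LG] id_Delta _ _
  (@reassocrK G G G) (@reassoclK G G G) W23 (star_submonoid_tens star_submonoid_vN) nD lD.
rewrite adj_L23 adjW => /(_ _ T LT); apply.
move=> _ [x Lx [y Ly <-]]; rewrite De// DE// !tensE -/(assoc _) -/(L12 _) L12M.
rewrite /assoc conj_bopM -!/(assoc _) assoc_amp -/(L23 _) !L23M L23_amp.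
by rewrite !mulrA L23_leg1.
Qed.

Lemma pentagon : W12 * L13 W = W23 * W12 * Wi23.
Proof.
apply: bop_ext => xi; apply: ell2_ext => -[[a b] c].
rewrite -[LHS]/(xi (a, (a^-1 * b)%g, (a^-1 * c)%g)).
rewrite -[RHS]/(xi (a, (a^-1 * b)%g, ((a^-1 * b) * (b^-1 * c))%g)).
by congr (xi (_, _)); rewrite mulgA mulgK.
Qed.

Definition rreg (t : G) : bop R G := perm_op (@mulIg G t).

Lemma rreg_commutant t : commutant (range (@lreg R G)) (rreg t).
Proof.
move=> _ [s _ <-]; apply: bop_ext => xi; apply: ell2_ext => a.
rewrite -[LHS]/(xi (s^-1 * (a * t))%g) -[RHS]/(xi ((s^-1 * a) * t)%g).
by rewrite mulgA.
Qed.

Lemma vox_ampr T x : (LG \vox LG) T -> commutant (range (@lreg R G)) x ->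
  T * ampr G x = ampr G x * T.
Proof.
move=> LT cx; apply: LT => _ [u Lu [v Lv <-]].
by rewrite -tens1l !tensM mul1r mulr1 Lv.
Qed.

Lemma vox_amp T x : (LG \vox LG) T -> commutant (range (@lreg R G)) x ->
  T * amp G x = amp G x * T.
Proof.
move=> LT cx; apply: LT => _ [u Lu [v Lv <-]].
by rewrite -tens1r !tensM mul1r mulr1 Lu.
Qed.

(** W is the direct sum over a of e_a (x) v_a, with e_a the projection onto [delta a], so its second
    leg lies in LG. *)
Lemma W_ampr x : commutant (range (@lreg R G)) x -> W * ampr G x = ampr G x * W.
Proof.
move=> cx; apply: bop_ext => xi; apply: ell2_ext => -[a b].
pose u := slice (pullback (can_inj (@swapK G G)) xi) a.
have h := cx _ (imageT (@lreg R G) a).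
rewrite -[LHS]/(x u (a^-1 * b)%g) -lregE -bopE -h.
by rewrite bopE amprE; congr (x _ b); apply: ell2_ext => c.
Qed.

(* [Wi23 * Sigma G * W23] is the pullback along (a, b, c) |-> (a, bc, c^-1): a
   right translation of the second leg, controlled by the third. *)
Lemma leg_twist T : (forall t, T * ampr G (rreg t) = ampr G (rreg t) * T) ->
  L12 T * (Wi23 * Sigma G * W23) = (Wi23 * Sigma G * W23) * L12 T.
Proof.
move=> cT; apply: bop_ext => xi.
have E eta c : slice ((Wi23 * Sigma G * W23) eta) c = ampr G (rreg c) (slice eta c^-1%g).
  apply: ell2_ext => -[a b].
  rewrite -[LHS]/(eta (a, (b * c)%g, ((b * c)^-1 * b)%g)).
  rewrite -[RHS]/(eta (a, (b * c)%g, c^-1%g)).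
  by congr (eta (_, _)); rewrite invgM mulgVK.
apply: slice_ext => c.
by rewrite bopE slice_L12 E [in RHS]bopE E slice_L12 -!bopE cT.
Qed.

End Group.

(** * Slices of the twisted unitary *)

Section Slicing.
Context {R : realType}.
Implicit Types (X I : choiceType).
Local Notation nrm := Normc.normc.

Lemma tensvPr X I a (v : ell2 R X) (xi eta : ell2 R I) :
  tensv v (a *: xi + eta) = a *: tensv v xi + tensv v eta.
Proof.
apply: ell2_ext => -[x i]; rewrite -[LHS]/(v x * (a * xi i + eta i)).
by rewrite -[RHS]/(a * (v x * xi i) + v x * eta i) mulrDr mulrCA.
Qed.

Lemma ell2_neq0 X (v : ell2 R X) : v <> 0 -> exists x, v x <> 0.
Proof.
move=> v0; apply: contrapT => hx; apply: v0; apply: ell2_ext => x.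
by apply: contrapT => vx; apply: hx; exists x.
Qed.

Lemma tensv_inj X I (v : ell2 R X) : v <> 0 -> injective (fun xi : ell2 R I => tensv v xi).
Proof.
move=> v0 xi eta h.
have [x vx] := ell2_neq0 v0.
apply: ell2_ext => i; have /eqP vx0 := vx; apply: (mulfI vx0).
by rewrite -[LHS]/(tensv v xi (x, i)) h.
Qed.

Definition pairr_inj X I (x : X) : injective (fun i : I => (x, i)).
Proof. by move=> a b []. Qed.

(** [w] is read off at one coordinate x0 where [v] does not vanish. The eigenvector property says
    that in [T (tensv v (delta j))] the dependence on the first coordinate is proportional to
    [v]. *)
Lemma eigen_slice X I (T : bop R (X * I)%type) (v : ell2 R X) : v <> 0 ->
  (forall i j, exists k : R[i], corner T i j v = k *: v) ->
  exists w : bop R I, forall zeta, T (tensv v zeta) = tensv v (w zeta).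
Proof.
move=> v0 ev.
have [x0 vx] := ell2_neq0 v0.
have /eqP vx0 := vx.
have [M M0 hM] := bop_bound T.
pose f (zeta : ell2 R I) : ell2 R I :=
  (v x0)^-1 *: pullback (@pairr_inj X I x0) (T (tensv v zeta)).
have fb : f \in @is_bop R I.
  apply: (@is_bopP _ _ _ (nrm (v x0)^-1 * (M * l2norm v))) => [a xi eta|xi].
    rewrite /f tensvPr linearP pullback_linear scalerDr !scalerA.
    by congr (_ *: _ + _); rewrite mulrC.
  rewrite /f l2normZ -!mulrA ler_wpM2l ?normc_ge0//.
  apply: le_trans (l2norm_pullback _ _) _; apply: le_trans (hM _) _.
  by rewrite l2norm_tensv.
exists (Bop fb) => zeta; apply: ell2_ext => -[x i].
have bf y c : bounded_functional (fun zeta : ell2 R I => c * T (tensv v zeta) (y, i)).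
  split=> [a xi eta|].
    rewrite tensvPr (bop_linear T).
    by rewrite -[LHS]/(c * (a * T (tensv v xi) (y, i) + T (tensv v eta) (y, i))) mulrDr mulrCA.
  exists (nrm c * (M * l2norm v)) => xi.
  rewrite Normc.normcM -!mulrA ler_wpM2l ?normc_ge0// -l2norm_tensv.
  exact: le_trans (normc_le_l2norm _ _) (hM _).
have E : (fun zeta : ell2 R I => 1 * T (tensv v zeta) (x, i)) =
    (fun zeta => (v x * (v x0)^-1) * T (tensv v zeta) (x0, i)).
  apply: functional_eq => // j.
  have [k hk] := ev i j.
  have hT y : T (tensv v (delta j)) (y, i) = k * v y.
    by rewrite -[LHS]/(corner T i j v y) hk.
  rewrite !hT mul1r -mulrA [(v x0)^-1 * _]mulrC -mulrA mulfV// mulr1 mulrC//.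
have /(congr1 (@^~ zeta)) := E; rewrite mul1r => ->.
by rewrite -mulrA.
Qed.

Lemma bop_corner_eq0 X I (T : bop R (X * I)%type) :
  (forall i j, corner T i j = 0) -> T = 0.
Proof.
move=> h; apply: bop_eq_delta => -[x j]; rewrite delta_tensv.
by apply: slice_ext => i; rewrite -cornerE h; apply: ell2_ext.
Qed.

Lemma perm_op_delta X (e e' : X -> X) (einj : injective e) x :
  cancel e e' -> cancel e' e -> perm_op einj (delta x) = delta (e' x) :> ell2 R X.
Proof.
by move=> eK e'K; apply: ell2_ext => y; rewrite perm_opE !deltaE (can2_eq eK e'K).
Qed.

(* Pairing with xi gives |K xi|^2 = c |K^* xi|^2, hence c > 0. *)
Lemma scaled_normal (X : choiceType) (K : bop R X) (c : R[i]) : K <> 0 -> nrm c = 1 ->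
  adj K * K = c *: (K * adj K) -> c = 1.
Proof.
move=> /bop_neq0[xi Kxi] c1 h.
have : dotp ((adj K * K) xi) xi = c * dotp ((K * adj K) xi) xi by rewrite h bopZE dotpZl.
rewrite !bopE adjPr (adjP K (adj K xi)) !dotp_self => E.
have n0 : 0 < l2norm (K xi) ^+ 2.
  by rewrite exprn_gt0// lt_neqAle l2norm_ge0 andbT eq_sym; apply/eqP => /l2norm_eq0.
case: c c1 {h} E => a b /= c1 [E1 E2]; move: E1 E2; rewrite !mulr0 subr0 add0r.
set k := l2norm (adj K xi) ^+ 2 => E1 /esym/eqP.
have k0 : 0 <= k by exact: sqr_ge0.
rewrite mulf_eq0 => /orP[/eqP b0|/eqP kz]; last by move: n0; rewrite E1 kz mulr0 ltxx.
have a0 : 0 < a.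
  rewrite ltNge; apply/negP => ale; move: n0; rewrite E1 ltNge => /negP; apply.
  by rewrite mulr_le0_ge0.
move: c1; rewrite b0 expr0n addr0 sqrtr_sqr ger0_norm ?ltW// => ->.
by [].
Qed.

End Slicing.

Section HilbertSchmidtCorners.
Context {R : realType} {G : groupType}.

(* Right-invariance turns the matrix of the corner into Fourier coefficients of
   T, so that its Hilbert-Schmidt norm is at most that of T (delta_1). *)
Lemma corner_hilbert_schmidt (T : bop R (G * G)%type) p q :
  (forall t, T * amp G (rreg t) = amp G (rreg t) * T) ->
  (forall t, T * ampr G (rreg t) = ampr G (rreg t) * T) ->
  hilbert_schmidt (corner (T * W) q p).
Proof.
move=> c1 c2; set y := T (delta (1%g, 1%g)).
have E s t : corner (T * W) q p (delta s) t = y (t * s^-1, q * (s * p)^-1)%g.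
  rewrite cornerE sliceE bopE -delta_tensv (perm_op_delta _ _ mmapK mmapVK).
  rewrite -[mmapV _]/(s, (s * p)%g); move: (s * p)%g => u.
  (* Every basis vector is a right translate of delta_(1,1) and [T] commutes with right translations
     in both legs, so all entries come from the one vector [y]. *)
  have -> : delta (s, u) = (amp G (rreg s^-1%g) * ampr G (rreg u^-1%g)) (delta (1%g, 1%g)) :> ell2 R (G * G)%type.
    apply: ell2_ext => -[a b].
    rewrite -[RHS]/(delta (1%g, 1%g) (a * s^-1, b * u^-1)%g) !deltaE !xpair_eqE.
    by rewrite !divg_eq1.
  rewrite -bopE mulrA c1 -mulrA c2 mulrA bopE -/y //.
(* With r = (t, s), the second component determines s, and then the first determines t. *)
pose e (r : G * G) := ((r.1 * r.2^-1)%g, (q * (r.2 * p)^-1)%g).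
have einj : injective e.
  move=> [t s] [t' s'] [h1 /mulgI/invg_inj/mulIg h2].
  by move: h1; rewrite h2 => /mulIg ->.
rewrite /hilbert_schmidt /hs.
apply: le_lt_trans (asboolW (ell2P y)); apply: le_trans (sqsum_inj y einj).
rewrite sqsum_slice; apply: le_esum => s _; rewrite -sqsumE.
by apply: le_esum => t _; rewrite E.
Qed.

End HilbertSchmidtCorners.

(** * The cocycle identity *)

Section RingIdentities.
Variable A : pzRingType.
Implicit Types a b p q s x y z : A.

Lemma conj_mul1 p q a b : q * p = 1 -> p * q = 1 -> a * b = 1 ->
  p * a * q * (p * b * q) = 1.
Proof.
move=> qp pq ab.
by rewrite !mulrA -(mulrA _ q p) qp mulr1 -(mulrA _ a b) ab mulr1.
Qed.

Lemma conj_insert p q a y z : q * p = 1 -> a * p * (y * z) = a * (p * y * q) * (p * z).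
Proof. by move=> qp; rewrite !mulrA -(mulrA _ q p) qp mulr1. Qed.

Lemma conj_fuse p q a y z : q * p = 1 ->
  a * (p * y * q) * (p * z * q) = a * p * (y * z) * q.
Proof. by move=> qp; rewrite !mulrA -(mulrA _ q p) qp mulr1. Qed.

(** Conjugation by s leaves p x q alone: s p x q s = p (q s p) x q s = p x (q s p) q s = p x q. Only
    [a] is conjugated. *)
Lemma conj_twist p q s a x : s * s = 1 -> p * q = 1 ->
  x * (q * s * p) = q * s * p * x -> s * (a * p * x * q) * s = s * a * s * p * x * q.
Proof.
move=> ss pq xF.
have -> : s * (a * p * x * q) * s = s * a * s * p * (q * s * p * x) * q * s.
  rewrite !mulrA -(mulrA _ p q) pq mulr1 -(mulrA _ s s) ss mulr1 //.
rewrite -xF !mulrA -(mulrA _ p q) pq mulr1 -(mulrA _ s s) ss mulr1 //.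
Qed.

End RingIdentities.

Section Cocycle.
Context {R : realType} {G : groupType}.
Implicit Types (S T : bop R (G * G)%type) (w : bop R G).
Local Notation nrm := Normc.normc.
Local Notation LG := (group_vN R G).
Local Notation W12 := (L12 W).
Local Notation Wi12 := (L12 Wi).
Local Notation W23 := (L23 W).
Local Notation Wi23 := (L23 Wi).

Lemma scaled_inverse (X : choiceType) (A B C D A' B' C' D' : bop R X) (e : R[i]) :
  e != 0 -> A * B = e *: (C * D) ->
  A * A' = 1 -> B * B' = 1 -> C' * C = 1 -> D' * D = 1 ->
  B' * A' = e^-1 *: (D' * C').
Proof.
move=> e0 h AA BB CC DD.
have : D' * C' * (A * B) * (B' * A') = D' * C'.
  by rewrite -!mulrA (mulrA B) BB mul1r AA mulr1.
rewrite h bopZr bopZl => <-; rewrite scalerA mulVf// scale1r.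
by rewrite !mulrA -(mulrA D') CC mulr1 DD mul1r.
Qed.

Variables (Omega Y : bop R (G * G)%type) (eta c : R[i]).
Hypothesis (YO : Y * Omega = 1) (OY : Omega * Y = 1) (eta0 : eta != 0).
Hypothesis cocycle : W12 * L13 Omega * Wi12 * L12 Omega =
  eta *: (W23 * L12 Omega * Wi23 * L23 Omega).

Let X := Y * W.

Lemma W12K : W12 * Wi12 = 1 :> bop R (G * G * G)%type.
Proof. by rewrite -L12M WK L12_1. Qed.
Lemma Wi12K : Wi12 * W12 = 1 :> bop R (G * G * G)%type.
Proof. by rewrite -L12M WiK L12_1. Qed.
Lemma W23K : W23 * Wi23 = 1 :> bop R (G * G * G)%type.
Proof. by rewrite -L23M WK L23_1. Qed.
Lemma Wi23K : Wi23 * W23 = 1 :> bop R (G * G * G)%type.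
Proof. by rewrite -L23M WiK L23_1. Qed.

Lemma cocycle_inv : L12 Y * (W12 * L13 Y * Wi12) =
  eta^-1 *: (L23 Y * (W23 * L12 Y * Wi23)).
Proof.
apply: (scaled_inverse eta0 cocycle).
- by apply: conj_mul1; [exact: Wi12K|exact: W12K|rewrite -L13M OY L13_1].
- by rewrite -L12M OY L12_1.
- by apply: conj_mul1; [exact: Wi23K|exact: W23K|rewrite -L12M YO L12_1].
- by rewrite -L23M YO L23_1.
Qed.

(** Inserting Wi_12 W_12 isolates the left side of [cocycle_inv], followed by W_12 W_13; the
    pentagon equation rewrites the latter so that a factor Wi_23 W_23 cancels. *)
Lemma leg_product : L12 X * L13 X = eta^-1 *: (L23 Y * W23 * L12 X * Wi23).
Proof.
rewrite /X L12M L13M (conj_insert _ _ _ Wi12K) cocycle_inv pentagon bopZl.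
by rewrite (conj_fuse _ _ _ Wi23K).
Qed.

(** Conjugating [leg_product] by [Sigma] reverses the product on the left. On the right, [leg_twist]
    and [conj_twist] leave only Y_23 to be flipped. *)
Lemma leg_commute : flip Y = c *: Y ->
  (forall t, X * ampr G (rreg t) = ampr G (rreg t) * X) ->
  L13 X * L12 X = c *: (L12 X * L13 X).
Proof.
move=> fY cX; rewrite L13_L12 leg_product bopZr bopZl scalerA mulrC -scalerA.
congr (_ *: _); rewrite (conj_twist _ (SigmaK G) W23K (leg_twist cX)).
by rewrite Sigma_L23 fY L23Z !bopZl.
Qed.

End Cocycle.

(** * Elimination of the scalar, and operators on vectors with a fixed first leg *)

Section FinalSteps.
Context {R : realType}.
Local Notation nrm := Normc.normc.

(** Here p stands for W, q for its inverse, O for Omega. Both sides of the cocycle identity are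
    multiplied by w (x) w (x) w. Each coboundary relation is used up to e^-1, twice on each side, so
    the sides become e^-2 and e e^-2 times the same nonzero operator [B0], the iterated
    comultiplication of w. *)
Lemma scalar_cocycle_trivial (X : choiceType)
    (p12 q12 p23 q23 p13 q13 O12 O13 O23 w1 w2 w3 : bop R X) (e : R[i]) :
  e != 0 -> w1 <> 0 ->
  p12 * q12 = 1 -> q12 * p12 = 1 -> p23 * q23 = 1 -> q23 * p23 = 1 ->
  p13 * q13 = 1 ->
  p12 * O13 * q12 * O12 = e *: (p23 * O12 * q23 * O23) ->
  O12 * (w1 * w2) = e^-1 *: (p12 * w1 * q12) ->
  O13 * (w1 * w3) = e^-1 *: (p13 * w1 * q13) ->
  O23 * (w2 * w3) = e^-1 *: (p23 * w2 * q23) ->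
  p12 * p13 = p23 * p12 * q23 ->
  q23 * w1 = w1 * q23 -> O23 * w1 = w1 * O23 -> q12 * w3 = w3 * q12 ->
  e = 1.
Proof.
move=> e0 w0 pq12 qp12 pq23 qp23 pq13 coc h12 h13 h23 pent c1 c2 c3.
pose B0 := p23 * p12 * w1 * q12 * q23.
have inv : q13 * q12 = p23 * q12 * q23.
  have QP : p23 * q12 * q23 * (p12 * p13) = 1.
    by rewrite pent !mulrA -(mulrA _ q23 p23) qp23 mulr1 -(mulrA _ q12 p12) qp12 mulr1.
  rewrite -[LHS]mul1r -QP -!mulrA (mulrA p13) pq13 mul1r pq12 mulr1 //.
(* Coassociativity at w, from the pentagon equation and its inverse. *)
have A0 : p12 * (p13 * w1 * q13) * q12 = B0.
  have -> : p12 * (p13 * w1 * q13) * q12 = p12 * p13 * w1 * (q13 * q12) by rewrite !mulrA.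
  rewrite pent inv /B0 !mulrA -(mulrA _ q23 w1) c1 !mulrA -(mulrA _ q23 p23) qp23 mulr1 //.
have EA : p12 * O13 * q12 * O12 * (w1 * w2 * w3) = (e^-1 * e^-1) *: B0.
  have -> : p12 * O13 * q12 * O12 * (w1 * w2 * w3) = p12 * O13 * q12 * (O12 * (w1 * w2)) * w3.
    by rewrite !mulrA.
  rewrite h12 bopZr bopZl -scalerA; congr (_ *: _).
  have -> : p12 * O13 * q12 * (p12 * w1 * q12) * w3 = p12 * (O13 * (w1 * w3)) * q12.
    by rewrite !mulrA -(mulrA _ q12 p12) qp12 mulr1 -(mulrA _ q12) c3 !mulrA.
  by rewrite h13 bopZr bopZl A0.
have EB : p23 * O12 * q23 * O23 * (w1 * w2 * w3) = (e^-1 * e^-1) *: B0.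
  have -> : p23 * O12 * q23 * O23 * (w1 * w2 * w3) = p23 * O12 * q23 * (w1 * (O23 * (w2 * w3))).
    by rewrite !mulrA -(mulrA _ O23 w1) c2 !mulrA.
  rewrite h23 !bopZr -scalerA; congr (_ *: _).
  have -> : p23 * O12 * q23 * (w1 * (p23 * w2 * q23)) = p23 * (O12 * (w1 * w2)) * q23.
    by rewrite !mulrA -(mulrA _ q23 w1) c1 !mulrA -(mulrA _ q23 p23) qp23 mulr1.
  by rewrite h12 bopZr bopZl /B0 !mulrA.
have BN : B0 <> 0.
  move=> B00; apply: w0.
  have -> : w1 = q12 * q23 * B0 * p23 * p12.
    rewrite /B0 !mulrA -(mulrA _ q23 p23) qp23 mulr1 -(mulrA _ q12 p12) qp12 mulr1.
    by rewrite -(mulrA _ q23 p23) qp23 mulr1 qp12 mul1r.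
  by rewrite B00 mulr0 !mul0r.
have : (e^-1 * e^-1) *: B0 = (e * (e^-1 * e^-1)) *: B0.
  by rewrite -EA coc bopZl EB scalerA.
move=> /eqP; rewrite -subr_eq0 -scalerBl scaler_eq0 => /orP[|/eqP//].
rewrite mulrA mulfV// mul1r subr_eq0 => /eqP h.
have /eqP : (e^-1 - 1) * e^-1 = 0 by rewrite mulrBl mul1r h subrr.
rewrite mulf_eq0 (negbTE (invr_neq0 e0)) orbF subr_eq0 => /eqP e1.
by rewrite -[e]invrK e1 invr1.
Qed.

Section FirstLegVector.
Variables (X : choiceType) (v : ell2 R X) (w : bop R X) (T : bop R (X * X)%type).
Hypothesis Tv : forall zeta, T (tensv v zeta) = tensv v (w zeta).

(** v (x) zeta with the legs regrouped to the left. On such vectors T_12, T_13 and S_23 act as w (x)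
    1, 1 (x) w and S on [zeta], so identities on three legs descend to two. *)
Definition tensv3 (zeta : ell2 R (X * X)%type) : ell2 R (X * X * X)%type :=
  pullback (can_inj (@reassocrK X X X)) (tensv v zeta).

Lemma L12_tensv3 zeta : L12 T (tensv3 zeta) = tensv3 (amp X w zeta).
Proof.
apply: slice_ext => k; rewrite slice_L12.
have E eta : slice (tensv3 eta) k = tensv v (slice eta k) by exact: ell2_ext.
by rewrite !E slice_amp Tv.
Qed.

Lemma L13_tensv3 zeta : L13 T (tensv3 zeta) = tensv3 (ampr X w zeta).
Proof.
pose sw (eta : ell2 R (X * X)%type) := pullback (can_inj (@swapK X X)) eta.
have E eta : Sigma X (tensv3 eta) = tensv3 (sw eta) by apply: ell2_ext => -[[x y] z].
by rewrite /L13 !bopE E L12_tensv3 E.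
Qed.

Lemma L23_tensv3 (S : bop R (X * X)%type) zeta : L23 S (tensv3 zeta) = tensv3 (S zeta).
Proof.
rewrite /L23 /assoc conj_bopE (_ : pullback _ (tensv3 zeta) = tensv v zeta).
  by rewrite ampr_tensv.
by apply: ell2_ext => -[x [y z]].
Qed.

Lemma tensv3Z a zeta : tensv3 (a *: zeta) = a *: tensv3 zeta.
Proof.
apply: ell2_ext => -[[x y] z].
by rewrite -[LHS]/(v x * (a * zeta (y, z))) mulrCA.
Qed.

Lemma tensv3_inj : v <> 0 -> injective tensv3.
Proof.
move=> v0 zeta zeta' /(congr1 (pullback (can_inj (@reassoclK X X X)))).
have E eta : pullback (can_inj (@reassoclK X X X)) (tensv3 eta) = tensv v eta.
  by apply: ell2_ext => -[x [y z]].
by rewrite !E => /(tensv_inj v0).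
Qed.

End FirstLegVector.

End FinalSteps.

Theorem theorem3p3 (R : realType) (G : groupType)
  (G_countable : countable [set: G])
  (Delta : bop R G -> bop R (G * G)%type)
  (DeltaP : comultiplication Delta)
  (Delta_id : bop R (G * G)%type -> bop R (G * G * G)%type)
  (Delta_idP : tensor_hom (group_vN R G) (group_vN R G)
     (group_vN R G \vox group_vN R G) (group_vN R G) Delta idfun Delta_id)
  (id_Delta : bop R (G * G)%type -> bop R (G * (G * G))%type)
  (id_DeltaP : tensor_hom (group_vN R G) (group_vN R G)
     (group_vN R G) (group_vN R G \vox group_vN R G) idfun Delta id_Delta)
  (Omega : bop R (G * G)%type)
  (Omega_vN : (group_vN R G \vox group_vN R G) Omega)
  (Omega_unitary : unitary Omega)
  (mu eta : R[i]) (mu_circle : `|mu| = 1) (eta_circle : `|eta| = 1)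
  (Omega_flip : flip Omega = mu *: Omega)
  (Omega_cocycle : Delta_id Omega * (Omega \ox (1 : bop R G)) =
     eta *: assoc (id_Delta Omega * ((1 : bop R G) \ox Omega))) :
  mu = 1 /\ eta = 1 /\
  exists w : bop R G,
    [/\ group_vN R G w, unitary w & Omega = Delta (adj w) * (w \ox w)].
Proof.
pose LG := group_vN R G; pose CL := commutant (range (@lreg R G)).
have DE := comultiplicationE DeltaP.
have coc : L12 W * L13 Omega * L12 Wi * L12 Omega =
    eta *: (L23 W * L12 Omega * L23 Wi * L23 Omega).
  rewrite -(Delta_idE DE Delta_idP Omega_vN) -(id_DeltaE DE id_DeltaP Omega_vN).
  by rewrite -[L12 Omega]tens1r Omega_cocycle tens1l /assoc conj_bopM.
have [YO OY] := Omega_unitary.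
pose Y := adj Omega; pose X := Y * W.
have eta0 : eta != 0 by rewrite -normr_eq0 eta_circle oner_eq0.
have Y_vN : (LG \vox LG) Y.
  apply: bicommutant_adj Omega_vN.
  by have [] := star_submonoid_tens (@star_submonoid_vN R G).
have fY : flip Y = conjc mu *: Y.
  by rewrite -adj_bopZ -Omega_flip /flip adj_conj_bop.
(* Second leg only: the first leg of W consists of multiplication operators, which in general do not
   commute with right translations. *)
have cX x : CL x -> X * ampr G x = ampr G x * X.
  by move=> cx; rewrite /X -mulrA W_ampr// mulrA (vox_ampr Y_vN cx) mulrA.
have comm := leg_commute YO OY eta0 coc fY (fun t => cX _ (rreg_commutant t)).
rewrite -/X in comm.
have XX : X * adj X = 1.
  by rewrite /X adj_bopM adjW adj_bopK mulrA -(mulrA Y) WK mulr1.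
have XX' : adj X * X = 1.
  by rewrite /X adj_bopM adjW adj_bopK mulrA -(mulrA Wi) OY mulr1 WiK.
have Xhs p q : hilbert_schmidt (corner X q p).
  apply: corner_hilbert_schmidt => t.
    exact: vox_amp Y_vN (rreg_commutant t).
  exact: vox_ampr Y_vN (rreg_commutant t).
have X0 : X <> 0.
  move=> X0; have := congr1 (fun T : bop R (G * G)%type => T (delta (1%g, 1%g))) XX.
  rewrite X0 mul0r bop0E bop1E => /(congr1 (fun xi : ell2 R (G * G)%type => xi (1%g, 1%g))).
  by rewrite deltaE eqxx => /esym/eqP; rewrite oner_eq0.
have [p [q K0]] : exists p q, corner X q p <> 0.
  apply: contrapT => h; apply: X0; apply: bop_corner_eq0 => i j.
  by apply: contrapT => hij; apply: h; exists j, i.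
have nmu : Normc.normc (conjc mu) = 1.
  by rewrite normc_conj; apply: complexI; exact: mu_circle.
have L12XX : L12 X * L12 (adj X) = 1 by rewrite -L12M XX L12_1.
have L12XX' : L12 (adj X) * L12 X = 1 by rewrite -L12M XX' L12_1.
(* Unitarity of [X]: multiplying [comm] by the adjoint of X_12 on both sides keeps the scalar and
   replaces X_12 by its adjoint. *)
have comm_adj : L12 (adj X) * L13 X = conjc mu *: (L13 X * L12 (adj X)).
  have := congr1 (fun T => L12 (adj X) * T * L12 (adj X)) comm.
  move: (L12 X) (L13 X) (L12 (adj X)) L12XX L12XX' => x y z xz zx.
  by rewrite /= bopZr bopZl !mulrA zx mul1r -!mulrA xz mulr1.
have mu1 : mu = 1.
  have c1 : conjc mu = 1.
    apply: (scaled_normal K0 nmu); rewrite adj_corner.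
    have cmu0 : conjc mu != 0 by rewrite conjc_eq0 -normr_eq0 mu_circle oner_eq0.
    have h : L13 X * L12 (adj X) = (conjc mu)^-1 *: (L12 (adj X) * L13 X).
      by rewrite comm_adj scalerA mulVf// scale1r.
    by rewrite (corner_comm h) scalerA mulfV// scale1r.
  by rewrite -[mu]conjcK c1 conjc1.
split=> //; rewrite mu1 conjc1 !scale1r in comm comm_adj.
have corner_c i j i' j' : corner X i' j' * corner X i j = corner X i j * corner X i' j'.
  by rewrite (@corner_comm _ _ X X 1) ?scale1r.
have corner_c' i j i' j' :
    corner X i' j' * corner (adj X) i j = corner (adj X) i j * corner X i' j'.
  by rewrite (@corner_comm _ _ (adj X) X 1) ?scale1r.
pose KK : set (bop R G) := [set K | exists i j, K = corner X i j \/ K = corner (adj X) i j].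
have KK_adj K : KK K -> KK (adj K).
  move=> [i [j [->|->]]]; exists j, i; rewrite adj_corner ?adj_bopK; [by right|by left].
have KK_comm K L : KK K -> KK L -> K * L = L * K.
  move=> [i [j [->|->]]] [k [l [->|->]]].
  - by rewrite corner_c.
  - by rewrite corner_c'.
  - by rewrite corner_c'.
  - by rewrite -!adj_corner -!adj_bopM corner_c.
have KK_hs K : KK K -> hilbert_schmidt K.
  move=> [i [j [->|->]]]; first exact: Xhs.
  (* Corners of [X] are normal by [corner_c'], so an adjoint corner has the same norm as the corner
     on every vector. *)
  apply: (@hs_le _ _ _ (corner X j i) 1) (Xhs i j) => x; rewrite mul1r.
  rewrite -(@ler_pXn2r _ 2) ?nnegrE ?l2norm_ge0// -lecR -!dotp_self.
  by rewrite -adj_corner adjPr (adjP (corner X j i)) -!bopE adj_corner corner_c'.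
have KKn0 : exists2 K, KK K & K <> 0.
  by exists (corner X q p) => //; exists q, p; left.
have [v v0 hv] := hs_common_eigenvector KK_adj KK_comm KK_hs KKn0.
have [w hw] : exists w : bop R G, forall zeta, X (tensv v zeta) = tensv v (w zeta).
  by apply: (eigen_slice v0) => i j; apply: hv; exists i, j; left.
have [w' hw'] : exists w : bop R G, forall zeta, adj X (tensv v zeta) = tensv v (w zeta).
  by apply: (eigen_slice v0) => i j; apply: hv; exists i, j; right.
have ww' : w * w' = 1.
  by apply: bop_ext => zeta; apply: (tensv_inj v0);
    rewrite -[LHS]/(tensv v (w (w' zeta))) -hw -hw' -bopE XX.
have w'w : w' * w = 1.
  by apply: bop_ext => zeta; apply: (tensv_inj v0);
    rewrite -[LHS]/(tensv v (w' (w zeta))) -hw' -hw -bopE XX'.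
have adjw : adj w = w'.
  apply: adj_unique => x y; have /eqP vv : dotp v v <> 0 by move/dotp_eq0.
  by apply: (mulfI vv); rewrite -!dotp_tensv -hw adjP hw'.
(* [X] commutes with 1 (x) S for S in the commutant; evaluating on v (x) zeta transfers this to
   [w]. *)
have Lw : LG w.
  move=> S CS; apply: bop_ext => zeta; apply: (tensv_inj v0).
  rewrite -[LHS]/(tensv v (w (S zeta))) -[RHS]/(tensv v (S (w zeta))).
  by rewrite -hw -(ampr_tensv S v zeta) -(ampr_tensv S v (w zeta)) -hw -!bopE cX.
(* [leg_product] evaluated on v (x) zeta: the left side becomes w (x) w, and v is cancelled by
   injectivity. *)
have hN : tens w w = eta^-1 *: (Y * (W * amp G w * Wi)).
  apply: bop_ext => zeta; apply: (tensv3_inj v0).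
  rewrite tensE bopE -(L12_tensv3 hw) -(L13_tensv3 hw) -bopE.
  rewrite (leg_product YO OY eta0 coc) bopZE !bopE L23_tensv3 (L12_tensv3 hw) !L23_tensv3.
  by rewrite bopZE tensv3Z.
have hD : Omega * (amp G w * ampr G w) = eta^-1 *: (W * amp G w * Wi).
  by rewrite -tensE hN bopZr mulrA OY mul1r.
have w1n0 : leg1 w <> 0.
  move=> w10; have : leg1 w * leg1 w' = 1 by rewrite -L12M -ampM ww' amp1 L12_1.
  rewrite w10 mul0r.
  move=> /(congr1 (fun T : bop R (G * G * G)%type => T (delta (1%g, 1%g, 1%g)) (1%g, 1%g, 1%g))).
  by rewrite bop0E bop1E deltaE eqxx => /esym/eqP; rewrite oner_eq0.
have eta1 : eta = 1.
  apply: (@scalar_cocycle_trivial R _ (L12 W) (L12 Wi) (L23 W) (L23 Wi) (L13 W) (L13 Wi)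
    (L12 Omega) (L13 Omega) (L23 Omega) (leg1 w) (leg2 w) (leg3 w) eta eta0 w1n0
    (@W12K R G) (@Wi12K R G) (@W23K R G) (@Wi23K R G) _ coc _ _ _ (@pentagon R G)).
  - by rewrite -L13M WK L13_1.
  - by rewrite -[leg1 w * leg2 w]L12M -L12M hD L12Z !L12M.
  - by rewrite -L13_amp -L13_ampr -!L13M hD L13Z.
  - by rewrite -L23_amp -L23_ampr -!L23M hD L23Z.
  - by rewrite L23_leg1.
  - by rewrite L23_leg1.
  - by rewrite L12_leg3.
(* With eta = 1, [hD] reads Omega (w (x) w) = Delta w, so the unitary of the statement is the
   adjoint of [w]. *)
split=> //; exists (adj w); split.
- exact: group_vN_adj.
- by rewrite /unitary adj_bopK adjw.
- rewrite adj_bopK DE// adjw.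
  have -> : W * amp G w * Wi = Omega * tens w w.
    by rewrite tensE hD eta1 invr1 scale1r.
  by rewrite -mulrA tensM ww' tens11 mulr1.
Qed.
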